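(* Let $G$ be one of the classical compact simply connected Lie groups, with the bi-invariant Riemannian metric given by the inner product $\langle X,Y\rangle=-\operatorname{Tr}(XY)$ on $\mathfrak g$. The injectivity radius of $G$ is $\sqrt2\,\pi$ for $\mathrm{SU}(m+1)$ ($m\ge1$) and $\mathrm{Sp}(m)$ ($m\ge 3$), and it is $2\pi$ for the simply connected groups $\mathrm{Spin}(2m)$ ($m\ge 4$) and $\mathrm{Spin}(2m+1)$ ($m\ge2$) of the series $\mathrm{SO}(2m)$ and $\mathrm{SO}(2m+1)$. In particular, for each of the four classical series the injectivity radius is independent of $m$.
   Context: The trace is taken in the standard matrix realization: $\mathfrak{su}(m+1)$ as $(m+1)\times(m+1)$ complex matrices, $\mathfrak{sp}(m)$ as $2m\times 2m$ complex matrices, $\mathfrak{so}(N)$ as $N\times N$ real skew-symmetric matrices. $\mathrm{Sp}(m)$ is the compact symplectic group of rank $m$. The injectivity radius is that of the Riemannian exponential map (which at the identity is the Lie group exponential). *)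

(* Defs.v *)
From HB Require Import structures.
From mathcomp Require Import all_boot all_order all_algebra.
From mathcomp Require Import spectral complex.
From mathcomp Require Import boolp classical_sets reals ereal.
From mathcomp Require Import topology normedtype sequences derive trigo.

Set Implicit Arguments.
Unset Strict Implicit.
Unset Printing Implicit Defensive.

Import Order.TTheory GRing.Theory Num.Theory.
Import numFieldNormedType.Exports.

Local Open Scope classical_set_scope.
Local Open Scope ring_scope.
Local Open Scope sesquilinear_scope.
Local Open Scope complex_scope.

(* C^k maps on a subset U of a finite-dimensional space V, by iterated
   directional derivatives; meant for open U. *)
Fixpoint Ck (R : realType) (V W : normedModType R) (k : nat) (U : set V)
    (f : V -> W) : Prop :=
  match k with
  | 0 => forall x, U x -> {for x, continuous f}
  | k'.+1 => (forall x, U x -> differentiable f x) /\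
             (forall v : V, Ck k' U (fun x => 'D_v f x))
  end.

Definition smooth_on_open (R : realType) (V W : normedModType R) (U : set V)
  (f : V -> W) : Prop := forall k, Ck k U f.

(* exp of x in a normed algebra, the powers of x being given by pow *)
Definition exp_of_powers (K : numFieldType) (V : normedModType K)
    (pow : nat -> V) : V :=
  lim ((\sum_(k < n) (k`!%:R)^-1 *: pow k) @[n --> \oo]).

(* A Lie group G embedded in a finite-dimensional real algebra A (which may
   have additional structure, such as complex matrices), its Lie algebra
   T_1 G seen inside A, the exponential of A, and a bi-invariant metric given
   by its value at the identity.  The injective map lie_coord gives linear
   real coordinates on A, through which smoothness is tested. *)
Record lie_group (R : realType) := LieGroup {
  lie_ambient : pzRingType;
  lie_space : normedModType R;
  lie_coord : lie_ambient -> lie_space;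
  lie_exp : lie_ambient -> lie_ambient;
  lie_points : set lie_ambient;
  lie_algebra : set lie_ambient;
  lie_inner : lie_ambient -> lie_ambient -> R }.

Section InjectivityRadius.
Variables (R : realType) (L : lie_group R).
Local Notation A := (lie_ambient L).
Local Notation V := (lie_space L).
Local Notation rho := (@lie_coord R L).

(* A map on an arbitrary subset S of a Euclidean space is smooth when it
   extends locally to a smooth map on an open set. *)
Definition smooth_on (S : set A) (f : A -> A) : Prop :=
  forall X, S X -> exists (U : set V) (h : V -> V),
    [/\ open U, U (rho X), smooth_on_open U h &
        forall Y, S Y -> U (rho Y) -> h (rho Y) = rho (f Y)].

Definition diffeo_onto_image (S : set A) (f : A -> A) : Prop :=
  smooth_on S f /\
  exists g : A -> A, (forall X, S X -> g (f X) = X) /\ smooth_on (f @` S) g.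

Definition lie_norm (X : A) : R := Num.sqrt (lie_inner X X).

Definition lie_ball (r : R) : set A :=
  [set X | lie_algebra X /\ lie_norm X < r].

(* The Riemannian exponential at p for a bi-invariant metric.  The tangent
   space at p is p * lie_algebra, which the left translation X |-> p * X
   identifies isometrically with lie_algebra. *)
Definition riemannian_exp (p X : A) : A := p * lie_exp X.

Definition injectivity_radius_at (p : A) : \bar R :=
  ereal_sup [set r%:E | r in
    [set r : R | 0 < r /\ diffeo_onto_image (lie_ball r) (riemannian_exp p)]].

Definition injectivity_radius : \bar R :=
  ereal_inf [set injectivity_radius_at p | p in @lie_points R L].

End InjectivityRadius.

Section ComplexMatrixGroups.
Variable R : realType.
Local Notation C := (R[i]).

Definition mxReIm n (X : 'M[C]_n) : 'M[R]_(n, n + n) :=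
  row_mx (map_mx (@complex.Re R) X) (map_mx (@complex.Im R) X).

Definition expmx n (X : 'M[C]_n) : 'M[C]_n :=
  exp_of_powers (fun k => X ^+ k : 'M[C]_n).

(* The trace form is real on anti-Hermitian matrices. *)
Definition trace_form n (X Y : 'M[C]_n) : R := complex.Re (- \tr (X *m Y)).

Definition SU (n : nat) : lie_group R :=
  @LieGroup R 'M[C]_n 'M[R]_(n, n + n) (@mxReIm n) (@expmx n)
    [set X | X \is unitarymx /\ \det X = 1]
    [set X | X^t* = - X /\ \tr X = 0]
    (@trace_form n).

Definition symplectic_form m : 'M[C]_(m + m) :=
  block_mx 0 1%:M (- 1%:M) 0.

Definition Sp (m : nat) : lie_group R :=
  @LieGroup R 'M[C]_(m + m) 'M[R]_(m + m, (m + m) + (m + m))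
    (@mxReIm (m + m)) (@expmx (m + m))
    [set X | X \is unitarymx /\
             X^T *m symplectic_form m *m X = symplectic_form m]
    [set X | X^t* = - X /\
             X^T *m symplectic_form m + symplectic_form m *m X = 0]
    (@trace_form (m + m)).

End ComplexMatrixGroups.

(* The Clifford algebra of R^N with e_i * e_i = -1.  Its basis is indexed by
   the subsets of 'I_N, the basis vector of A being the product of the e_i,
   i in A, in increasing order. *)
Definition clifford (R : realType) (N : nat) : Type :=
  'rV[R]_#|{: {set 'I_N}}|.

HB.instance Definition _ (R : realType) (N : nat) :=
  NormedModule.copy (clifford R N) 'rV[R]_#|{: {set 'I_N}}|.

Section Clifford.
Variables (R : realType) (N : nat).
Local Notation cl := (clifford R N).
Implicit Types (x y z : cl) (A B D : {set 'I_N}).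

Definition clbase A : cl := delta_mx 0 (enum_rank A).
Definition clcoef x A : R := (x : 'rV[R]__) 0 (enum_rank A).

Definition symdiff A B : {set 'I_N} := ((A :\: B) :|: (B :\: A))%SET.

(* Sorting the product of the basis vectors of A and B exchanges each pair
   j < i, with i in A and j in B; each index common to A and B then gives
   a factor e_i * e_i = -1. *)
Definition clsign A B : R :=
  \prod_(i in A) \prod_(j in B | (j <= i)%N) -1.

Definition clmul x y : cl :=
  \sum_A \sum_B (clcoef x A * clcoef y B * clsign A B) *: clbase (symdiff A B).

Lemma in_symdiff A B i : (i \in symdiff A B) = (i \in A) (+) (i \in B).
Proof. by rewrite !inE; case: (i \in A); case: (i \in B). Qed.

Lemma symdiffA A B D : symdiff A (symdiff B D) = symdiff (symdiff A B) D.
Proof. by apply/setP=> i; rewrite !in_symdiff addbA. Qed.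

Lemma symdiff0 A : symdiff finset.set0 A = A.
Proof. by apply/setP=> i; rewrite in_symdiff inE. Qed.

Lemma symdiffr0 A : symdiff A finset.set0 = A.
Proof. by apply/setP=> i; rewrite in_symdiff inE addbF. Qed.

Lemma clsignE A B : clsign A B =
  \prod_i \prod_j (-1) ^+ [&& i \in A, j \in B & (j <= i)%N].
Proof.
rewrite /clsign big_mkcond /=; apply: eq_bigr => i _.
case: (i \in A) => /=; last by rewrite big1.
rewrite big_mkcond /=; apply: eq_bigr => j _.
by case: (_ && _).
Qed.

Lemma clsignDl A B D : clsign (symdiff A B) D = clsign A D * clsign B D.
Proof.
rewrite !clsignE -big_split /=; apply: eq_bigr => i _.
rewrite -big_split /=; apply: eq_bigr => j _.
by rewrite -signr_addb in_symdiff andb_addl.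
Qed.

Lemma clsignDr A B D : clsign A (symdiff B D) = clsign A B * clsign A D.
Proof.
rewrite !clsignE -big_split /=; apply: eq_bigr => i _.
rewrite -big_split /=; apply: eq_bigr => j _.
by rewrite -signr_addb in_symdiff andb_addl andb_addr.
Qed.

Lemma clsign0l A : clsign finset.set0 A = 1.
Proof. by rewrite /clsign big1 // => i; rewrite inE. Qed.

Lemma clsign0r A : clsign A finset.set0 = 1.
Proof.
rewrite /clsign big1 // => i _; rewrite big1 // => j.
by rewrite inE.
Qed.

Lemma clcoef_base A B : clcoef (clbase A) B = (B == A)%:R.
Proof. by rewrite /clcoef mxE eqxx /= (inj_eq enum_rank_inj). Qed.

Lemma clcoefD x y A : clcoef (x + y) A = clcoef x A + clcoef y A.
Proof. by rewrite /clcoef mxE. Qed.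

Lemma clcoefZ a x A : clcoef (a *: x) A = a * clcoef x A.
Proof. by rewrite /clcoef mxE. Qed.

Lemma clexpand x : x = \sum_A clcoef x A *: clbase A.
Proof.
rewrite /clbase /clcoef [LHS](row_sum_delta x).
rewrite (reindex (@enum_rank {set 'I_N})) //=.
exact: onW_bij (@enum_rank_bij _).
Qed.

Lemma clmulDl : left_distributive clmul +%R.
Proof.
move=> x y z; rewrite /clmul -big_split /=; apply: eq_bigr => A _.
rewrite -big_split /=; apply: eq_bigr => B _.
by rewrite clcoefD !mulrDl scalerDl.
Qed.

Lemma clmulDr : right_distributive clmul +%R.
Proof.
move=> x y z; rewrite /clmul -big_split /=; apply: eq_bigr => A _.
rewrite -big_split /=; apply: eq_bigr => B _.
by rewrite clcoefD mulrDr mulrDl scalerDl.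
Qed.

Lemma clmulZl a x y : clmul (a *: x) y = a *: clmul x y.
Proof.
rewrite /clmul scaler_sumr; apply: eq_bigr => A _.
rewrite scaler_sumr; apply: eq_bigr => B _.
by rewrite clcoefZ scalerA !mulrA.
Qed.

Lemma clmulZr a x y : clmul x (a *: y) = a *: clmul x y.
Proof.
rewrite /clmul scaler_sumr; apply: eq_bigr => A _.
rewrite scaler_sumr; apply: eq_bigr => B _.
by rewrite clcoefZ scalerA !mulrA [_ * a]mulrC.
Qed.

Lemma clmul0l y : clmul 0 y = 0.
Proof. by have := clmulZl 0 0 y; rewrite !scale0r. Qed.

Lemma clmul0r x : clmul x 0 = 0.
Proof. by have := clmulZr 0 x 0; rewrite !scale0r. Qed.

Lemma clmul_suml (I : finType) (F : I -> cl) y :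
  clmul (\sum_i F i) y = \sum_i clmul (F i) y.
Proof.
by apply: (big_morph (clmul^~ y)); [move=> u v; exact: clmulDl|exact: clmul0l].
Qed.

Lemma clmul_sumr (I : finType) (F : I -> cl) x :
  clmul x (\sum_i F i) = \sum_i clmul x (F i).
Proof.
by apply: (big_morph (clmul x)); [move=> u v; exact: clmulDr|exact: clmul0r].
Qed.

Lemma clmul_base A B :
  clmul (clbase A) (clbase B) = clsign A B *: clbase (symdiff A B).
Proof.
rewrite /clmul (bigD1 A) //= (bigD1 B) //= !clcoef_base !eqxx !mul1r.
rewrite big1 ?addr0; last first.
  by move=> D nD; rewrite !clcoef_base (negPf nD) mulr0 mul0r scale0r.
rewrite big1 ?addr0 // => D nD; rewrite big1 // => E _.
by rewrite !clcoef_base (negPf nD) !mul0r scale0r.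
Qed.

Lemma clifford_ind (P : cl -> Prop) :
  P 0 -> (forall x y, P x -> P y -> P (x + y)) ->
  (forall a x, P x -> P (a *: x)) -> (forall A, P (clbase A)) ->
  forall x, P x.
Proof.
move=> P0 PD PZ Pb x; rewrite (clexpand x).
by elim/big_ind: _ => // A _; exact/PZ/Pb.
Qed.

Lemma clmulA : associative clmul.
Proof.
move=> x y z; elim/clifford_ind: x => [|x x' IH IH'|a x IH|A].
- by rewrite !clmul0l.
- by rewrite !clmulDl IH IH'.
- by rewrite !clmulZl IH.
elim/clifford_ind: y => [|y y' IH IH'|a y IH|B].
- by rewrite clmul0l !clmul0r clmul0l.
- by rewrite clmulDr !clmulDl clmulDr IH IH'.
- by rewrite clmulZr !clmulZl clmulZr IH.
elim/clifford_ind: z => [|z z' IH IH'|a z IH|D].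
- by rewrite !clmul0r.
- by rewrite !clmulDr IH IH'.
- by rewrite !clmulZr IH.
rewrite !clmul_base clmulZr clmulZl !clmul_base !scalerA symdiffA.
by rewrite clsignDl clsignDr mulrCA [clsign A D * _]mulrC.
Qed.

Lemma clmul1l : left_id (clbase finset.set0) clmul.
Proof.
move=> x; rewrite {2}(clexpand x) {1}(clexpand x) clmul_sumr.
apply: eq_bigr => A _.
by rewrite clmulZr clmul_base clsign0l symdiff0 scale1r.
Qed.

Lemma clmul1r : right_id (clbase finset.set0) clmul.
Proof.
move=> x; rewrite {2}(clexpand x) {1}(clexpand x) clmul_suml.
apply: eq_bigr => A _.
by rewrite clmulZl clmul_base clsign0r symdiffr0 scale1r.
Qed.

Lemma clbase0_neq0 : clbase finset.set0 != 0.
Proof.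
apply/eqP=> /(congr1 (clcoef ^~ finset.set0)).
by rewrite clcoef_base eqxx /clcoef mxE => /eqP; rewrite oner_eq0.
Qed.

HB.instance Definition _ := GRing.Zmodule_isNzRing.Build cl
  clmulA clmul1l clmul1r clmulDl clmulDr clbase0_neq0.

HB.instance Definition _ :=
  GRing.Lmodule_isLalgebra.Build R cl (fun a x y => esym (clmulZl a x y)).

HB.instance Definition _ :=
  GRing.Lalgebra_isAlgebra.Build R cl (fun a x y => esym (clmulZr a x y)).

Definition clgen (i : 'I_N) : cl := clbase [set i]%SET.

Lemma clgen_relation i j :
  clgen i * clgen j + clgen j * clgen i = (- (i == j)%:R *+ 2) *: 1.
Proof.
have sgE k l : clsign [set k]%SET [set l]%SET = (-1) ^+ (l <= k)%N.
  rewrite /clsign big_set1; have [lk|lk] := boolP (l <= k)%N.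
    rewrite (bigD1 l) /= ?inE ?eqxx ?lk // big1 ?mulr1 // => m.
    by rewrite !inE => /andP[/andP[->]].
  rewrite big1 // => m; rewrite !inE => /andP[/eqP ->] lk'.
  by rewrite lk' in lk.
have mulE k l : clgen k * clgen l =
    (-1) ^+ (l <= k)%N *: clbase (symdiff [set k] [set l])%SET.
  by rewrite -sgE -clmul_base.
rewrite !mulE; have -> : symdiff [set j]%SET [set i]%SET =
    symdiff [set i]%SET [set j]%SET.
  by apply/setP => k; rewrite !in_symdiff addbC.
rewrite -scalerDl; have [<-|nij] := eqVneq i j; last first.
  rewrite oppr0 mul0rn scale0r; case: (ltngtP i j) => [||/val_inj eij].
  - by rewrite expr0 expr1 subrr scale0r.
  - by rewrite expr0 expr1 addNr scale0r.
  - by rewrite eij eqxx in nij.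
rewrite leqnn expr1 mulr2n; congr (_ *: clbase _).
by apply/setP => k; rewrite in_symdiff addbb inE.
Qed.

Definition clvec (v : 'rV[R]_N) : cl := \sum_i v 0 i *: clgen i.

Definition clexp x : cl := exp_of_powers (fun k => x ^+ k).

(* The map v |-> x * v - v * x on R^N, for x a bivector; on bivectors this is
   the differential at 1 of the covering of SO(N) by Spin(N), which sends g to
   v |-> g * v * g^-1, and so identifies them with so(N). *)
Definition spin_to_so x : 'M[R]_N :=
  \matrix_(i, j) clcoef (x * clgen j - clgen j * x) [set i]%SET.

Definition Spin : lie_group R :=
  @LieGroup R cl cl id clexp
    [set x | exists s : seq 'rV[R]_N,
      [/\ ~~ odd (size s), (forall v, v \in s -> v *m v^T = 1%:M) &
          x = \prod_(v <- s) clvec v]]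
    [set x | exists b : 'M[R]_N,
      x = \sum_(i < N) \sum_(j < N | (i < j)%N) b i j *: (clgen i * clgen j)]
    (fun x y => - \tr (spin_to_so x *m spin_to_so y)).

End Clifford.

(* Main.v *)
(* Let r be the claimed radius.  In each of the groups, spectral theory gives
   two facts on the Lie algebra: if |X| < r and e^X commutes with Y, then X
   commutes with Y; and if |Z| < 2 r and e^Z = 1, then Z = 0.  If e^X = e^Y with
   |X|, |Y| < r, then X and Y commute, e^(X - Y) = 1 and so X = Y.  If the
   derivative of exp at X kills Y, then Y commutes with e^X, hence with X, and
   the derivative is Y e^X, so that Y = 0.  Thus exp is an injective immersion of
   every closed ball of radius less than r, and the inverse function theorem and
   compactness provide local smooth extensions of its inverse.  Conversely, some
   X with |X| = r satisfies X^3 = - pi^2 X, and then e^X = e^(-X) by Rodrigues'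
   formula: X = diag (i pi, - i pi, 0, ...) for SU, its analogue for Sp, and
   (pi / 2) (e_0 e_1 + e_2 e_3) in the Clifford algebra for Spin. *)

From HB Require Import structures.
Require Import Defs.
From mathcomp Require Import all_boot all_order all_algebra.
From mathcomp Require Import spectral complex.
From mathcomp Require Import boolp classical_sets functions reals ereal.
From mathcomp Require Import topology normedtype sequences landau.
From mathcomp Require Import derive realfun exp trigo.
From mathcomp Require Import ring lra.

Set Implicit Arguments.
Unset Strict Implicit.
Unset Printing Implicit Defensive.

Import Order.TTheory GRing.Theory Num.Theory.
Import numFieldNormedType.Exports.

Local Open Scope classical_set_scope.
Local Open Scope ring_scope.

(** The radii come from eigenvalues. If X is skew-Hermitian with eigenvalues i t_j, its exponential
    commutes with more than X does only when some t_j - t_k is a nonzero multiple of 2 pi; since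
    (t_j - t_k)^2 <= 2 |X|^2, this cannot happen below sqrt 2 pi. For Spin, |X| is the norm of a
    real skew matrix W acting on R^N. The nonreal eigenvalues of W come in conjugate pairs, both
    counted in |W|, and this raises the radius to 2 pi. A given eigenbasis need not respect the
    pairs when eigenvalues repeat, so nothing is paired: the bound (t_j + t_k)^2 <= |W|^2 is proved
    instead. The threshold 2 r for e^Z = 1 is the cost of two full turns. In SU these are two
    nonzero eigenvalues of modulus 2 pi, a single one being excluded by the trace; in Spin they are
    two planes turned by 2 pi, a single one being excluded because it lifts to -1. The factor 2
    itself is the parallelogram law applied to X - Y. Sp (m) needs no spectral theory of its own,
    its Lie algebra being contained in su (2m). *)

(** * Differential calculus: closure properties of C^k maps *)

Lemma differentiable_eps (R : realType) (V W : normedModType R) (f : V -> W)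
    (df : {linear V -> W}) (x : V) :
  continuous df ->
  (forall e, 0 < e ->
     \forall h \near 0, `|f (h + x) - f x - df h| <= e * `|h|) ->
  differentiable f x /\ 'd f x = df :> (V -> W).
Proof.
move=> cdf fdf.
have loc : f \o shift x = cst (f x) + df +o_ 0 id.
  apply/eqaddoP => e e0; near=> h; rewrite /=.
  have -> : (f \o shift x - (cst (f x) + df)) h = f (h + x) - f x - df h.
    by rewrite -addrA -opprD.
  by near: h; exact: fdf.
have dE : 'd f x = df :> (V -> W) by exact: diff_unique.
by split=> //; apply/diff_locallyP; rewrite dE.
Unshelve. all: by end_near. Qed.

Lemma near_eq_diff (R : realType) (V W : normedModType R) (f g : V -> W)
    (x : V) :
  (\near x, f x = g x) -> differentiable f x -> differentiable g x.
Proof.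
move=> fg dfx; have [cf /eqaddoP fo] := (diff_locallyP _ _).1 dfx.
apply: (proj1 (@differentiable_eps _ _ _ g ('d f x) x cf _)) => e e0.
rewrite -(nbhs_singleton fg).
have := fo _ e0; near_simpl => fo'; near=> h.
have <- : f (h + x) = g (h + x).
  by near: h; have := (nbhs0P _ _).1 fg; under eq_near do rewrite addrC.
have -> : f (h + x) - f x - 'd f x h = (f \o shift x - (cst (f x) + 'd f x)) h.
  by rewrite /= -addrA -opprD.
by near: h.
Unshelve. all: by end_near. Qed.

Section CkTheory.
Variable R : realType.
Implicit Types V W : normedModType R.

Lemma mxlin_continuous m n W (f : {linear 'M[R]_(m, n) -> W}) : continuous f.
Proof.
have -> : (f : _ -> _) = fun y => \sum_i \sum_j y i j *: f (delta_mx i j).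
  apply/funext => y; rewrite {1}[y]matrix_sum_delta linear_sum.
  by apply: eq_bigr => i _; rewrite linear_sum; apply: eq_bigr => j _; rewrite linearZ.
apply: continuous_big => [|i _]; first exact: add_continuous.
apply: continuous_big => [|j _ x]; first exact: add_continuous.
apply: (@cvgZr_tmp _ _ _ (nbhs x)); exact: coord_continuous.
Qed.

(** Openness of [U] makes equality on [U] an equality of germs, which is all that derivatives see;
    this lets each derivative below be replaced by its closed formula. *)
Lemma Ck_eq V W k (U : set V) (f g : V -> W) :
  open U -> {in U, f =1 g} -> Ck k U f -> Ck k U g.
Proof.
move=> oU; elim: k f g => [|k IH] f g fg /=.
  move=> cf x Ux; have := cf x Ux; rewrite /prop_for /continuous_at (fg x) ?inE//.
  apply: cvg_trans; apply: near_eq_cvg.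
  by near=> y; apply: fg; rewrite inE; near: y; exact: open_nbhs_nbhs.
have ngf x : U x -> \near x, f x = g x.
  move=> Ux; near=> y; apply: fg; rewrite inE.
  by near: y; exact: open_nbhs_nbhs.
move=> [df Df]; split=> [x Ux|v].
  by apply: near_eq_diff (df x Ux); exact: ngf.
apply: IH (Df v) => x; rewrite inE => Ux.
by apply: near_eq_derive; exact: ngf.
Unshelve. all: by end_near. Qed.

Lemma Ck_sub V W k (U U' : set V) (f : V -> W) :
  U' `<=` U -> Ck k U f -> Ck k U' f.
Proof.
move=> sub; elim: k f => [|k IH] f /=; first by move=> cf x /sub; exact: cf.
by move=> [df Df]; split=> [x /sub|v]; [exact: df|exact: IH].
Qed.

Lemma CkW V W k (U : set V) (f : V -> W) : Ck k.+1 U f -> Ck k U f.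
Proof.
elim: k f => [|k IH] f /= [df Df].
  by move=> x Ux; exact/differentiable_continuous/df.
by split=> // v; apply: IH; exact: Df.
Qed.

Lemma Ck_cst V W k (U : set V) (w : W) : Ck k U (cst w).
Proof.
elim: k w => [|k IH] w /=; first by move=> x _; exact: cst_continuous.
split=> [x _|v]; first exact: differentiable_cst.
by rewrite (_ : (fun x => _) = cst 0) //; apply/funext => x; rewrite derive_cst.
Qed.

Lemma Ck_lin V W k (U : set V) (f : {linear V -> W}) :
  continuous f -> Ck k U f.
Proof.
move=> cf; case: k => [|k] /=; first by move=> x _; exact: cf.
split=> [x _|v]; first exact: linear_differentiable.
rewrite (_ : (fun x => _) = cst (f v)); first exact: Ck_cst.
apply/funext => x; rewrite deriveE; last exact: linear_differentiable.
by rewrite diff_lin.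
Qed.

Lemma Ck_add V W k (U : set V) (f g : V -> W) :
  open U -> Ck k U f -> Ck k U g -> Ck k U (fun x => f x + g x).
Proof.
move=> oU; elim: k f g => [|k IH] f g /=.
  by move=> cf cg x Ux; apply: cvgD; [exact: cf|exact: cg].
move=> [df Df] [dg Dg]; split=> [x Ux|v].
  by apply: differentiableD; [exact: df|exact: dg].
apply: Ck_eq (IH _ _ (Df v) (Dg v)) => // x; rewrite inE => Ux.
by rewrite deriveD //; apply: diff_derivable; [exact: df|exact: dg].
Qed.

Lemma Ck_sum V W (I : Type) (r : seq I) k (U : set V) (f : I -> V -> W) :
  open U -> (forall i, Ck k U (f i)) -> Ck k U (fun x => \sum_(i <- r) f i x).
Proof.
move=> oU Cf; elim: r => [|i r IH].
  by under eq_fun do rewrite big_nil; exact: Ck_cst.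
by under eq_fun do rewrite big_cons; exact: Ck_add.
Qed.

Lemma Ck_mul V k (U : set V) (f g : V -> R) :
  open U -> Ck k U f -> Ck k U g -> Ck k U (fun x => f x * g x).
Proof.
move=> oU; elim: k f g => [|k IH] f g.
  by move=> cf cg x Ux; apply: cvgM; [exact: cf|exact: cg].
move=> Cf Cg; have Cf' := CkW Cf; have Cg' := CkW Cg.
have [df Df] := Cf; have [dg Dg] := Cg.
split=> [x Ux|v].
  by apply: differentiableM; [exact: df|exact: dg].
apply: (@Ck_eq _ _ _ _ (fun x => f x * 'D_v g x + g x * 'D_v f x)) => //.
  move=> x; rewrite inE => Ux.
  rewrite (_ : (fun x => f x * g x) = f * g)//.
  by rewrite deriveM //; apply: diff_derivable; [exact: df|exact: dg].
by apply: Ck_add => //; [exact: IH (Dg v)|exact: IH (Df v)].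
Qed.

Lemma Ck_prod V (I : Type) (r : seq I) k (U : set V) (f : I -> V -> R) :
  open U -> (forall i, Ck k U (f i)) -> Ck k U (fun x => \prod_(i <- r) f i x).
Proof.
move=> oU Cf; elim: r => [|i r IH].
  by under eq_fun do rewrite big_nil; exact: Ck_cst.
by under eq_fun do rewrite big_cons; exact: Ck_mul.
Qed.

(** The derivative of 1/f is a polynomial in 1/f and the derivative of f, so that the induction
    hypothesis on 1/f itself suffices. *)
Lemma Ck_inv V k (U : set V) (f : V -> R) :
  open U -> (forall x, U x -> f x != 0) -> Ck k U f -> Ck k U (fun x => (f x)^-1).
Proof.
move=> oU f0; elim: k => [|k IH].
  by move=> cf x Ux; apply: cvgV; [exact: f0|exact: cf].
move=> Cf; have Cf' := CkW Cf; have [df Df] := Cf; split=> [x Ux|v].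
  by apply: differentiableV; [exact: df|exact: f0].
apply: (@Ck_eq _ _ _ _ (fun x => (-1) * ((f x)^-1 * (f x)^-1 * 'D_v f x))) => //.
  move=> x; rewrite inE => Ux.
  rewrite deriveV ?f0 //; last exact/diff_derivable/df.
  by rewrite mulN1r scaleNr expr2 invfM.
apply: Ck_mul => //; first by apply: Ck_cst.
apply: Ck_mul => //; last exact: Df.
by apply: Ck_mul => //; exact: IH.
Qed.

Lemma Ck_linl V W W' k (U : set V) (L : {linear W -> W'}) (f : V -> W) :
  open U -> continuous L -> Ck k U f -> Ck k U (fun x => L (f x)).
Proof.
move=> oU cL; elim: k f => [|k IH] f /=.
  by move=> cf x Ux; apply: (@continuous_comp _ _ _ f L); [exact: cf|exact: cL].
move=> [df Df]; split=> [x Ux|v].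
  by apply: differentiable_comp; [exact: df|exact: linear_differentiable].
apply: Ck_eq (IH _ (Df v)) => // x; rewrite inE => Ux.
have dL : differentiable L (f x) by exact: linear_differentiable.
rewrite [RHS](@deriveE _ _ _ (L \o f)); last by apply: differentiable_comp; [exact: df|].
by rewrite diff_comp //=; [rewrite diff_lin// deriveE//; exact: df|exact: df].
Qed.

Lemma Ck_mx V m n k (U : set V) (f : V -> 'M[R]_(m, n)) : open U ->
  (forall i j, Ck k U (fun x => f x i j)) -> Ck k U f.
Proof.
move=> oU Cf.
have -> : f = fun x => \sum_i \sum_j f x i j *: delta_mx i j.
  by apply/funext => x; rewrite -matrix_sum_delta.
apply: Ck_sum => // i; apply: Ck_sum => // j.
pose w : 'M[R]_(m, n) := delta_mx i j.
have lw : linear ( *:%R^~ w : R -> _) by move=> u y z; rewrite scalerDl scalerA.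
pose L : {linear R -> 'M[R]_(m, n)} :=
  HB.pack ( *:%R^~ w : R -> _) (GRing.isLinear.Build _ _ _ _ _ lw).
apply: (@Ck_linl V R _ k U L _ oU) (Cf i j); exact: scalel_continuous.
Qed.

Lemma Ck_coord V m n k (U : set V) (f : V -> 'M[R]_(m, n)) i j : open U ->
  Ck k U f -> Ck k U (fun x => f x i j).
Proof.
move=> oU.
have lw : linear (fun x : 'M[R]_(m, n) => x i j : R) by move=> u y z; rewrite !mxE.
pose L : {linear 'M[R]_(m, n) -> R} :=
  HB.pack (fun x : 'M[R]_(m, n) => x i j : R) (GRing.isLinear.Build _ _ _ _ _ lw).
by apply: (@Ck_linl V _ R k U L _ oU); exact: mxlin_continuous.
Qed.

Lemma Ck_comp_scalar V m n k (U : set V) (U' : set 'M[R]_(m, n))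
    (f : V -> 'M[R]_(m, n)) (g : 'M[R]_(m, n) -> R) :
  open U -> (forall x, U x -> U' (f x)) ->
  Ck k U f -> Ck k U' g -> Ck k U (g \o f).
Proof.
move=> oU UU'; elim: k f g UU' => [|k IH] f g UU'.
  move=> cf cg x Ux; apply: (@continuous_comp _ _ _ f g); first exact: cf.
  by apply: cg; exact: UU'.
move=> Cf [dg Dg]; have [df Df] := Cf; have Cf' := CkW Cf.
split=> [x Ux|v].
  by apply: differentiable_comp; [exact: df|exact/dg/UU'].
(* [Ck] only speaks of derivatives in fixed directions, whereas the chain rule differentiates g in
   the moving direction 'D_v f x; expanding that direction in matrix units makes the coefficients
   move instead. *)
apply: (@Ck_eq _ _ _ _ (fun x => \sum_i \sum_j
    'D_v f x i j * ('D_(delta_mx i j) g \o f) x)) => //.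
  move=> x; rewrite inE => Ux; have dfx := df _ Ux; have dgx := dg _ (UU' _ Ux).
  rewrite [RHS]deriveE; last exact: differentiable_comp.
  rewrite diff_comp //= -(deriveE v dfx).
  rewrite [in RHS](matrix_sum_delta ('D_v f x)) linear_sum.
  apply: eq_bigr => i _; rewrite linear_sum; apply: eq_bigr => j _.
  by rewrite linearZ -deriveE.
apply: Ck_sum => // i; apply: Ck_sum => // j; apply: Ck_mul => //.
  exact: Ck_coord oU (Df v).
exact: IH Cf' (Dg _).
Qed.

Lemma Ck_comp V m n p q k (U : set V) (U' : set 'M[R]_(m, n))
    (f : V -> 'M[R]_(m, n)) (g : 'M[R]_(m, n) -> 'M[R]_(p, q)) :
  open U -> open U' -> (forall x, U x -> U' (f x)) ->
  Ck k U f -> Ck k U' g -> Ck k U (g \o f).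
Proof.
move=> oU oU' UU' Cf Cg; apply: Ck_mx => // i j.
exact: (Ck_comp_scalar oU UU' Cf (Ck_coord i j oU' Cg)).
Qed.

Lemma Ck_det V n k (U : set V) (M : V -> 'M[R]_n) : open U ->
  Ck k U M -> Ck k U (fun x => \det (M x)).
Proof.
move=> oU CM; rewrite /determinant; apply: Ck_sum => // s.
apply: Ck_mul => //; first by apply: Ck_cst.
by apply: Ck_prod => // i; exact: Ck_coord.
Qed.

Lemma Ck_adj V n k (U : set V) (M : V -> 'M[R]_n) : open U ->
  Ck k U M -> Ck k U (fun x => \adj (M x)).
Proof.
move=> oU CM; apply: Ck_mx => // i j; under eq_fun do rewrite mxE.
apply: Ck_mul => //; first by apply: Ck_cst.
apply: Ck_det => //; apply: Ck_mx => // i' j'; under eq_fun do rewrite !mxE.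
exact: Ck_coord.
Qed.

(** Cramer's formula reduces this to determinants and one scalar inverse. *)
Lemma Ck_invmx V n k (U : set V) (M : V -> 'M[R]_n) : open U ->
  (forall x, U x -> M x \in unitmx) ->
  Ck k U M -> Ck k U (fun x => invmx (M x)).
Proof.
move=> oU uM CM; apply: Ck_mx => // i j.
apply: (@Ck_eq _ _ _ _ (fun x => (\det (M x))^-1 * (\adj (M x)) i j)) => //.
  by move=> x; rewrite inE => /uM; rewrite /invmx => ->; rewrite [RHS]mxE.
apply: Ck_mul => //; last by apply: Ck_coord => //; exact: Ck_adj.
apply: Ck_inv; [by []| |exact: Ck_det].
by move=> x /uM; rewrite unitmxE unitfE.
Qed.

Lemma Ck_mulmx V m n p k (U : set V) (M : V -> 'M[R]_(m, n))
    (N : V -> 'M[R]_(n, p)) : open U ->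
  Ck k U M -> Ck k U N -> Ck k U (fun x => M x *m N x).
Proof.
move=> oU CM CN; apply: Ck_mx => // i j; under eq_fun do rewrite mxE.
by apply: Ck_sum => // l; apply: Ck_mul => //; exact: Ck_coord.
Qed.

End CkTheory.

(** Completeness is what both the contraction argument and the exponential series rest on. *)
HB.instance Definition _ (R : realType) (m n : nat) := Complete.on 'M[R]_(m, n).

(** * The inverse function theorem, by contraction *)

Section InverseFunction.
Variables (R : realType) (d : nat).
Local Notation V := 'rV[R]_d.

Lemma coord_le_norm m n (x : 'M[R]_(m, n)) i j : `|x i j| <= `|x|.
Proof.
rewrite [X in _ <= X]/Num.Def.normr/= mx_normrE.
exact: (le_bigmax _ (fun p : 'I_m * 'I_n => `|x p.1 p.2|) (i, j)).
Qed.

Lemma norm_le_coord m n (x : 'M[R]_(m, n)) e : 0 <= e ->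
  (forall i j, `|x i j| <= e) -> `|x| <= e.
Proof.
move=> e0 xe; rewrite [X in X <= _]/Num.Def.normr/= mx_normrE.
by apply: bigmax_le => // -[i j] _; exact: xe.
Qed.

(** The norm of row vectors is the sup norm, so the one-variable mean value theorem, applied to each
    coordinate along the segment from y to x, gives the bound without loss in [K]. *)
Lemma mean_value_ineq (f : V -> V) (x0 : V) (r K : R) : 0 <= K ->
  (forall x, `|x - x0| < r -> differentiable f x) ->
  (forall x v, `|x - x0| < r -> `|'d f x v| <= K * `|v|) ->
  forall x y, `|x - x0| < r -> `|y - x0| < r -> `|f x - f y| <= K * `|x - y|.
Proof.
move=> K0 df Kf x y xr yr.
apply: norm_le_coord; first by rewrite mulr_ge0.
move=> i j; rewrite (ord1 i).
pose g (t : R) : V := y + t *: (x - y).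
pose coord (z : V) : R := z 0 j.
have gr t : 0 <= t <= 1 -> `|g t - x0| < r.
  move=> /andP[t0 t1].
  have -> : g t - x0 = t *: (x - x0) + (1 - t) *: (y - x0).
    by rewrite /g; apply/rowP => k; rewrite !mxE; ring.
  apply: le_lt_trans (ler_normD _ _) _; rewrite !normrZ.
  rewrite (ger0_norm t0) ger0_norm ?subr_ge0//.
  have [->|tn1] := eqVneq t 1; first by rewrite subrr mul0r addr0 mul1r.
  have t1' : t < 1 by rewrite lt_neqAle tn1.
  apply: (@lt_le_trans _ _ (t * r + (1 - t) * r)); last by rewrite -mulrDl subrKC mul1r.
  apply: ler_ltD; first by rewrite ler_wpM2l// ltW.
  by rewrite ltr_pM2l// subr_gt0.
have dg t : is_diff t g ( *:%R^~ (x - y)).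
  pose h : R -> V := *:%R^~ (x - y).
  have hd : is_diff t (cst y + h) (0 + h) by apply: is_diffD.
  by rewrite add0r in hd.
have lc : linear coord by move=> u a b; rewrite /coord !mxE.
pose c : {linear V -> R} := HB.pack coord (GRing.isLinear.Build _ _ _ _ _ lc).
have cc : continuous c by exact: mxlin_continuous.
have dF (t : R) : 0 <= t <= 1 -> is_diff t (c \o (f \o g)) (c \o ('d f (g t) \o ( *:%R^~ (x - y)))).
  move=> t01; apply: is_diff_comp.
    by apply: is_diff_comp; apply: DiffDef => //; exact/df/gr.
  by apply: DiffDef; [exact: linear_differentiable|exact: diff_lin].
have [t t01 ht] : exists2 t, t \in `[0, 1]%R &
    (c \o (f \o g)) 1 - (c \o (f \o g)) 0 = 'd f (g t) (x - y) 0 j * (1 - 0).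
  apply: MVT_segment => //.
    move=> t; rewrite in_itv/= => /andP[/ltW t0 /ltW t1].
    have [ex vl] := dF t (introT andP (conj t0 t1)).
    apply: DeriveDef; first exact: diff_derivable.
    by rewrite deriveE // vl /= scale1r.
  apply: continuous_in_subspaceT => t; rewrite inE /= in_itv/= => t01.
  by have [ex _] := dF t t01; exact: differentiable_continuous.
move: ht; rewrite subr0 mulr1 /= /c /= /coord /g scale1r scale0r addr0 subrKC => ht.
rewrite !mxE ht; apply: le_trans (coord_le_norm _ _ _) _.
by apply/Kf/gr; move: t01; rewrite in_itv.
Qed.

Lemma diff_sum_delta (f : V -> V) x v : differentiable f x ->
  'd f x v = \sum_j v 0 j *: 'D_(delta_mx 0 j) f x.
Proof.
move=> dfx; rewrite {1}[v]row_sum_delta linear_sum.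
by apply: eq_bigr => j _; rewrite linearZ -deriveE.
Qed.

Section Local.
Variables (f : V -> V) (x0 : V).
Hypothesis smooth_f : smooth_on_open setT f.
Hypothesis df0 : forall v, 'd f x0 v = v.

Let df x : differentiable f x. Proof. by have [/(_ x I)] := smooth_f 1. Qed.

Lemma diff_near_id : exists2 r, 0 < r &
  forall x v, `|x - x0| < r -> `|'d f x v - v| <= 2^-1 * `|v|.
Proof.
(* Each of the d coordinate directions contributes at most e |v|, and d e <= 1/2; the successor
   keeps [e] meaningful for d = 0. *)
pose e : R := (2 * d.+1%:R)^-1.
have e0 : 0 < e by rewrite invr_gt0 mulr_gt0.
have near_e : \forall x \near x0, forall j : 'I_d,
    `|'D_(delta_mx 0 j) f x - delta_mx 0 j| <= e.
  apply: (@filter_forall V 'I_d (fun j x =>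
    `|'D_(delta_mx 0 j) f x - delta_mx 0 j| <= e) _ (nbhs_filter x0)) => j.
  have [_ /(_ (delta_mx 0 j)) /(_ x0 I)] := smooth_f 1.
  rewrite /prop_for /continuous_at (deriveE _ (df x0)) df0.
  move=> /cvgrPdist_le /(_ e e0); apply: filterS => x.
  by rewrite distrC.
have /nbhs_ballP [r /= r0 hr] := near_e; exists r => // x v xr.
have {}hr : forall j : 'I_d, `|'D_(delta_mx 0 j) f x - delta_mx 0 j| <= e.
  by apply: hr; rewrite -ball_normE /= distrC.
rewrite (diff_sum_delta _ (df x)) {2}[v]row_sum_delta -sumrB.
apply: le_trans (ler_norm_sum _ _ _) _.
apply: (@le_trans _ _ (\sum_(j < d) `|v| * e)).
  apply: ler_sum => j _; rewrite -scalerBr normrZ.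
  by rewrite ler_pM// coord_le_norm.
rewrite sumr_const card_ord -mulrnAr [X in X <= _]mulrC.
rewrite ler_wpM2r// -mulr_natl /e invfM mulrCA ler_piMr ?invr_ge0//.
by rewrite ler_pdivrMr ?ltr0n// mul1r ler_nat.
Qed.

Let dist_id_lipschitz r : (forall x v, `|x - x0| < r -> `|'d f x v - v| <= 2^-1 * `|v|) ->
  forall x y, `|x - x0| < r -> `|y - x0| < r ->
    `|(x - f x) - (y - f y)| <= 2^-1 * `|x - y|.
Proof.
move=> hr; have dg x : is_diff x (fun x => x - f x) (fun v => v - 'd f x v).
  apply: (@is_diffB _ _ _ id f id ('d f x) x); exact: DiffDef.
apply: mean_value_ineq => // x v xr; have [ex vl] := dg x.
by rewrite vl -normrN opprD opprK addrC; exact: hr.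
Qed.

Let expanding r : (forall x v, `|x - x0| < r -> `|'d f x v - v| <= 2^-1 * `|v|) ->
  forall x y, `|x - x0| < r -> `|y - x0| < r -> `|x - y| <= 2 * `|f x - f y|.
Proof.
move=> hr x y xr yr; have := dist_id_lipschitz hr xr yr.
have e : x - y = (x - f x - (y - f y)) + (f x - f y).
  by apply/rowP => j; rewrite !mxE; ring.
by have := ler_normD (x - f x - (y - f y)) (f x - f y); rewrite -e; lra.
Qed.

Let local_surjective r : 0 < r ->
  (forall x v, `|x - x0| < r -> `|'d f x v - v| <= 2^-1 * `|v|) ->
  forall y, `|y - f x0| < r / 4 -> exists x, `|x - x0| < r /\ f x = y.
Proof.
move=> r0 hr y yr.
pose K := [set x : V | `|x - x0| <= r / 2].
(* A fixed point of [T] solves f x = y. On the closed ball [K] of radius r / 2 the map id - f moves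
   points by at most r / 4 from its value at x0, and y is within r / 4 of f x0, so [T] preserves
   [K]. *)
pose T x := y + (x - f x).
have Kr x : K x -> `|x - x0| < r by rewrite /K /=; lra.
have x00 : `|x0 - x0| < r by rewrite subrr normr0.
have TK : {homo T : x / K x >-> K x}.
  move=> x Kx; have := dist_id_lipschitz hr (Kr _ Kx) x00.
  have -> : T x = (x - f x - (x0 - f x0)) + (y - f x0) + x0.
    by rewrite /T; apply/rowP => j; rewrite !mxE; ring.
  rewrite /K /= addrK => h; apply: le_trans (ler_normD _ _) _.
  by move: Kx; rewrite /K /=; lra.
pose T' : {fun K >-> K} := HB.pack T (isFun.Build _ _ K K T TK).
have ctr : is_contraction T'.
  exists (2^-1)%:nng; split; first by rewrite /= invf_lt1// ltr1n.
  move=> [a b] [Ka Kb] /=.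
  rewrite /T opprD addrACA subrr add0r.
  by apply: (dist_id_lipschitz hr); exact: Kr.
have clK : closed K.
  rewrite (_ : K = closed_ball x0 (r / 2)); first exact: closed_ball_closed.
  rewrite closed_ballE ?divr_gt0//; apply/seteqP.
  by split=> x; rewrite /K /closed_ball_ /= distrC.
have [x Kx fx] : exists2 p, K p & p = T' p.
  apply: banach_fixed_point => //.
  by exists x0; rewrite /K /= subrr normr0 divr_ge0// ltW.
exists x; split; first exact: Kr.
apply/rowP => j; move/rowP/(_ j): fx; rewrite /= /T !mxE; lra.
Qed.

Let J x : 'M[R]_d := lin1_mx ('d f x).

Let J_unit x : (forall v, `|'d f x v - v| <= 2^-1 * `|v|) -> J x \in unitmx.
Proof.
move=> hx; rewrite -row_free_unit -kermx_eq0; apply/rowV0P => v /sub_kermxP.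
rewrite mul_rV_lin1 => dv; have := hx v; rewrite dv sub0r normrN => h.
by apply/eqP; rewrite -normr_le0; have := normr_ge0 v; lra.
Qed.

Lemma smooth_local_inverse : exists r (U : set V) (g : V -> V),
  [/\ 0 < r, open U, U (f x0), smooth_on_open U g &
      forall x, `|x - x0| < r -> g (f x) = x].
Proof.
have [r r0 hr] := diff_near_id.
(* The inverse is obtained by choice, with junk value 0 off the image of the ball; on [U] a preimage
   exists by [local_surjective] and is unique by [expanding]. *)
pose g y := xget 0 [set x | `|x - x0| < r /\ f x = y].
have gf x : `|x - x0| < r -> g (f x) = x.
  move=> xr.
  apply: (@xget_unique _ 0 [set z | `|z - x0| < r /\ f z = f x] x) => //.
  move=> z [zr fz]; have := expanding hr zr xr; rewrite fz subrr normr0 mulr0.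
  by rewrite normr_le0 subr_eq0 => /eqP.
pose U := ball (f x0) (r / 4).
have gU y : U y -> `|g y - x0| < r /\ f (g y) = y.
  rewrite /U -ball_normE /= distrC => /(local_surjective r0 hr) [x hx].
  exact: (@xgetPex _ 0 [set z | `|z - x0| < r /\ f z = y] (ex_intro _ x hx)).
have oU : open U by apply: ball_open; rewrite divr_gt0.
exists r, U, g; split=> //; first by apply: ballxx; rewrite divr_gt0.
have JU y : U y -> J (g y) \in unitmx.
  by move=> /gU[gr _]; apply: J_unit => v; exact: hr.
pose dg y : {linear V -> V} := mulmxr (invmx (J (g y))).
have dgP y : U y -> differentiable g y /\ 'd g y = dg y :> (V -> V).
  move=> Uy; apply: differentiable_eps; first exact: mxlin_continuous.
  move=> e e0; have [gyr fgy] := gU _ Uy.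
  have [C C0 hC] := linear_lipschitz (@mxlin_continuous R 1 d V (dg y)).
  have [_ /eqaddoP] := (diff_locallyP _ _).1 (df (g y)).
  (* The factor [C] is lost when [dg y] is applied to the error term, the factor 2 when the
     increment of g is bounded by that of its argument. *)
  move=> /(_ (e / (2 * C))); rewrite divr_gt0 ?mulr_gt0// => /(_ isT) /nbhs_ballP.
  move=> [s /= s0 hs]; near=> k.
  have Uk : U (k + y).
    near: k; have := (nbhs0P _ _).1 (open_nbhs_nbhs (conj oU Uy)).
    by under eq_near do rewrite addrC.
  have [gkr fgk] := gU _ Uk.
  pose h := g (k + y) - g y.
  have hk : `|h| <= 2 * `|k|.
    by have := expanding hr gkr gyr; rewrite fgk fgy addrK.
  have hsk : `|h| < s.
    apply: le_lt_trans hk _; rewrite -ltr_pdivlMl//.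
    near: k; apply/nbhs_ballP; exists (2^-1 * s) => /=; first by rewrite mulr_gt0.
    by move=> k; rewrite -ball_normE /= sub0r normrN.
  have := hs h; rewrite -ball_normE /= sub0r normrN => /(_ hsk).
  have -> : (f \o shift (g y) - (cst (f (g y)) + 'd f (g y))) h =
      f (h + g y) - f (g y) - 'd f (g y) h.
    by rewrite -addrA -opprD.
  rewrite subrK fgk fgy addrK => hkd.
  (* Writing h as (h J) J^-1 shows the error of [dg y] at k to be the image under [dg y] of the
     error of 'd f at h, up to sign. *)
  rewrite -/h -{1}(mulmxK (JU _ Uy) h) mul_rV_lin1.
  have -> : 'd f (g y) h *m invmx (J (g y)) - dg y k = - dg y (k - 'd f (g y) h).
    by rewrite [in RHS]linearB opprB /dg /=.
  rewrite normrN; apply: le_trans (hC _) _.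
  apply: (@le_trans _ _ (C * (e / (2 * C) * (2 * `|k|)))).
    rewrite ler_pM2l//; apply: le_trans hkd _.
    by rewrite ler_pM2l// divr_gt0// mulr_gt0.
  by rewrite le_eqVlt; apply/orP; left; apply/eqP; field; rewrite gt_eqF.
have oT : open ([set: V]) by exact: openT.
(* Bootstrap: the derivative of g in direction v is v J(g y)^-1, which is C^k as soon as g is. *)
elim=> [|k IH].
  by move=> y Uy; apply: differentiable_continuous; exact: (dgP y Uy).1.
split=> [y Uy|v]; first exact: (dgP y Uy).1.
apply: (@Ck_eq _ _ _ _ _ (fun y => v *m invmx (J (g y)))) => //.
  move=> y; rewrite inE => Uy; have [dgy dgE] := dgP y Uy.
  by rewrite (deriveE v dgy) dgE.
apply: Ck_mulmx => //; first exact: Ck_cst.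
apply: Ck_invmx => //.
apply: (@Ck_comp _ _ _ _ _ _ _ U setT g J) => //.
apply: Ck_mx => // i j.
have [_ /(_ (delta_mx 0 i))] := smooth_f k.+1.
move=> /(Ck_coord 0 j oT); apply: Ck_eq => // x _.
by rewrite /J mxE deriveE.
Unshelve. all: by end_near. Qed.

End Local.
End InverseFunction.

(** * Smooth left inverses of injective immersions on compact sets *)

(** Among the matrices whose row space lies in [g], one of maximal rank spans [g], since any further
    vector of [g] would raise the rank; its cokernel matrix gives the equations. They serve to
    complete an immersion of [g] to one of the whole space, and to see that [g] is closed. *)
Lemma subspace_kermx (R : realType) (d : nat) (g : set 'rV[R]_d) :
  g 0 -> (forall a x y, g x -> g y -> g (a *: x + y)) ->
  exists K : 'M[R]_d, forall x, g x <-> x *m K = 0.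
Proof.
move=> g0 glin.
pose spanned (B : 'M[R]_d) := forall u : 'rV_d, (u <= B)%MS -> g u.
pose P r := `[< exists B, spanned B /\ \rank B = r >].
have exP : exists r, P r.
  exists 0%N; apply/asboolP; exists 0; rewrite mxrank0; split=> // u.
  by rewrite submx0 => /eqP ->.
have ubP r : P r -> (r <= d)%N by move=> /asboolP[B [_ <-]]; exact: rank_leq_row.
case: (ex_maxnP exP ubP) => r /asboolP[B [gB rB]] maxr.
exists (cokermx B) => x; split=> [gx|/eqP]; last by rewrite -submxE; exact: gB.
apply/eqP; rewrite -submxE; apply/negPn/negP => nxB.
have : P (\rank (B + x)%MS).
  apply/asboolP; exists (B + x)%MS; split=> // u /sub_addsmxP[[u1 u2] ->] /=.
  rewrite addrC (_ : u2 *m x = u2 0 0 *: x).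
    by apply: glin => //; apply: gB; exact: submxMl.
  by rewrite {1}[u2]mx11_scalar mul_scalar_mx.
move=> /maxr; rewrite leqNgt -rB; apply/negP/negPn.
rewrite ltn_neqAle; have := mxrank_leqif_sup (addsmxSl B x) => [[-> ->]].
by rewrite andbT addsmx_sub submx_refl.
Qed.

Section SmoothLeftInverse.
Variables (R : realType) (d e : nat).
Variables (F : 'rV[R]_d -> 'rV[R]_e) (g : set 'rV[R]_d).
Hypothesis smooth_F : smooth_on_open setT F.
Hypothesis g0 : g 0.
Hypothesis glin : forall a x y, g x -> g y -> g (a *: x + y).

Let oT n : open [set: 'rV[R]_n]. Proof. exact: openT. Qed.

Let dF x : differentiable F x. Proof. by have [/(_ x I)] := smooth_F 1. Qed.

(* With K a matrix of kernel g, the map x |-> (F x, x K) is an immersion at x0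
   of the whole space; composing it with a linear left inverse of its
   derivative gives a local diffeomorphism Phi, and Phi only depends on F x
   for x in g. *)
Lemma immersion_local_left_inverse x0 : g x0 ->
  (forall v, g v -> 'd F x0 v = 0 -> v = 0) ->
  exists r (U : set 'rV[R]_e) (h : 'rV[R]_e -> 'rV[R]_d),
    [/\ 0 < r, open U, U (F x0), smooth_on_open U h &
        forall x, g x -> `|x - x0| < r -> h (F x) = x].
Proof.
move=> gx0 inj; have [K gK] := subspace_kermx g0 glin.
pose D : 'M[R]_(d, e) := lin1_mx ('d F x0).
have : row_free (row_mx D K).
  rewrite -kermx_eq0; apply/rowV0P => v /sub_kermxP.
  rewrite mul_mx_row -[0]row_mx0 => /eq_row_mx[vD vK].
  by apply: inj; [exact/gK|move: vD; rewrite mul_rV_lin1].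
move=> /row_freeP[L]; rewrite -[L]vsubmxK mul_row_col => DK1.
set L1 := usubmx L in DK1; set L2 := dsubmx L in DK1.
pose Phi x := F x *m L1 + x *m (K *m L2).
have smooth_Phi : smooth_on_open setT Phi.
  move=> k; apply: (@Ck_add _ _ _ k setT (mulmxr L1 \o F) (mulmxr (K *m L2))).
  - exact: oT.
  - by apply: Ck_linl; [exact: oT|exact: mxlin_continuous|exact: smooth_F].
  - by apply: Ck_lin; exact: mxlin_continuous.
have dPhi v : 'd Phi x0 v = v.
  have d1 : is_diff x0 (mulmxr L1 \o F) (mulmxr L1 \o 'd F x0).
    apply: is_diff_comp; first exact: DiffDef.
    by apply: DiffDef; [apply: linear_differentiable|apply: diff_lin];
       exact: mxlin_continuous.
  have d2 : is_diff x0 (mulmxr (K *m L2)) (mulmxr (K *m L2)).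
    by apply: DiffDef; [apply: linear_differentiable|apply: diff_lin];
       exact: mxlin_continuous.
  have [_ vl] := @is_diffD _ _ _ _ _ _ _ _ d1 d2.
  transitivity ('d F x0 v *m L1 + v *m (K *m L2)).
    exact: (congr1 (fun f : _ -> 'rV_d => f v) vl).
  by rewrite -mul_rV_lin1 -/D -mulmxA -mulmxDr DK1 mulmx1.
have [r [U [Psi [r0 oU Ux0 sPsi PsiK]]]] := smooth_local_inverse smooth_Phi dPhi.
have PhiE x : g x -> Phi x = F x *m L1.
  by move=> /gK xK; rewrite /Phi mulmxA xK mul0mx addr0.
have cL1 : continuous (mulmxr L1 : 'rV_e -> 'rV_d) by exact: mxlin_continuous.
exists r, ((mulmxr L1) @^-1` U), (Psi \o mulmxr L1); split=> //.
- by apply: open_comp => // y _; exact: cL1.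
- by rewrite /= -PhiE.
- move=> k; apply: (@Ck_comp _ _ _ _ _ _ _ _ U) => //.
    by apply: open_comp => // y _; exact: cL1.
  exact: Ck_lin.
- by move=> x gx xr; rewrite /= -PhiE // PsiK.
Qed.

(* By compactness, the points of F C near F x0 only come from points near x0. *)
Lemma compact_smooth_left_inverse (C : set 'rV[R]_d) x0 :
  C `<=` g -> compact C -> (forall x y, C x -> C y -> F x = F y -> x = y) ->
  C x0 -> (forall v, g v -> 'd F x0 v = 0 -> v = 0) ->
  exists (U : set 'rV[R]_e) (h : 'rV[R]_e -> 'rV[R]_d),
    [/\ open U, U (F x0), smooth_on_open U h &
        forall x, C x -> U (F x) -> h (F x) = x].
Proof.
move=> Cg cC injF Cx0 /(immersion_local_left_inverse (Cg _ Cx0)) [r [U [h [r0 oU Ux0 sh hK]]]].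
pose C' := C `&` ~` ball x0 r.
have cC' : compact C'.
  by apply: compact_closedI => //; apply: open_closedC; exact: ball_open.
have clF : closed (F @` C').
  apply: compact_closed; first exact: norm_hausdorff.
  apply: continuous_compact => //; apply: continuous_subspaceT => x.
  exact: differentiable_continuous.
exists (U `&` ~` (F @` C')), h; split.
- by apply: openI => //; exact: closed_openC.
- split=> // -[x [Cx nx] Fx]; apply: nx.
  by rewrite (injF x x0 Cx Cx0 Fx); exact: ballxx.
- by move=> k; apply: Ck_sub (sh k); exact: subIsetl.
- move=> x Cx [_ nF]; apply: hK; first exact: Cg.
  apply: contrapT => nx; apply: nF; exists x => //; split=> //.
  by rewrite -ball_normE /= distrC.
Qed.

End SmoothLeftInverse.

(** * The exponential of real matrices and its differential *)

Section MatrixExponential.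
Variable R : realType.

Definition mexp n (X : 'M[R]_n) : 'M[R]_n :=
  exp_of_powers (fun k => X ^+ k : 'M[R]_n).

Definition mexp_sum n (X : 'M[R]_n) (N : nat) : 'M[R]_n :=
  \sum_(k < N) (k`!%:R)^-1 *: (X ^+ k : 'M[R]_n).

Lemma norm_mulmx m n p (A : 'M[R]_(m, n)) (B : 'M[R]_(n, p)) :
  `|A *m B| <= n%:R * `|A| * `|B|.
Proof.
apply: norm_le_coord => [|i j]; first by rewrite !mulr_ge0.
rewrite mxE; apply: le_trans (ler_norm_sum _ _ _) _.
apply: (@le_trans _ _ (\sum_(k < n) `|A| * `|B|)).
  by apply: ler_sum => k _; rewrite normrM ler_pM ?coord_le_norm.
by rewrite sumr_const card_ord -mulrA mulr_natl.
Qed.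

Lemma norm_exprmx n (X : 'M[R]_n) k : `|X ^+ k : 'M[R]_n| <= (n%:R * `|X|) ^+ k.
Proof.
elim: k => [|k IH].
  rewrite !expr0; apply: norm_le_coord => // i j; rewrite mxE.
  by case: eqP => _; rewrite ?normr1 ?normr0.
rewrite !exprS; apply: le_trans (norm_mulmx _ _) _.
by rewrite ler_wpM2l// mulr_ge0.
Qed.

Let mexp_term n (X : 'M[R]_n) k : 'M[R]_n := (k`!%:R)^-1 *: (X ^+ k : 'M[R]_n).

Let mexp_term_le n (X : 'M[R]_n) k :
  `|mexp_term X k| <= exp_coeff (n%:R * `|X|) k.
Proof.
rewrite normrZ ger0_norm ?invr_ge0// /exp_coeff /= mulrC ler_wpM2r ?invr_ge0//.
exact: norm_exprmx.
Qed.

Let mexp_sumE n (X : 'M[R]_n) : mexp_sum X = series (mexp_term X).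
Proof. by apply/funext => N; rewrite /series /mexp_sum /= big_mkord. Qed.

Let mexp_normed_cvg n (X : 'M[R]_n) : cvgn [normed series (mexp_term X)].
Proof.
apply: (series_le_cvg _ _ (mexp_term_le X)) => // [k|].
  by apply: exp_coeff_ge0; rewrite mulr_ge0.
exact: is_cvg_series_exp_coeff.
Qed.

Lemma mexp_cvg n (X : 'M[R]_n) : mexp_sum X @ \oo --> mexp X.
Proof.
rewrite /mexp /exp_of_powers -/(mexp_sum X) mexp_sumE.
exact/normed_cvg/mexp_normed_cvg.
Qed.

Lemma mexp_unique n (X Y : 'M[R]_n) : mexp_sum X @ \oo --> Y -> mexp X = Y.
Proof. by move=> XY; apply: cvg_lim => //; exact: norm_hausdorff. Qed.

Lemma norm_mexp n (X : 'M[R]_n) : `|mexp X| <= expR (n%:R * `|X|).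
Proof.
apply: (cvgr_to_le (cvg_norm (@mexp_cvg _ X))); apply: nearW => N.
apply: le_trans (ler_norm_sum _ _ _) _.
apply: (@le_trans _ _ (series (exp_coeff (n%:R * `|X|)) N)).
  by rewrite /series /= big_mkord; apply: ler_sum => k _; exact: mexp_term_le.
apply: nondecreasing_cvgn_le; last exact: is_cvg_series_exp_coeff.
by apply: nondecreasing_series => k _ _; rewrite exp_coeff_ge0// mulr_ge0.
Qed.

Lemma mexp0 n : mexp (0 : 'M[R]_n) = 1%:M.
Proof.
apply: mexp_unique; rewrite -cvg_shiftS; apply: cvg_near_cst; near=> N.
rewrite /= /mexp_sum big_ord_recl /= big1 ?addr0 /= ?fact0 ?invr1 ?scale1r ?expr0//.
by move=> i _; rewrite expr0n scaler0.
Unshelve. all: by end_near. Qed.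

Lemma cvg_mxlin m n p q (L : {linear 'M[R]_(m, n) -> 'M[R]_(p, q)})
    (u : nat -> 'M[R]_(m, n)) l :
  u @ \oo --> l -> (fun k => L (u k)) @ \oo --> L l.
Proof. by move=> ul; apply: (cvg_comp u L ul); exact: mxlin_continuous. Qed.

Lemma mxcvg_unique m n (u : nat -> 'M[R]_(m, n)) (a b : 'M[R]_(m, n)) :
  u @ \oo --> a -> u @ \oo --> b -> a = b.
Proof.
move=> /cvg_lim ua /cvg_lim ub.
by rewrite -(ua (@norm_hausdorff _ _)) (ub (@norm_hausdorff _ _)).
Qed.

Lemma expr_intertwine m n (X : 'M[R]_m) (Y : 'M[R]_n) (P : 'M[R]_(m, n)) k :
  X *m P = P *m Y -> (X ^+ k : 'M[R]_m) *m P = P *m (Y ^+ k : 'M[R]_n).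
Proof.
move=> XP; elim: k => [|k IH]; first by rewrite !expr0 -idmxE mul1mx mulmx1.
by rewrite !exprS -!mulmxE -mulmxA IH !mulmxA XP.
Qed.

(** [P] may be rectangular: inclusions of blocks, projections, eigenvectors and maps between
    representations are all intertwiners, and most identities on exponentials below are
    instances. *)
Lemma mexp_intertwine m n (X : 'M[R]_m) (Y : 'M[R]_n) (P : 'M[R]_(m, n)) :
  X *m P = P *m Y -> mexp X *m P = P *m mexp Y.
Proof.
move=> XP; apply: (@mxcvg_unique _ _ (fun N => mexp_sum X N *m P)).
  exact: (@cvg_mxlin _ _ _ _ (mulmxr P) _ _ (@mexp_cvg _ X)).
have -> : (fun N => mexp_sum X N *m P) = fun N => P *m mexp_sum Y N.
  apply/funext => N; rewrite mulmx_suml mulmx_sumr; apply: eq_bigr => k _.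
  by rewrite -scalemxAl -scalemxAr (expr_intertwine k XP).
exact: (@cvg_mxlin _ _ _ _ (mulmx P) _ _ (@mexp_cvg _ Y)).
Qed.

Definition ursubmx_lin m n : {linear 'M[R]_(m + n) -> 'M[R]_(m, n)} :=
  rsubmx \o usubmx.

Section Block.
Variables (m n : nat) (X : 'M[R]_m) (Y : 'M[R]_n).
Implicit Type H : 'M[R]_(m, n).

(** This block is Duhamel's integral of e^((1-s) X) H e^(s Y) over s in [0, 1]; for X = Y it is the
    differential of the exponential at X. *)
Definition mexp_ur H : 'M[R]_(m, n) := ursubmx (mexp (block_mx X H 0 Y)).

(** The inclusion of the first summand and the projection onto the second are intertwiners, and they
    determine every block but the upper right one. *)
Lemma mexp_block H :
  mexp (block_mx X H 0 Y) = block_mx (mexp X) (mexp_ur H) 0 (mexp Y).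
Proof.
set W := block_mx X H 0 Y.
have h1 : mexp W *m col_mx 1%:M 0 = col_mx 1%:M 0 *m mexp X.
  apply: mexp_intertwine; rewrite mul_block_col mul_col_mx.
  by rewrite !mulmx1 !mulmx0 mul1mx mul0mx !addr0.
have h2 : mexp Y *m row_mx 0 1%:M = row_mx 0 1%:M *m mexp W.
  apply: mexp_intertwine; rewrite mul_row_block mul_mx_row.
  by rewrite !mulmx1 !mulmx0 mul1mx !mul0mx !add0r.
rewrite -[mexp W]submxK in h1 h2 *.
move: h1; rewrite mul_block_col mul_col_mx !mulmx1 !mulmx0 mul1mx mul0mx !addr0.
move=> /eq_col_mx[-> ->]; congr block_mx.
move: h2; rewrite mul_row_block mul_mx_row !mulmx1 !mulmx0 !mul1mx !mul0mx !add0r.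
by move=> /eq_row_mx[_ ->].
Qed.

Fixpoint power_ur H k : 'M[R]_(m, n) :=
  if k is k'.+1 then X *m power_ur H k' + H *m (Y ^+ k' : 'M[R]_n) else 0.

Lemma expr_block H k : (block_mx X H 0 Y ^+ k : 'M[R]__) =
  block_mx (X ^+ k : 'M[R]_m) (power_ur H k) 0 (Y ^+ k : 'M[R]_n).
Proof.
elim: k => [|k IH]; first by rewrite !expr0 -!idmxE -scalar_mx_block.
rewrite exprS IH -mulmxE mulmx_block !mul0mx !mulmx0 !addr0 add0r /=.
by rewrite !exprS.
Qed.

Lemma mexp_ur_cvg H :
  (fun N : nat => \sum_(k < N) (k`!%:R)^-1 *: power_ur H k) @ \oo --> mexp_ur H.
Proof.
have -> : (fun N => \sum_(k < N) (k`!%:R)^-1 *: power_ur H k) =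
    (fun N => ursubmx_lin m n (mexp_sum (block_mx X H 0 Y) N)).
  apply/funext => N; rewrite /mexp_sum linear_sum; apply: eq_bigr => k _.
  by rewrite linearZ /= expr_block -[rsubmx _]/(ursubmx _) block_mxKur.
exact: (@cvg_mxlin _ _ _ _ (ursubmx_lin m n) _ _ (@mexp_cvg _ _)).
Qed.

Lemma mexp_ur_linear : linear mexp_ur.
Proof.
move=> a H H'; apply: (@mxcvg_unique _ _ (fun N : nat =>
    \sum_(k < N) (k`!%:R)^-1 *: power_ur (a *: H + H') k)).
  exact: mexp_ur_cvg.
have uD k : power_ur (a *: H + H') k = a *: power_ur H k + power_ur H' k.
  elim: k => [|k IH] /=; first by rewrite scaler0 addr0.
  by rewrite IH mulmxDr mulmxDl -scalemxAr -scalemxAl scalerDr addrACA.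
have -> : (fun N : nat => \sum_(k < N) (k`!%:R)^-1 *: power_ur (a *: H + H') k) =
    (fun N => a *: (\sum_(k < N) (k`!%:R)^-1 *: power_ur H k) +
              \sum_(k < N) (k`!%:R)^-1 *: power_ur H' k).
  apply/funext => N; rewrite scaler_sumr -big_split /=; apply: eq_bigr => k _.
  by rewrite uD scalerDr !scalerA mulrC.
apply: cvgD; last exact: mexp_ur_cvg.
by apply: cvgZl_tmp; exact: mexp_ur_cvg.
Qed.
HB.instance Definition _ := GRing.isLinear.Build R 'M[R]_(m, n) 'M[R]_(m, n)
  _ mexp_ur mexp_ur_linear.

End Block.

(** The column (1, 1) intertwines the block matrix with Y. This exact formula for the increment
    yields continuity and differentiability with no termwise differentiation of the series. *)
Lemma mexp_subE n (X Y : 'M[R]_n) : mexp Y - mexp X = mexp_ur X Y (Y - X).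
Proof.
have : mexp (block_mx X (Y - X) 0 Y) *m col_mx 1%:M 1%:M = col_mx 1%:M 1%:M *m mexp Y.
  apply: mexp_intertwine; rewrite mul_block_col mul_col_mx.
  by rewrite !mulmx1 !mul1mx add0r addrCA subrr addr0.
rewrite mexp_block mul_block_col mul_col_mx !mulmx1 !mul1mx => /eq_col_mx[<- _].
by rewrite addrAC subrr add0r.
Qed.

Lemma mexp_ur_le n (X Y H : 'M[R]_n) : `|mexp_ur X Y H| <=
  expR ((n + n)%:R * Num.max (Num.max `|X| `|Y|) `|H|).
Proof.
set b := Num.max _ _.
have Xb : `|X| <= b by rewrite !le_max lexx.
have Yb : `|Y| <= b by rewrite !le_max lexx orbT.
have Hb : `|H| <= b by rewrite !le_max lexx orbT.
apply: (@le_trans _ _ `|mexp (block_mx X H 0 Y)|).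
  apply: norm_le_coord => // i j; rewrite /mexp_ur /ursubmx mxE mxE.
  exact: coord_le_norm.
apply: le_trans (norm_mexp _) _; rewrite ler_expR ler_wpM2l//.
apply: norm_le_coord => [|i j]; first exact: le_trans (normr_ge0 X) Xb.
case: (split_ordP i) => k ->; case: (split_ordP j) => l ->;
  rewrite ?block_mxEul ?block_mxEur ?block_mxEdl ?block_mxEdr.
- exact: le_trans (coord_le_norm _ _ _) Xb.
- exact: le_trans (coord_le_norm _ _ _) Hb.
- by rewrite mxE normr0; exact: le_trans (normr_ge0 X) Xb.
- exact: le_trans (coord_le_norm _ _ _) Yb.
Qed.

Lemma mxlin_bound m n p q (L : {linear 'M[R]_(m, n) -> 'M[R]_(p, q)}) c H :
  (forall i j, `|L (delta_mx i j)| <= c) -> `|L H| <= (m * n)%:R * c * `|H|.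
Proof.
move=> Lc; rewrite {1}[H]matrix_sum_delta linear_sum.
apply: le_trans (ler_norm_sum _ _ _) _.
apply: (@le_trans _ _ (\sum_(i < m) n%:R * c * `|H|)); last first.
  by rewrite sumr_const card_ord -[X in X <= _]mulr_natl natrM !mulrA.
apply: ler_sum => i _; rewrite linear_sum.
apply: le_trans (ler_norm_sum _ _ _) _.
apply: (@le_trans _ _ (\sum_(j < n) c * `|H|)); last first.
  by rewrite sumr_const card_ord -[X in X <= _]mulr_natl mulrA.
apply: ler_sum => j _; rewrite linearZ normrZ mulrC.
by rewrite ler_pM// coord_le_norm.
Qed.

Lemma mexp_continuous n : continuous (@mexp n).
Proof.
move=> X; apply/(@cvgrPdist_le _ _ _ (nbhs X)) => e e0.
pose b := expR ((n + n)%:R * (`|X| + 1)).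
have b0 : 0 < b by exact: expR_gt0.
(* The added 1 keeps [c] positive when n = 0, so that it can be divided by. *)
pose c : R := (n * n)%:R * b + 1.
have c0 : 0 < c by rewrite ltr_wpDl// mulr_ge0// ltW.
near=> Y.
have YX1 : `|Y - X| <= 1.
  near: Y; apply/nbhs_ballP; exists 1 => //= Y.
  by rewrite -ball_normE /= distrC => /ltW.
rewrite distrC mexp_subE.
have Y1 : `|Y| <= `|X| + 1.
  rewrite -[Y](subrK X) addrC; apply: le_trans (ler_normD _ _) _.
  by rewrite lerD2l.
have h : `|mexp_ur X Y (Y - X)| <= (n * n)%:R * b * `|Y - X|.
  apply: mxlin_bound => i j; apply: le_trans (mexp_ur_le _ _ _) _.
  rewrite ler_expR ler_wpM2l// !ge_max lerDl ler01 Y1 /=.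
  apply: norm_le_coord => [|k l]; first by rewrite addr_ge0.
  rewrite mxE; case: (_ && _); rewrite ?normr1 ?normr0 ?addr_ge0//.
  by rewrite lerDr.
apply: le_trans h _; apply: (@le_trans _ _ (c * `|Y - X|)).
  by rewrite ler_wpM2r// /c lerDl.
rewrite -ler_pdivlMl//; near: Y; apply/nbhs_ballP; exists (c^-1 * e) => /=.
  by rewrite mulr_gt0 ?invr_gt0.
by move=> Y; rewrite -ball_normE /= distrC => /ltW.
Unshelve. all: by end_near. Qed.

(** By [mexp_subE] the error at H is mexp_ur X (H + X) - mexp_ur X X applied to H. It thus suffices
    that mexp_ur X Y be continuous in Y on each matrix unit, which is the continuity of the
    exponential in twice the dimension. *)
Lemma mexp_differentiable n (X : 'M[R]_n) :
  differentiable (@mexp n) X /\ 'd (@mexp n) X = mexp_ur X X :> ('M_n -> 'M_n).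
Proof.
apply: (@differentiable_eps _ _ _ _ (mexp_ur X X)); first exact: mxlin_continuous.
move=> e e0.
pose c : R := (n * n)%:R + 1.
have c0 : 0 < c by rewrite ltr_wpDl.
have near_e : \forall H \near (0 : 'M[R]_n), forall p : 'I_n * 'I_n,
    `|mexp_ur X (H + X) (delta_mx p.1 p.2) - mexp_ur X X (delta_mx p.1 p.2)| <= e / c.
  apply: (@filter_forall _ _ (fun p (H : 'M[R]_n) =>
    `|mexp_ur X (H + X) (delta_mx p.1 p.2) - mexp_ur X X (delta_mx p.1 p.2)|
      <= e / c) _ (nbhs_filter (0 : 'M[R]_n))) => p.
  set D := delta_mx _ _.
  pose f (H : 'M[R]_n) := mexp_ur X (H + X) D.
  have cf : {for 0, continuous f}.
    pose g (H : 'M[R]_n) := block_mx X D 0 H : 'M[R]_(n + n).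
    have cg : continuous g.
      pose g0 (H : 'M[R]_n) := block_mx 0 0 0 H : 'M[R]_(n + n).
      have lg : linear g0.
        by move=> a A B; rewrite /g0 scale_block_mx add_block_mx !scaler0 !addr0.
      pose G : {linear 'M[R]_n -> 'M[R]_(n + n)} :=
        HB.pack g0 (GRing.isLinear.Build _ _ _ _ _ lg).
      have -> : g = fun H => block_mx X D 0 0 + G H.
        by apply/funext => H; rewrite /g /= /g0 add_block_mx !addr0 add0r.
      move=> H; exact: (@cvgD _ _ _ (nbhs H) _ (cst (block_mx X D 0 0)) G _ _
        (@cvg_cst _ _ _ _ _) (@mxlin_continuous _ _ _ _ G H)).
    have -> : f = ursubmx_lin n n \o (@mexp (n + n) \o (g \o +%R^~ X)) by [].
    apply: continuous_comp; last exact: mxlin_continuous.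
    apply: continuous_comp; last exact: mexp_continuous.
    apply: continuous_comp; last exact: cg.
    exact: (@cvgD _ _ _ (nbhs (0 : 'M[R]_n)) _ id (cst X) 0 X
      (@cvg_id _ _) (@cvg_cst _ _ _ _ _)).
  have /cvgrPdist_le /(_ (e / c)) : f @ 0 --> f 0 by exact: cf.
  rewrite divr_gt0// => /(_ isT).
  have -> : f 0 = mexp_ur X X D by rewrite /f add0r.
  by apply: filterS => H h; rewrite -normrN opprB; exact: h.
near=> H.
have -> : mexp (H + X) - mexp X - mexp_ur X X H =
    mexp_ur X (H + X) H - mexp_ur X X H.
  by rewrite mexp_subE addrK.
pose L := (mexp_ur X (H + X) \- mexp_ur X X).
have h : `|L H| <= (n * n)%:R * (e / c) * `|H|.
  apply: mxlin_bound => i j; rewrite /L /=.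
  by have /(_ (i, j)) : forall p : 'I_n * 'I_n,
    `|mexp_ur X (H + X) (delta_mx p.1 p.2) - mexp_ur X X (delta_mx p.1 p.2)| <= e / c
    by near: H.
apply: le_trans h _; rewrite ler_wpM2r// mulrCA ger_pMr//.
by rewrite ler_pdivrMr// mul1r /c lerDl.
Unshelve. all: by end_near. Qed.

End MatrixExponential.

(** * Smoothness of the exponential, the addition law and Rodrigues' formula *)

Section MatrixExponentialCalculus.
Variable R : realType.

(* The derivative of mexp at x in the direction v is a block of the exponential
   of a larger matrix that is affine in x: hence the induction on the order of
   differentiability, for all dimensions at once. *)
Lemma smooth_mexp n : smooth_on_open setT (@mexp R n).
Proof.
move=> k; elim: k n => [|k IH] n; first by move=> x _; exact: mexp_continuous.
split=> [x _|v]; first exact: (mexp_differentiable x).1.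
pose g0 (H : 'M[R]_n) := block_mx H 0 0 H : 'M[R]_(n + n).
have lg : linear g0.
  by move=> a A B; rewrite /g0 scale_block_mx add_block_mx !scaler0 !addr0.
pose G : {linear 'M[R]_n -> 'M[R]_(n + n)} :=
  HB.pack g0 (GRing.isLinear.Build _ _ _ _ _ lg).
pose g (H : 'M[R]_n) := block_mx 0 v 0 0 + G H.
have oT m : open [set: 'M[R]_m] by exact: openT.
have -> : (fun x => 'D_v (@mexp R n) x) = (ursubmx_lin R n n) \o ((@mexp R (n + n)) \o g).
  apply/funext => x; have [dx dE] := mexp_differentiable x.
  rewrite deriveE // dE /= /mexp_ur /g /= /g0 add_block_mx.
  by rewrite !addr0 !add0r.
apply: (@Ck_linl _ _ _ _ _ _ (ursubmx_lin R n n) (@mexp R (n + n) \o g)).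
- exact: oT.
- exact: mxlin_continuous.
apply: (@Ck_comp _ _ _ _ _ _ _ _ setT); [exact: oT|exact: oT|by []| |exact: IH].
apply: (@Ck_add _ _ _ k setT (cst (block_mx 0 v 0 0)) G); first exact: oT.
  exact: Ck_cst.
by apply: Ck_lin; exact: mxlin_continuous.
Qed.

Lemma derive_mexp_comm n (X v : 'M[R]_n) :
  X *m v = v *m X -> 'd (@mexp R n) X v = v *m mexp X.
Proof.
move=> Xv; rewrite (mexp_differentiable X).2.
(* The sums are shifted by one because the zeroth term vanishes: the k-th power contributes k v
   X^(k-1). *)
apply: (@mxcvg_unique _ _ _ (fun N : nat =>
    \sum_(k < N.+1) (k`!%:R)^-1 *: power_ur X X v k)).
  by rewrite (cvg_shiftS (fun N : nat => \sum_(k < N) (k`!%:R)^-1 *: power_ur X X v k));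
    exact: mexp_ur_cvg.
have uE k : power_ur X X v k.+1 = k.+1%:R *: (v *m (X ^+ k : 'M_n)).
  elim: k => [|k IH]; first by rewrite /= mulmx0 add0r scale1r.
  rewrite [LHS]/= -/(power_ur X X v k.+1) IH -scalemxAr mulmxA Xv -mulmxA.
  rewrite !mulmxE -exprS -[X in _ + X]scale1r -scalerDl.
  by rewrite -[in RHS]natr1.
have -> : (fun N : nat => \sum_(k < N.+1) (k`!%:R)^-1 *: power_ur X X v k) =
    (fun N => mulmx v (mexp_sum X N)).
  apply/funext => N; rewrite big_ord_recl /= scaler0 add0r mulmx_sumr.
  apply: eq_bigr => k _.
  rewrite -[X in _ *: X = _]/(power_ur X X v k.+1) -[in LHS]/(k.+1) uE.
  rewrite -scalemxAr scalerA.
  by congr (_ *: _); rewrite factS natrM invfM mulrAC mulVf ?mul1r// pnatr_eq0.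
exact: (@cvg_mxlin _ _ _ _ _ (mulmx v) _ _ (@mexp_cvg _ _ X)).
Qed.

(** The block matrix commutes with its own exponential; when the upper right block of the latter is
    zero, the off-diagonal entry of this relation is the conclusion. *)
Lemma derive_mexp_eq0_comm n (X v : 'M[R]_n) :
  'd (@mexp R n) X v = 0 -> v *m mexp X = mexp X *m v.
Proof.
rewrite (mexp_differentiable X).2 => u0.
have := @mexp_intertwine R _ _ (block_mx X v 0 X) (block_mx X v 0 X) (block_mx X v 0 X) erefl.
rewrite mexp_block u0 !mulmx_block !(mul0mx, mulmx0, addr0, add0r).
by move=> /eq_block_mx[].
Qed.

Definition is_derive_mx m n (t : R) (M : R -> 'M[R]_(m, n)) (dM : 'M[R]_(m, n)) :=
  forall i j, is_derive t (1 : R) (fun s => M s i j) (dM i j).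

Lemma is_derive_mulmx m n p (M : R -> 'M[R]_(m, n)) (N : R -> 'M[R]_(n, p))
    dM dN t : is_derive_mx t M dM -> is_derive_mx t N dN ->
  is_derive_mx t (fun t => M t *m N t) (dM *m N t + M t *m dN).
Proof.
move=> hM hN i j; rewrite !mxE -big_split /=.
have -> : (fun t => (M t *m N t) i j) =
    \sum_(k < n) ((fun t => M t i k) * (fun t => N t k j)).
  by apply/funext => s; rewrite mxE fct_sumE.
apply: is_derive_sum => k.
have := @is_deriveM _ _ _ _ _ _ _ _ (hM i k) (hN k j).
by rewrite /GRing.scale /= [N t k j * _]mulrC addrC.
Qed.

Lemma is_derive0_mx_cst m n (M : R -> 'M[R]_(m, n)) s t :
  (forall t, is_derive_mx t M 0) -> M s = M t.
Proof.
move=> hM; apply/matrixP => i j.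
apply: (@is_derive_0_is_cst _ (fun t => M t i j)) => u.
by have := hM u i j; rewrite mxE.
Qed.

Lemma is_derive_mexp_line n (X Y : 'M[R]_n) (t : R) : X *m Y = Y *m X ->
  is_derive_mx t (fun t => mexp (t *: X + Y)) (X *m mexp (t *: X + Y)).
Proof.
move=> XY i j.
pose h : R -> 'M[R]_n := *:%R^~ X.
have hd : is_diff t (h + cst Y) (h + 0) by apply: is_diffD.
rewrite addr0 in hd.
have [dm dE] := mexp_differentiable (t *: X + Y).
have hm : is_diff ((h + cst Y) t) (@mexp R n) ('d (@mexp R n) (t *: X + Y)).
  exact: DiffDef.
have [df vE] := @is_diff_comp _ _ _ _ _ _ _ _ _ hd hm.
have dm' : derivable (@mexp R n \o (h + cst Y)) t (1 : R) by exact: diff_derivable.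
have := derive_mx dm'; rewrite deriveE // vE /= /h scale1r derive_mexp_comm; last first.
  by rewrite mulmxDl mulmxDr -scalemxAl -scalemxAr XY.
move=> /matrixP/(_ i j); rewrite [in X in _ = X]mxE => ->.
by apply: DeriveDef => //; exact: (derivable_mxP _ _ _).1.
Qed.

(** The product of e^(-tX) with M t is constant. The factor stays on the left because the
    invertibility of [mexp X] is only deduced afterwards, by applying this lemma to e^(tX). *)
Lemma mexp_ode n p (X : 'M[R]_n) (M : R -> 'M[R]_(n, p)) :
  (forall t, is_derive_mx t M (X *m M t)) -> mexp (- X) *m M 1 = M 0.
Proof.
move=> hM.
have h t : is_derive_mx t (fun t => mexp (t *: - X + 0) *m M t) 0.
  have hX : - X *m 0 = 0 *m - X by rewrite mulmx0 mul0mx.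
  have := is_derive_mulmx (is_derive_mexp_line t hX) (hM t).
  rewrite (_ : _ + _ = 0)//.
  have e : mexp (t *: - X + 0) *m X = X *m mexp (t *: - X + 0).
    by apply: mexp_intertwine; rewrite addr0 scalerN mulNmx mulmxN -scalemxAl -scalemxAr.
  by rewrite mulmxA e !mulNmx addNr.
have := is_derive0_mx_cst 1 0 h.
by rewrite scale1r scale0r !addr0 mexp0 mul1mx.
Qed.

Lemma mexpNK n (X : 'M[R]_n) : mexp (- X) *m mexp X = 1%:M.
Proof.
have h0 : X *m 0 = 0 *m X by rewrite mulmx0 mul0mx.
have := mexp_ode (fun t => is_derive_mexp_line t h0).
by rewrite scale1r scale0r !addr0 mexp0.
Qed.

Lemma mexpKN n (X : 'M[R]_n) : mexp X *m mexp (- X) = 1%:M.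
Proof. by rewrite -{1}[X]opprK mexpNK. Qed.

Lemma mexp_solution n p (X : 'M[R]_n) (M : R -> 'M[R]_(n, p)) :
  (forall t, is_derive_mx t M (X *m M t)) -> M 1 = mexp X *m M 0.
Proof. by move=> /mexp_ode <-; rewrite mulmxA mexpKN mul1mx. Qed.

Lemma mexpD n (X Y : 'M[R]_n) : X *m Y = Y *m X ->
  mexp (X + Y) = mexp X *m mexp Y.
Proof.
move=> XY; have := mexp_solution (fun t => is_derive_mexp_line t XY).
by rewrite scale1r scale0r add0r.
Qed.

Lemma mexp_rodrigues n (X : 'M[R]_n) (a : R) : a != 0 ->
  X *m X *m X = - (a ^+ 2) *: X ->
  mexp X = 1%:M + (sin a / a) *: X + ((1 - cos a) / a ^+ 2) *: (X *m X).
Proof.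
move=> a0 X3.
(* This is the formula for tX. The relation X^3 = - a^2 X makes it a solution of M' = X M with M 0 =
   1, and such a solution is e^(tX). *)
pose M (t : R) := 1%:M + (sin (a * t) / a) *: X +
  ((1 - cos (a * t)) / a ^+ 2) *: (X *m X).
suff : M 1 = mexp X *m M 0.
  rewrite /M mulr1 mulr0 sin0 cos0 subrr !mul0r !scale0r !addr0 mulmx1.
  by move=> <-.
apply: mexp_solution => t i j.
have -> : X *m M t = cos (a * t) *: X + (sin (a * t) / a) *: (X *m X).
  rewrite /M !mulmxDr mulmx1 -!scalemxAr mulmxA X3 addrAC; congr (_ + _).
  rewrite scalerA -[X in X + _]scale1r -scalerDl; congr (_ *: _).
  by field.
rewrite !mxE.
have ha : is_derive t (1 : R) (fun t => a * t) a.
  have h := is_deriveZ a (is_derive_id t (1 : R)).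
  by apply: is_derive_eq h _; rewrite /GRing.scale /= mulr1.
have hs : is_derive t (1 : R) (sin \o ( *%R a)) (cos (a * t) * a).
  exact: is_derive1_comp.
have hc : is_derive t (1 : R) (cos \o ( *%R a)) (- sin (a * t) * a).
  exact: is_derive1_comp.
have -> : (fun t => M t i j) =
    cst ((1%:M : 'M[R]_n) i j) + (X i j / a) *: (sin \o ( *%R a)) +
    ((X *m X) i j / a ^+ 2) *: (cst 1 - cos \o ( *%R a)).
  apply/funext => s; transitivity ((1%:M : 'M[R]_n) i j +
      X i j / a * sin (a * s) + (X *m X) i j / a ^+ 2 * (1 - cos (a * s))) => //.
  rewrite /M; set Z := X *m X.
  by rewrite !mxE; field.
have h1 := is_deriveD (is_derive_cst ((1%:M : 'M[R]_n) i j) t (1 : R))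
  (is_deriveZ (X i j / a) hs).
have h2 := is_deriveB (is_derive_cst (1 : R) t (1 : R)) hc.
apply: is_derive_eq (is_deriveD h1 (is_deriveZ ((X *m X) i j / a ^+ 2) h2)) _.
rewrite /GRing.scale /= !mxE.
by field.
Qed.

End MatrixExponentialCalculus.

(** * Lower bound for the injectivity radius from two spectral hypotheses *)

Definition frob2 (R : realType) m n (v : 'M[R]_(m, n)) : R :=
  \sum_i \sum_j v i j ^+ 2.

Lemma frob2_ge0 (R : realType) m n (v : 'M[R]_(m, n)) : 0 <= frob2 v.
Proof. by apply: sumr_ge0 => i _; apply: sumr_ge0 => j _; exact: sqr_ge0. Qed.

Lemma coord_le_frob2 (R : realType) m n (v : 'M[R]_(m, n)) i j :
  v i j ^+ 2 <= frob2 v.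
Proof.
rewrite /frob2 (bigD1 i) //= (bigD1 j) //= -addrA lerDl addr_ge0 //.
  by apply: sumr_ge0 => k _; exact: sqr_ge0.
by apply: sumr_ge0 => k _; apply: sumr_ge0 => l _; exact: sqr_ge0.
Qed.

Lemma parallelogram_frob2 (R : realType) m n (x y : 'M[R]_(m, n)) :
  frob2 (x - y) + frob2 (x + y) = 2 * (frob2 x + frob2 y).
Proof.
rewrite /frob2 -!big_split mulr_sumr; apply: eq_bigr => i _ /=.
rewrite -!big_split mulr_sumr; apply: eq_bigr => j _ /=.
by rewrite !mxE; ring.
Qed.

(* phi is a faithful real matrix representation of the ambient algebra, through
   which the calculus of ex reduces to that of mexp. *)
Section LowerBound.
Variables (R : realType) (A : pzRingType) (a b D : nat).
Variables (rho : A -> 'M[R]_(a, b)) (sigma : 'M[R]_(a, b) -> A) (ex : A -> A).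
Variables (pts alg : set A) (inner : A -> A -> R).
Variables (phi : A -> 'M[R]_D) (J : {linear 'M[R]_(a, b) -> 'M[R]_D})
  (J' : {linear 'M[R]_D -> 'M[R]_(a, b)}).
Variables (r0 c : R).

Hypothesis rhoK : cancel rho sigma.
Hypothesis sigmaK : cancel sigma rho.
Hypothesis rhoB : {morph rho : X Y / X - Y}.
Hypothesis phiE : forall X, phi X = J (rho X).
Hypothesis JK : cancel J J'.
Hypothesis phi1 : phi 1 = 1%:M.
Hypothesis phiM : forall X Y, phi (X * Y) = phi X *m phi Y.
Hypothesis phi_ex : forall X, phi (ex X) = mexp (phi X).
Hypothesis alg0 : alg 0.
Hypothesis alg_lin : forall t X Y, alg X -> alg Y -> alg (sigma (t *: rho X + rho Y)).
(** [c] is the ratio between the metric and the Euclidean norm of the coordinates: 1 for complex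
    matrices, 8 for the Clifford algebra. *)
Hypothesis c0 : 0 < c.
Hypothesis innerE : forall X, alg X -> inner X X = c * frob2 (rho X).
Hypothesis comm_of_comm_ex : forall X Y, alg X -> alg Y -> inner X X < r0 ^+ 2 ->
  ex X * Y = Y * ex X -> X * Y = Y * X.
Hypothesis ex_eq1 : forall Z, alg Z -> inner Z Z < 4 * r0 ^+ 2 -> ex Z = 1 -> Z = 0.

Let L := @LieGroup R A 'M[R]_(a, b) rho ex pts alg inner.

Let phi_inj : injective phi.
Proof. by move=> X Y; rewrite !phiE => /(can_inj JK) /(can_inj rhoK). Qed.

Let phiB X Y : phi (X - Y) = phi X - phi Y.
Proof. by rewrite !phiE rhoB linearB. Qed.

Let rho0 : rho 0 = 0. Proof. by rewrite -[0](subrr 0) rhoB subrr. Qed.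

Let ex_comm X : ex X * X = X * ex X.
Proof. by apply: phi_inj; rewrite !phiM phi_ex; exact: mexp_intertwine. Qed.

Let algB X Y : alg X -> alg Y -> alg (X - Y).
Proof.
move=> aX aY; have := alg_lin (-1) aY aX.
by rewrite scaleN1r addrC -rhoB rhoK.
Qed.

(** The parallelogram law bounds |X - Y|^2 by 2 |X|^2 + 2 |Y|^2, whence the 4 in [ex_eq1]. *)
Let inner_sub X Y : alg X -> alg Y -> inner X X < r0 ^+ 2 -> inner Y Y < r0 ^+ 2 ->
  inner (X - Y) (X - Y) < 4 * r0 ^+ 2.
Proof.
move=> aX aY; rewrite !innerE //; last exact: algB.
move=> hX hY; have := parallelogram_frob2 (rho X) (rho Y).
have := frob2_ge0 (rho X + rho Y); rewrite rhoB.
set u := frob2 (rho X) in hX *; set v := frob2 (rho Y) in hY *.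
set w := frob2 _; set z := frob2 _ => w0 e.
have : c * z + c * w = 2 * (c * u + c * v) by rewrite -mulrDr e; ring.
have : 0 <= c * w by rewrite mulr_ge0// ltW.
lra.
Qed.

Lemma ex_inj_ball X Y : alg X -> alg Y -> inner X X < r0 ^+ 2 ->
  inner Y Y < r0 ^+ 2 -> ex X = ex Y -> X = Y.
Proof.
move=> aX aY hX hY eXY.
have XY : X * Y = Y * X.
  by apply: comm_of_comm_ex => //; rewrite eXY ex_comm.
apply/eqP; rewrite -subr_eq0; apply/eqP; apply: ex_eq1; first exact: algB.
  exact: inner_sub.
apply: phi_inj; rewrite phi_ex phiB mexpD; last first.
  by rewrite mulmxN mulNmx -!phiM XY.
by rewrite -phi_ex eXY phi_ex mexpKN phi1.
Qed.

Lemma immersion_ball X Y : alg X -> alg Y -> inner X X < r0 ^+ 2 ->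
  'd (@mexp R D) (phi X) (phi Y) = 0 -> Y = 0.
Proof.
move=> aX aY hX dXY.
have XY : X * Y = Y * X.
  apply: comm_of_comm_ex => //; apply: phi_inj; rewrite !phiM phi_ex.
  by rewrite derive_mexp_eq0_comm.
move: dXY; rewrite derive_mexp_comm; last by rewrite -!phiM XY.
move=> /(congr1 (mulmx^~ (mexp (- phi X)))); rewrite -mulmxA mexpKN mulmx1 mul0mx.
by rewrite -(linear0 J) -rho0 -phiE => /phi_inj.
Qed.

Section AtPoint.
Variables (p q : A).
Hypothesis qp : q * p = 1.
Variable r : R.
Hypotheses (r_gt0 : 0 < r) (r_lt : r < r0).

(** In coordinates, X |-> p * ex X on the whole algebra, written through [J] and [J'] so that its
    smoothness is that of [mexp]. [F] is the same map on row vectors, where the inverse function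
    theorem is available. *)
Let F0 (v : 'M[R]_(a, b)) : 'M[R]_(a, b) := J' (phi p *m mexp (J v)).
Let F (x : 'rV[R]_(a * b)) : 'rV[R]_(a * b) := mxvec (F0 (vec_mx x)).
Let g : set 'rV[R]_(a * b) := [set x | alg (sigma (vec_mx x))].
(** A closed ball, for compactness; as r < r0, the spectral hypotheses still hold on it. *)
Let C : set 'rV[R]_(a * b) := [set x | g x /\ c * frob2 (vec_mx x) <= r ^+ 2].

Let F0E X : F0 (rho X) = rho (p * ex X).
Proof. by rewrite /F0 -phiE -phi_ex -phiM phiE JK. Qed.

Let oT m n : open [set: 'M[R]_(m, n)]. Proof. exact: openT. Qed.

Let smooth_F0 : smooth_on_open setT F0.
Proof.
move=> k; apply: Ck_linl; [exact: oT|exact: mxlin_continuous|].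
apply: Ck_linl; [exact: oT|exact: mxlin_continuous|].
apply: (@Ck_comp _ _ _ _ _ _ _ setT setT J (@mexp R D)); [exact: oT|exact: oT|by []| |].
  by apply: Ck_lin; exact: mxlin_continuous.
exact: smooth_mexp.
Qed.

Let smooth_F : smooth_on_open setT F.
Proof.
move=> k; apply: (@Ck_linl _ _ _ _ _ _ (@mxvec R a b) (fun x => F0 (vec_mx x))).
- exact: oT.
- exact: mxlin_continuous.
apply: (@Ck_comp _ _ _ _ _ _ _ setT setT (@vec_mx R a b) F0);
  [exact: oT|exact: oT|by []| |exact: smooth_F0].
by apply: Ck_lin; exact: mxlin_continuous.
Qed.

Let diff_lin_mx m n m' n' (f : {linear 'M[R]_(m, n) -> 'M[R]_(m', n')}) x :
  is_diff x f f.
Proof.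
by apply: DiffDef; [apply: linear_differentiable|apply: diff_lin];
   exact: mxlin_continuous.
Qed.

Let JF0 v : J (F0 v) = phi p *m mexp (J v).
Proof. by rewrite -[v]sigmaK F0E -!phiE phiM phi_ex. Qed.

(** Both sides of J F = phi(p) exp(J) are differentiated, instead of [F] itself, because [J'] is
    only a left inverse of [J] and would obstruct cancelling phi p. *)
Let dF x v : J (vec_mx ('d F x v)) =
  phi p *m 'd (@mexp R D) (J (vec_mx x)) (J (vec_mx v)).
Proof.
have h1 : is_diff x (J \o vec_mx) (J \o vec_mx).
  by apply: is_diff_comp; exact: diff_lin_mx.
have h2 : is_diff ((J \o vec_mx) x) (@mexp R D) ('d (@mexp R D) (J (vec_mx x))).
  by apply: DiffDef => //; exact: (mexp_differentiable _).1.
have h3 := is_diff_comp h1 h2.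
have [_ h4] := is_diff_comp h3 (diff_lin_mx (mulmx (phi p)) _).
have k1 : is_diff x F ('d F x).
  by apply: DiffDef => //; have [/(_ x I)] := smooth_F 1.
have k2 := is_diff_comp k1 (diff_lin_mx (@vec_mx R a b) _).
have [_ k3] := is_diff_comp k2 (diff_lin_mx J _).
have e : J \o (vec_mx \o F) = mulmx (phi p) \o (@mexp R D \o (J \o vec_mx)).
  by apply/funext => y; rewrite /= mxvecK JF0.
move: k3; rewrite e h4 => k3.
exact: (esym (congr1 (fun f : _ -> 'M_D => f v) k3)).
Qed.

Let inv_p (M N : 'M[R]_D) : phi p *m M = phi p *m N -> M = N.
Proof.
move=> /(congr1 (mulmx (phi q))); rewrite !mulmxA -phiM qp phi1.
by rewrite !mul1mx.
Qed.

Let f := @riemannian_exp R L p.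

Let C_of_alg X : alg X -> c * frob2 (rho X) <= r ^+ 2 -> C (mxvec (rho X)).
Proof. by move=> aX hX; split; rewrite /g /= mxvecK ?rhoK. Qed.

Let alg_of_C x : C x -> [/\ alg (sigma (vec_mx x)),
  inner (sigma (vec_mx x)) (sigma (vec_mx x)) < r0 ^+ 2 &
  x = mxvec (rho (sigma (vec_mx x)))].
Proof.
move=> [gx hx]; split=> //; last by rewrite sigmaK vec_mxK.
rewrite innerE // sigmaK; apply: le_lt_trans hx _.
by rewrite ltrXn2r// ?ltW// (lt_trans r_gt0).
Qed.

Let ballP X : @lie_ball R L r X <-> alg X /\ inner X X < r ^+ 2.
Proof.
rewrite /lie_ball /lie_norm /=; split=> -[aX hX]; split=> //.
  rewrite -(@sqr_sqrtr _ (inner X X)); last first.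
    by rewrite innerE// mulr_ge0 ?frob2_ge0// ltW.
  by rewrite ltrXn2r ?sqrtr_ge0// ltW.
by rewrite -(ger0_norm (ltW r_gt0)) -sqrtr_sqr ltr_sqrt// exprn_gt0.
Qed.

Let ball_C X : @lie_ball R L r X -> C (mxvec (rho X)).
Proof. by move=> /ballP[aX hX]; apply: C_of_alg => //; rewrite -innerE // ltW. Qed.

Let glin t x y : g x -> g y -> g (t *: x + y).
Proof. by rewrite /g /= linearP => gx gy; have := alg_lin t gx gy; rewrite !sigmaK. Qed.

Let g0 : g 0.
Proof. by rewrite /g /= linear0 -rho0 rhoK. Qed.

Let F_inj x y : C x -> C y -> F x = F y -> x = y.
Proof.
move=> /alg_of_C[ax hx xE] /alg_of_C[ay hy yE]; rewrite xE yE /F !mxvecK.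
move=> /(can_inj mxvecK); move/(congr1 J); rewrite !JF0 -!phiE -!phi_ex.
by move=> /inv_p /phi_inj /ex_inj_ball ->.
Qed.

Let dF_inj x v : C x -> g v -> 'd F x v = 0 -> v = 0.
Proof.
move=> /alg_of_C[ax hx xE] gv dFv; have := dF x v; rewrite dFv !linear0.
rewrite -(mulmx0 _ (phi p)) => /inv_p /esym.
have -> : J (vec_mx x) = phi (sigma (vec_mx x)) by rewrite phiE sigmaK.
have -> : J (vec_mx v) = phi (sigma (vec_mx v)) by rewrite phiE sigmaK.
move=> /(immersion_ball ax gv hx) /(congr1 rho); rewrite sigmaK rho0 => v0.
by rewrite -[v]vec_mxK v0 linear0.
Qed.

Let compact_C : compact C.
Proof.
apply: bounded_closed_compact.
  (* From y^2 <= s follows y <= s + 1, which avoids a square root. *)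
  exists (r ^+ 2 / c + 1); split; first exact: num_real.
  move=> M hM x [_ hx]; apply: norm_le_coord => [|i j].
    apply: ltW; apply: lt_trans hM.
    by rewrite ltr_pwDr// divr_ge0 ?sqr_ge0// ltW.
  apply: ltW; apply: le_lt_trans hM.
  have : x i j ^+ 2 <= r ^+ 2 / c.
    rewrite ler_pdivlMr// mulrC; apply: le_trans hx; rewrite ler_pM2l//.
    rewrite -[x]vec_mxK (ord1 i).
    case/mxvec_indexP: j => k l; rewrite mxvecE.
    by rewrite (le_trans (coord_le_frob2 _ k l))// vec_mxK.
  rewrite -[x i j ^+ 2]real_normK ?num_real//.
  set y := `|x i j|; have : 0 <= y by exact: normr_ge0.
  by nra.
have [K gK] := subspace_kermx g0 glin.
have -> : C = (mulmxr K @^-1` [set 0]) `&`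
    ((fun x : 'rV[R]_(a * b) => c * frob2 (vec_mx x)) @^-1` [set x | x <= r ^+ 2]).
  by apply/seteqP; split=> x [/gK].
apply: closedI; apply: closed_comp.
- by move=> x _; exact: (@mxlin_continuous _ _ _ _ (mulmxr K)).
- exact: (accessible_closed_set1 (hausdorff_accessible (@norm_hausdorff _ _))).
- move=> x _.
  have -> : (fun x : 'rV[R]_(a * b) => c * frob2 (vec_mx x)) = (fun x =>
      c * \sum_i \sum_j (x 0 (mxvec_index i j) * x 0 (mxvec_index i j))).
    apply/funext => y; congr (_ * _); apply: eq_bigr => i _; apply: eq_bigr => j _.
    by rewrite mxE expr2.
  suff h : Ck 0 setT (fun x : 'rV[R]_(a * b) =>
      c * \sum_i \sum_j (x 0 (mxvec_index i j) * x 0 (mxvec_index i j))).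
    exact: h x I.
  have Cc i : Ck 0 setT (fun x : 'rV[R]_(a * b) => x 0 i).
    apply: Ck_coord; first exact: oT.
    by apply: (@Ck_lin _ _ _ _ _ idfun) => y; exact: cvg_id.
  apply: Ck_mul; [exact: oT|exact: Ck_cst|].
  apply: Ck_sum => [|i]; first exact: oT.
  apply: Ck_sum => [|j]; first exact: oT.
  by apply: Ck_mul; [exact: oT|exact: Cc|exact: Cc].
- exact: closed_le.
Qed.

Lemma diffeo_ball : diffeo_onto_image (@lie_ball R L r) f.
Proof.
have f_inj X Y : @lie_ball R L r X -> @lie_ball R L r Y -> f X = f Y -> X = Y.
  move=> /ball_C CX /ball_C CY fXY.
  apply: (can_inj rhoK); apply: (can_inj mxvecK); apply: (F_inj CX CY).
  by rewrite /F !mxvecK !F0E; congr (mxvec (rho _)).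
split.
  move=> X _; exists setT, F0; split=> //; exact: openT.
(* A global inverse by choice, with value 0 off the image; by injectivity it agrees there with the
   local smooth inverses obtained below from compactness. *)
pose h (Y : lie_ambient L) : lie_ambient L :=
  xget (0 : A) [set X : A | @lie_ball R L r X /\ f X = Y].
have hf X : @lie_ball R L r X -> h (f X) = X.
  move=> SX; apply: (@xget_unique A 0 [set X' | @lie_ball R L r X' /\ f X' = f X] X) => //.
  by move=> Y [SY fY]; exact: f_inj.
exists h; split=> // _ [X SX <-].
have CX := ball_C SX.
have gC : C `<=` g by move=> x [].
have [U [k [oU UX sk kF]]] := compact_smooth_left_inverse smooth_F g0 glin
  gC compact_C F_inj CX (fun v => @dF_inj _ v CX).
have FE Z : F (mxvec (rho Z)) = mxvec (rho (f Z)) by rewrite /F mxvecK F0E.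
have cmv : continuous (@mxvec R a b) by exact: mxlin_continuous.
have oU' : open (@mxvec R a b @^-1` U) by apply: open_comp => // y _; exact: cmv.
exists (@mxvec R a b @^-1` U), (fun v => vec_mx (k (mxvec v))); split=> //.
- by rewrite /= -FE.
- move=> n; apply: (@Ck_linl _ _ _ _ _ _ (@vec_mx R a b) (k \o @mxvec R a b)).
  + exact: oU'.
  + exact: mxlin_continuous.
  apply: (@Ck_comp _ _ _ _ _ _ _ (@mxvec R a b @^-1` U) U (@mxvec R a b) k).
  + exact: oU'.
  + exact: oU.
  + by [].
  + by apply: Ck_lin; exact: mxlin_continuous.
  + exact: sk.
move=> _ [Z SZ <-] /= UZ; rewrite hf //.
rewrite -FE (kF _ (ball_C SZ)) ?FE //; exact: mxvecK.
Qed.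

End AtPoint.

Lemma injectivity_radius_at_ge (p q : A) : 0 < r0 -> q * p = 1 ->
  (r0%:E <= @injectivity_radius_at R L p)%E.
Proof.
move=> r00 qp; apply/lee_subgt0Pr => e e0.
(* For e >= r0 the radius r0 - e is not positive, and r0 / 2 serves instead. *)
have [er|er] := ltP e r0; last first.
  apply: (@le_trans _ _ (r0 / 2)%:E).
    by rewrite -EFinB lee_fin; lra.
  apply: ereal_sup_ubound; exists (r0 / 2) => //; split; first lra.
  by apply: (diffeo_ball qp); lra.
rewrite -EFinB; apply: ereal_sup_ubound; exists (r0 - e) => //; split; first lra.
by apply: (diffeo_ball qp); lra.
Qed.

End LowerBound.

(** * Upper bound from two points with the same exponential *)

Lemma injectivity_radius_at_le (R : realType) (L : lie_group R)
    (p X Y : lie_ambient L) (r0 : R) :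
  lie_algebra X -> lie_algebra Y -> lie_norm X <= r0 -> lie_norm Y <= r0 ->
  lie_exp X = lie_exp Y -> X <> Y ->
  (injectivity_radius_at p <= r0%:E)%E.
Proof.
move=> aX aY hX hY eXY nXY; apply: ge_ereal_sup => _ [r [r_gt0 [_ [g [gK _]]]] <-].
rewrite lee_fin leNgt; apply/negP => r0r; apply: nXY.
rewrite -(gK X) -1?(gK Y) /riemannian_exp ?eXY //.
  by split=> //; exact: le_lt_trans r0r.
by split=> //; exact: le_lt_trans r0r.
Qed.

(** * Bivectors of the Clifford algebra as skew matrices *)

Definition dot (R : pzRingType) n (u v : 'rV[R]_n) : R := \sum_i u 0 i * v 0 i.

Section CliffordBivectors.
Variables (R : realType) (N : nat).
Local Notation cl := (clifford R N).
Local Notation e := (@clgen R N).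
Local Notation vec := (@clvec R N).
Implicit Types (S W : 'M[R]_N) (u v : 'rV[R]_N) (x y : cl).

(** Summing over all pairs, not only i < j, makes [biv] linear on all matrices and sends u^T v to
    the product of u and v. A skew S then has each pair counted twice, the source of the factors 2
    and 4 below. *)
Definition biv S : cl := \sum_i \sum_j S i j *: (e i * e j).

Lemma biv_linear : linear biv.
Proof.
move=> a S S'; rewrite /biv scaler_sumr -big_split; apply: eq_bigr => i _ /=.
rewrite scaler_sumr -big_split; apply: eq_bigr => j _ /=.
by rewrite !mxE scalerDl scalerA.
Qed.
HB.instance Definition _ := GRing.isLinear.Build R 'M[R]_N cl _ biv biv_linear.

Lemma clvec_linear : linear vec.
Proof.
move=> a u v; rewrite /clvec scaler_sumr -big_split; apply: eq_bigr => i _ /=.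
by rewrite !mxE scalerDl scalerA.
Qed.
HB.instance Definition _ := GRing.isLinear.Build R 'rV[R]_N cl _ vec clvec_linear.

Lemma biv_outer u v : biv (u^T *m v) = vec u * vec v.
Proof.
rewrite /clvec mulr_suml; apply: eq_bigr => i _.
rewrite mulr_sumr; apply: eq_bigr => j _.
by rewrite mxE big_ord1 mxE -scalerAl -scalerAr scalerA.
Qed.

Lemma clvec_relation u v : vec u * vec v + vec v * vec u = (- 2 * dot u v) *: 1.
Proof.
have -> : vec v * vec u = \sum_i \sum_j (u 0 i * v 0 j) *: (e j * e i).
  rewrite /clvec mulr_sumr; apply: eq_bigr => i _.
  rewrite mulr_suml; apply: eq_bigr => j _.
  by rewrite -scalerAl -scalerAr scalerA mulrC.
rewrite -biv_outer /biv -big_split /= mulr_sumr scaler_suml; apply: eq_bigr => i _.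
rewrite -big_split /= (bigD1 i) //= big1 => [|j nji]; rewrite !mxE big_ord1 !mxE.
  rewrite -scalerDr clgen_relation eqxx addr0 scalerA mulr1n mulr2n.
  by congr (_ *: _); ring.
by rewrite -scalerDr clgen_relation eq_sym (negPf nji) oppr0 mul0rn scale0r scaler0.
Qed.

Lemma clvec_sqr v : vec v * vec v = (- dot v v) *: 1.
Proof.
have := clvec_relation v v; rewrite -mulr2n -scaler_nat => h.
apply: (@scalerI _ _ (2 : R)); first by rewrite pnatr_eq0.
by rewrite h scalerA; congr (_ *: _); ring.
Qed.

Lemma clvec_delta i : vec (delta_mx 0 i) = e i.
Proof.
rewrite /clvec (bigD1 i) //= big1 ?addr0 => [|j /negPf nji]; rewrite mxE eqxx /=.
  by rewrite eqxx scale1r.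
by rewrite nji scale0r.
Qed.

Lemma clcoef_gen i j : clcoef (e j) [set i]%SET = (i == j)%:R.
Proof. by rewrite /clgen clcoef_base (inj_eq set1_inj). Qed.

Lemma clcoef_vec v i : clcoef (vec v) [set i]%SET = v 0 i.
Proof.
rewrite /clvec /clcoef summxE (bigD1 i) //= big1 ?addr0 => [|j /negPf nji].
  by rewrite mxE -/(clcoef (e i) [set i]%SET) clcoef_gen eqxx mulr1.
by rewrite mxE -/(clcoef (e j) [set i]%SET) clcoef_gen eq_sym nji mulr0.
Qed.

Lemma clvec_inj : injective vec.
Proof. by move=> u v uv; apply/rowP => i; rewrite -!clcoef_vec uv. Qed.

(** The commutator of e_k e_l with e_j is 2 delta_kj e_l - 2 delta_lj e_k, and skewness merges the
    two resulting sums, hence the 4. *)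
Lemma biv_comm_gen S j : S^T = - S ->
  biv S * e j - e j * biv S = vec (row j (4 *: S)).
Proof.
move=> Ss.
have pq k l : e k * e l * e j - e j * (e k * e l) =
    (2 * (k == j)%:R) *: e l - (2 * (l == j)%:R) *: e k.
  move: (clgen_relation R l j) (clgen_relation R k j).
  move: ((l == j)%:R : R) ((k == j)%:R : R) => dl dk r1 r2.
  have e1 : e l * e j = (- dl *+ 2) *: 1 - e j * e l by rewrite -r1 addrK.
  have e2 : e j * e k = (- dk *+ 2) *: 1 - e k * e j by rewrite -r2 [_ + e j * _]addrC addrK.
  rewrite -mulrA e1 [e j * (_ * _)]mulrA e2 mulrBr mulrBl -scalerAr -scalerAl.
  rewrite mulr1 mul1r mulrA opprB addrA addrNK addrC -scaleNr -[in RHS]scaleNr.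
  by congr (_ *: _ + _ *: _); rewrite mulr2n; ring.
rewrite /biv mulr_suml mulr_sumr -sumrB.
transitivity (\sum_k \sum_l S k l *: ((2 * (k == j)%:R) *: e l - (2 * (l == j)%:R) *: e k)).
  apply: eq_bigr => k _; rewrite mulr_suml mulr_sumr -sumrB; apply: eq_bigr => l _.
  by rewrite -scalerAl -scalerAr -scalerBr pq.
transitivity (\sum_k \sum_l S k l *: ((2 * (k == j)%:R) *: e l) -
  \sum_k \sum_l S k l *: ((2 * (l == j)%:R) *: e k)).
  rewrite -sumrB; apply: eq_bigr => k _; rewrite -sumrB; apply: eq_bigr => l _.
  exact: scalerBr.
rewrite (bigD1 j) //= [X in _ + X - _]big1 ?addr0; last first.
  move=> k /negPf nkj; rewrite big1 // => l _.
  by rewrite nkj mulr0 scale0r scaler0.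
rewrite /clvec -sumrB; apply: eq_bigr => i _.
rewrite [X in _ - X](bigD1 j) //= [X in _ - (_ + X)]big1 ?addr0; last first.
  by move=> l /negPf nlj; rewrite nlj mulr0 scale0r scaler0.
rewrite eqxx !mulr1 !scalerA -scalerBl !mxE; congr (_ *: _).
by move/matrixP/(_ i j): Ss; rewrite !mxE => ->; ring.
Qed.

Lemma biv_comm_vec S v : S^T = - S ->
  biv S * vec v - vec v * biv S = vec (v *m (4 *: S)).
Proof.
move=> Ss; rewrite [in RHS](row_sum_delta v) mulmx_suml [RHS]linear_sum.
move: (biv S) (fun i => biv_comm_gen i Ss) => B hB.
rewrite -[vec v]/(\sum_i v 0 i *: e i) mulr_suml mulr_sumr -sumrB.
apply: eq_bigr => i _.
rewrite -scalerAl -scalerAr -scalerBr hB -scalemxAl -rowE.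
by rewrite [RHS]linearZ.
Qed.

(** [spin_to_so] acts on columns and [biv_comm_vec] on rows, whence a transpose, that is a sign. *)
Lemma spin_to_so_biv S : S^T = - S -> spin_to_so (biv S) = - (4 *: S).
Proof.
move=> Ss; apply/matrixP => i j; rewrite mxE biv_comm_gen // clcoef_vec !mxE.
by move/matrixP/(_ i j): Ss; rewrite !mxE => ->; rewrite mulrN.
Qed.

Lemma sum_pairs (V : nmodType) (F : 'I_N -> 'I_N -> V) : \sum_i \sum_j F i j =
  \sum_(i < N) (F i i + \sum_(j < N | (i < j)%N) (F i j + F j i)).
Proof.
have h i : \sum_j F i j = F i i +
    (\sum_(j < N | (i < j)%N) F i j + \sum_(j < N | (j < i)%N) F i j).
  rewrite (bigD1 i) //= (bigID (fun j : 'I_N => (i < j)%N)) /=.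
  congr (_ + (_ + _)); apply: eq_bigl => j.
    by rewrite -val_eqE /=; case: ltngtP.
  by rewrite -val_eqE /=; case: ltngtP.
under eq_bigr do rewrite h.
rewrite !big_split /=; congr (_ + _); rewrite [X in _ + X](exchange_big_dep xpredT) //=.
by rewrite -big_split /=; apply: eq_bigr => i _; rewrite big_split.
Qed.

Lemma biv_skewE S : S^T = - S ->
  biv S = \sum_(i < N) \sum_(j < N | (i < j)%N) (2 * S i j) *: (e i * e j).
Proof.
move=> Ss; rewrite /biv sum_pairs; apply: eq_bigr => i _.
have ST k l : S l k = - S k l by move/matrixP/(_ k l): Ss; rewrite !mxE.
have Sii : S i i = 0 by have := ST i i; lra.
rewrite Sii scale0r add0r; apply: eq_bigr => j ij.
have -> : e j * e i = - (e i * e j).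
  have := clgen_relation R i j; rewrite (_ : (i == j) = false) ?oppr0 ?mul0rn ?scale0r.
    by move=> /eqP; rewrite addrC addr_eq0 => /eqP.
  by apply/eqP => ij'; rewrite ij' ltnn in ij.
by rewrite (ST i j) scalerN scaleNr opprK -scalerDl; congr (_ *: _); ring.
Qed.

Definition bivector x :=
  exists b : 'M[R]_N, x = \sum_(i < N) \sum_(j < N | (i < j)%N) b i j *: (e i * e j).

Lemma bivectorP x : bivector x <-> exists S, S^T = - S /\ x = biv S.
Proof.
split=> [[b xE]|[S [Ss ->]]]; last by exists (2 *: S); rewrite biv_skewE //;
  apply: eq_bigr => i _; apply: eq_bigr => j _; rewrite mxE.
pose S : 'M[R]_N := \matrix_(i, j)
  (if (i < j)%N then b i j / 2 else if (j < i)%N then - (b j i / 2) else 0).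
have Ss : S^T = - S.
  apply/matrixP => i j; rewrite !mxE; case: ltngtP => _; rewrite ?opprK ?oppr0 //.
exists S; split=> //; rewrite biv_skewE // xE.
apply: eq_bigr => i _; apply: eq_bigr => j ij; congr (_ *: _).
by rewrite mxE ij; field.
Qed.

Lemma clgen_mul_lt (i j : 'I_N) : (i < j)%N -> e i * e j = clbase R ([set i; j]%SET).
Proof.
move=> ij; rewrite -[e i * e j]/(clmul (e i) (e j)) clmul_base.
have -> : clsign R [set i]%SET [set j]%SET = 1.
  rewrite /clsign big_set1 big1 // => k; rewrite inE => /andP[/eqP ->].
  by rewrite leqNgt ij.
rewrite scale1r; congr clbase; apply/setP => k; rewrite in_symdiff !inE.
by case: eqP => [->|]; case: eqP => [ek|] //; rewrite ek ltnn in ij.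
Qed.

Lemma set2_lt_inj (i j k l : 'I_N) : (i < j)%N -> (k < l)%N ->
  [set i; j]%SET = [set k; l]%SET -> i = k /\ j = l.
Proof.
move=> ij kl /setP h.
have : i \in [set k; l]%SET by rewrite -h !inE eqxx.
have : j \in [set k; l]%SET by rewrite -h !inE eqxx orbT.
have nij : (j == i) = false by apply/eqP => ji; rewrite ji ltnn in ij.
rewrite !inE => /orP[]/eqP jE /orP[]/eqP iE; rewrite jE iE ?eqxx in nij ij *; rewrite ?ltnn // in ij.
by move: kl; rewrite ltnNge ltnW.
Qed.

Lemma frob2_clcoef x : frob2 (x : 'rV[R]__) = \sum_A clcoef x A ^+ 2.
Proof.
rewrite /frob2 big_ord1 (reindex (@enum_rank {set 'I_N})) //=.
exact: onW_bij (@enum_rank_bij _).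
Qed.

(** The coefficients of [biv S] are the 2 S_ij for i < j; their squares add up to half of 4
    |S|^2. *)
Lemma frob2_biv S : S^T = - S -> frob2 (biv S : 'rV[R]__) = 2 * frob2 S.
Proof.
move=> Ss; pose c (p : 'I_N * 'I_N) := 2 * S p.1 p.2.
pose lt (p : 'I_N * 'I_N) := (p.1 < p.2)%N.
have bE : biv S = \sum_(p | lt p) c p *: clbase R ([set p.1; p.2]%SET).
  rewrite biv_skewE // pair_big_dep /=; apply: eq_bigr => p ltp.
  by rewrite clgen_mul_lt.
have coefE A : clcoef (biv S) A = \sum_(p | lt p) c p * (A == [set p.1; p.2]%SET)%:R.
  rewrite bE /clcoef summxE; apply: eq_bigr => p _.
  by rewrite mxE -/(clcoef (clbase R _) A) clcoef_base.
have coefp p : lt p -> clcoef (biv S) ([set p.1; p.2]%SET) = c p.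
  move=> ltp; rewrite coefE (bigD1 p) //= eqxx mulr1 big1 ?addr0 // => q /andP[ltq nqp].
  case: eqP => [pq|]; last by rewrite mulr0.
  have [e1 e2] := set2_lt_inj ltp ltq pq.
  by case/eqP: nqp; case: (p) (q) e1 e2 => ? ? [? ?] /= -> ->.
transitivity (\sum_(p | lt p) c p ^+ 2).
  rewrite frob2_clcoef.
  transitivity (\sum_A \sum_(p | lt p) clcoef (biv S) A * (c p * (A == [set p.1; p.2]%SET)%:R)).
    by apply: eq_bigr => A _; rewrite -mulr_sumr -coefE expr2.
  rewrite exchange_big /=; apply: eq_bigr => p ltp.
  rewrite (bigD1 ([set p.1; p.2]%SET)) //= big1 ?addr0; last by move=> A /negPf ->; rewrite !mulr0.
  by rewrite eqxx mulr1 coefp // expr2.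
have ST k l : S l k = - S k l by move/matrixP/(_ k l): Ss; rewrite !mxE.
rewrite /frob2 sum_pairs mulr_sumr -(pair_big_dep xpredT (fun i j : 'I_N => (i < j)%N)
  (fun i j => c (i, j) ^+ 2)) /=.
apply: eq_bigr => i _; have -> : S i i = 0 by have := ST i i; lra.
rewrite expr0n add0r mulr_sumr; apply: eq_bigr => j _.
by rewrite (ST i j) /c /=; ring.
Qed.

(** A commutator is a derivation, so that its effect on e_k e_l follows from [biv_comm_gen]. This
    lifts commutation of skew matrices back to bivectors. *)
Lemma biv_comm_biv S S' : S^T = - S ->
  biv S * biv S' - biv S' * biv S = biv (4 *: (S' *m S - S *m S')).
Proof.
move=> Ss; pose x := biv S.
have comm3 k l : x * (e k * e l) - e k * e l * x =
    vec (row k (4 *: S)) * e l + e k * vec (row l (4 *: S)).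
  rewrite -!biv_comm_gen // -/x mulrBl mulrBr !mulrA.
  by rewrite addrA subrK.
pose D (M M' : 'M[R]_N) : cl := \sum_k \sum_l M k l *: (vec (row k M') * e l).
transitivity (\sum_k \sum_l S' k l *: (x * (e k * e l) - e k * e l * x)).
  rewrite /x; move: (biv S) => y; rewrite /biv mulr_sumr mulr_suml -sumrB.
  apply: eq_bigr => k _; rewrite mulr_sumr mulr_suml -sumrB; apply: eq_bigr => l _.
  by rewrite -scalerAl -scalerAr scalerBr.
transitivity (\sum_k \sum_l biv (S' k l *: ((row k (4 *: S))^T *m delta_mx 0 l +
    (delta_mx 0 k)^T *m row l (4 *: S)))).
  apply: eq_bigr => k _; apply: eq_bigr => l _; rewrite comm3 [RHS]linearZ /= [biv (_ + _)]linearD /=.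
  by rewrite !biv_outer !clvec_delta.
under eq_bigr do rewrite -linear_sum; rewrite -linear_sum; congr biv.
have S'E : S' = \sum_k \sum_l S' k l *: ((delta_mx (0 : 'I_1) k)^T *m delta_mx 0 l : 'M_N).
  apply: etrans (matrix_sum_delta S') _; apply: eq_bigr => k _; apply: eq_bigr => l _.
  by rewrite trmx_delta mul_delta_mx.
rewrite scalerBr [4 *: (S' *m S)]scalemxAr [4 *: (S *m S')]scalemxAl.
have -> : - (4 *: S *m S') = (4 *: S)^T *m S' by rewrite linearZ /= Ss scalerN mulNmx.
move: (4 *: S) => M; rewrite [in RHS]S'E mulmx_suml mulmx_sumr -big_split; apply: eq_bigr => k _ /=.
rewrite mulmx_suml mulmx_sumr -big_split; apply: eq_bigr => l _ /=.
rewrite -scalemxAl -scalemxAr -scalerDr; congr (_ *: _); rewrite addrC; congr (_ + _).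
  by rewrite -mulmxA rowE.
by rewrite mulmxA rowE trmx_mul.
Qed.

End CliffordBivectors.

(** * Complex matrices as real matrices of twice the size *)

Local Open Scope sesquilinear_scope.
Local Open Scope complex_scope.

Section Realification.
Variable R : realType.
Local Notation C := (R[i]).
Local Notation Re := (@complex.Re R).
Local Notation Im := (@complex.Im R).

Lemma Re_sum (I : Type) (r : seq I) (P : pred I) (f : I -> C) :
  Re (\sum_(i <- r | P i) f i) = \sum_(i <- r | P i) Re (f i).
Proof. by apply: (big_morph Re) => // -[x1 x2] [y1 y2]. Qed.

Lemma Im_sum (I : Type) (r : seq I) (P : pred I) (f : I -> C) :
  Im (\sum_(i <- r | P i) f i) = \sum_(i <- r | P i) Im (f i).
Proof. by apply: (big_morph Im) => // -[x1 x2] [y1 y2]. Qed.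

Definition rmx m n (X : 'M[C]_(m, n)) : 'M[R]_(m, n) := map_mx Re X.
Definition imx m n (X : 'M[C]_(m, n)) : 'M[R]_(m, n) := map_mx Im X.

Lemma rmxM m n p (X : 'M[C]_(m, n)) (Y : 'M[C]_(n, p)) :
  rmx (X *m Y) = rmx X *m rmx Y - imx X *m imx Y.
Proof.
apply/matrixP => i j; rewrite !mxE Re_sum -sumrB; apply: eq_bigr => k _.
by rewrite !mxE; case: (X i k) => x1 x2; case: (Y k j) => y1 y2.
Qed.

Lemma imxM m n p (X : 'M[C]_(m, n)) (Y : 'M[C]_(n, p)) :
  imx (X *m Y) = rmx X *m imx Y + imx X *m rmx Y.
Proof.
apply/matrixP => i j; rewrite !mxE Im_sum -big_split; apply: eq_bigr => k _.
by rewrite !mxE; case: (X i k) => x1 x2; case: (Y k j) => y1 y2.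
Qed.

Definition realify m n (X : 'M[C]_(m, n)) : 'M[R]_(m + m, n + n) :=
  block_mx (rmx X) (- imx X) (imx X) (rmx X).

Lemma realifyM m n p (X : 'M[C]_(m, n)) (Y : 'M[C]_(n, p)) :
  realify (X *m Y) = realify X *m realify Y.
Proof.
rewrite /realify mulmx_block rmxM imxM !mulNmx !mulmxN opprD.
by congr block_mx; rewrite addrC.
Qed.

Lemma realify_inj m n : injective (@realify m n).
Proof.
move=> X Y /eq_block_mx[/matrixP rXY _ /matrixP iXY _].
apply/matrixP => i j; have := rXY i j; have := iXY i j; rewrite !mxE.
by case: (X i j) => x1 x2; case: (Y i j) => y1 y2 /= -> ->.
Qed.

Lemma rmx_scalar n (x : C) : rmx (x%:M : 'M_n) = (Re x)%:M.
Proof. by apply/matrixP => i j; rewrite !mxE; case: (i == j). Qed.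

Lemma imx_scalar n (x : C) : imx (x%:M : 'M_n) = (Im x)%:M.
Proof. by apply/matrixP => i j; rewrite !mxE; case: (i == j). Qed.

Lemma realify1 n : realify (1%:M : 'M_n) = 1%:M.
Proof. by rewrite /realify rmx_scalar imx_scalar /= raddf0 oppr0 -scalar_mx_block. Qed.

Definition unrealify m n (v : 'M[R]_(m, n + n)) : 'M[C]_(m, n) :=
  \matrix_(i, j) (lsubmx v i j +i* rsubmx v i j).

Lemma mxReImK n : cancel (@mxReIm R n) (@unrealify n n).
Proof.
move=> X; apply/matrixP => i j; rewrite mxE /mxReIm row_mxKl row_mxKr !mxE.
by case: (X i j).
Qed.

Lemma unrealifyK n : cancel (@unrealify n n) (@mxReIm R n).
Proof.
move=> v; rewrite -[RHS]hsubmxK /mxReIm; congr row_mx;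
by apply/matrixP => i j; rewrite !mxE.
Qed.

Lemma mxReImB n : {morph (@mxReIm R n) : X Y / X - Y}.
Proof.
move=> X Y; rewrite /mxReIm opp_row_mx add_row_mx; congr row_mx;
by apply/matrixP => i j; rewrite !mxE; case: (X i j); case: (Y i j).
Qed.

Lemma mxReIm_lin n (t : R) (X Y : 'M[C]_n) :
  unrealify (t *: mxReIm X + mxReIm Y) = t%:C *: X + Y.
Proof.
apply: (can_inj (@mxReImK n)); rewrite unrealifyK /mxReIm scale_row_mx add_row_mx.
congr row_mx; apply/matrixP => i j; rewrite !mxE; case: (X i j); case: (Y i j) => * /=.
  by rewrite mul0r subr0.
by rewrite mul0r addr0.
Qed.

(** Realification read in the coordinates [mxReIm]; with its left inverse [left_blocks] it provides
    [J] and [J'] for the lower bound. *)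
Definition realify_mxReIm n (v : 'M[R]_(n, n + n)) : 'M[R]_(n + n) :=
  block_mx (lsubmx v) (- rsubmx v) (rsubmx v) (lsubmx v).

Lemma realify_mxReIm_linear n : linear (@realify_mxReIm n).
Proof.
move=> a u v; rewrite /realify_mxReIm scale_block_mx add_block_mx.
by congr block_mx; apply/matrixP => i j; rewrite !mxE //; ring.
Qed.
HB.instance Definition _ n := GRing.isLinear.Build R 'M[R]_(n, n + n) 'M[R]_(n + n)
  _ (@realify_mxReIm n) (@realify_mxReIm_linear n).

Definition left_blocks n (M : 'M[R]_(n + n)) : 'M[R]_(n, n + n) :=
  row_mx (ulsubmx M) (dlsubmx M).

Lemma left_blocks_linear n : linear (@left_blocks n).
Proof.
move=> a u v; rewrite /left_blocks scale_row_mx add_row_mx.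
by congr row_mx; apply/matrixP => i j; rewrite !mxE.
Qed.
HB.instance Definition _ n := GRing.isLinear.Build R 'M[R]_(n + n) 'M[R]_(n, n + n)
  _ (@left_blocks n) (@left_blocks_linear n).

Lemma realify_mxReImK n : cancel (@realify_mxReIm n) (@left_blocks n).
Proof.
by move=> v; rewrite /left_blocks /realify_mxReIm block_mxKul block_mxKdl hsubmxK.
Qed.

Lemma realifyE n (X : 'M[C]_n) : realify X = realify_mxReIm (mxReIm X).
Proof. by rewrite /realify_mxReIm /mxReIm row_mxKl row_mxKr. Qed.

Lemma normc_lt (z : C) (e : R) : `|Re z| < e / 2 -> `|Im z| < e / 2 -> `|z| < e%:C.
Proof.
move=> hr hi; rewrite normc_def ltcR.
apply: (@le_lt_trans _ _ (`|Re z| + `|Im z|)); last by rewrite (splitr e) ltrD.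
rewrite -(ler_pXn2r (ltn0Sn 1)) ?nnegrE ?sqrtr_ge0 ?addr_ge0//.
rewrite sqr_sqrtr ?addr_ge0 ?sqr_ge0// -(real_normK (num_real (Re z))).
rewrite -(real_normK (num_real (Im z))).
have := normr_ge0 (Re z); have := normr_ge0 (Im z); nra.
Qed.

(** [expmx] is a limit in a normed space over the complex numbers and [mexp] one over the reals;
    this lemma passes from the second topology to the first. *)
Lemma unrealify_cvg m n (u : nat -> 'M[R]_(m, n + n)) (v : 'M[R]_(m, n + n)) :
  u @ \oo --> v -> (fun k => unrealify (u k) : 'M[(C : numFieldType)]_(m, n)) @ \oo -->
    (unrealify v : 'M[(C : numFieldType)]_(m, n)).
Proof.
move=> uv; apply/cvg_ballP => -[e e'] /[dup] he.
(* A radius that is positive in the order of C is real. *)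
rewrite ltcE /= => /andP[/eqP e'0 e0]; rewrite e'0 in he *.
move/cvgrPdist_lt: uv => /(_ (e / 2)); rewrite divr_gt0// => /(_ isT).
apply: filterS => k hk; split=> // i j; rewrite -ball_normE /= !mxE.
have hk' (l : 'I_(n + n)) : `|v i l - u k i l| < e / 2.
  apply: le_lt_trans hk; have := coord_le_norm (v - u k) i l.
  by rewrite !mxE.
by apply: (@normc_lt _ e); exact: hk'.
Qed.

Lemma realify_expmx n (X : 'M[C]_n) : realify (expmx X) = mexp (realify X).
Proof.
pose S (N : nat) : 'M[C]_n := \sum_(k < N) (k`!%:R)^-1 *: (X ^+ k : 'M[C]_n).
have JS N : realify_mxReIm (mxReIm (S N)) = mexp_sum (realify X) N.
  elim: N => [|N IH].
    rewrite /S /mexp_sum !big_ord0 -[RHS](linear0 (@realify_mxReIm n)).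
    by congr realify_mxReIm; rewrite -(subrr 0) mxReImB subrr.
  rewrite /S /mexp_sum !big_ord_recr /= -/(S N) -/(mexp_sum _ N) -IH.
  have -> : S N + N`!%:R^-1 *: (X ^+ N : 'M[C]_n) =
      (N`!%:R^-1)%:C *: (X ^+ N : 'M[C]_n) + S N.
    by rewrite addrC; congr (_ *: _ + _); rewrite fmorphV rmorph_nat.
  rewrite -mxReIm_lin unrealifyK linearP /= addrC -!realifyE; congr (_ + _ *: _).
  elim: N {IH} => [|N IH]; first by rewrite !expr0 realify1.
  by rewrite !exprS -!mulmxE realifyM IH.
have cvgJS : (fun N => mxReIm (S N)) @ \oo --> left_blocks (mexp (realify X)).
  have -> : (fun N => mxReIm (S N)) = (fun N => left_blocks (mexp_sum (realify X) N)).
    by apply/funext => N; rewrite -JS realify_mxReImK.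
  exact: (@cvg_mxlin _ _ _ _ _ (@left_blocks n) _ _ (@mexp_cvg _ _ _)).
have cvgS : (S : nat -> 'M[(C : numFieldType)]_n) @ \oo -->
    (unrealify (left_blocks (mexp (realify X))) : 'M[(C : numFieldType)]_n).
  have -> : S = fun N => unrealify (mxReIm (S N)).
    by apply/funext => N; rewrite mxReImK.
  exact: unrealify_cvg.
have -> : expmx X = unrealify (left_blocks (mexp (realify X))).
  by apply: (cvg_lim _ cvgS); exact: norm_hausdorff.
rewrite realifyE unrealifyK.
(* The limit is again the realification of a complex matrix: [JJ] fixes every partial sum, hence
   their limit. *)
pose JJ := @realify_mxReIm n \o @left_blocks n.
have : (fun N => JJ (mexp_sum (realify X) N)) @ \oo --> JJ (mexp (realify X)).
  exact: (@cvg_mxlin _ _ _ _ _ JJ _ _ (@mexp_cvg _ _ _)).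
have -> : (fun N => JJ (mexp_sum (realify X) N)) = mexp_sum (realify X).
  by apply/funext => N; rewrite /JJ /= -JS realify_mxReImK.
by move=> h; apply: mxcvg_unique h _; exact: mexp_cvg.
Qed.

End Realification.

(** * Exponentials of skew-Hermitian matrices through the spectral theorem *)

Section UnitaryExponential.
Variable R : realType.
Local Notation C := (R[i]).
Local Notation Im := (@complex.Im R).

Lemma mexp_opp_eq n (M : 'M[R]_n) :
  M *m M *m M = - (pi ^+ 2) *: M -> mexp M = mexp (- M).
Proof.
move=> M3; have pi0 : (pi : R) != 0 by rewrite gt_eqF// pi_gt0.
have NM3 : - M *m - M *m - M = - (pi ^+ 2) *: - M.
  by rewrite !(mulNmx, mulmxN) !opprK M3 scalerN.
rewrite (mexp_rodrigues pi0 M3) (mexp_rodrigues pi0 NM3) sinpi mul0r !scale0r.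
by rewrite !(mulNmx, mulmxN) opprK.
Qed.

Lemma conjC_conjc (z : C) : Num.conj z = conjc z.
Proof. by []. Qed.

Lemma realifyZ m n (t : R) (X : 'M[C]_(m, n)) : realify (t%:C *: X) = t *: realify X.
Proof.
rewrite /realify scale_block_mx; congr block_mx; apply/matrixP => i j;
by rewrite !mxE; case: (X i j) => x1 x2 /=; ring.
Qed.

Lemma realifyN m n (X : 'M[C]_(m, n)) : realify (- X) = - realify X.
Proof.
have := realifyZ (-1) X; rewrite scaleN1r => <-; congr realify.
by rewrite rmorphN1 scaleN1r.
Qed.

Lemma expmx_opp_eq n (X : 'M[C]_n) :
  X *m X *m X = (- (pi ^+ 2))%:C *: X -> expmx X = expmx (- X).
Proof.
move=> X3; have hX := realify_expmx X; have hNX := realify_expmx (- X).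
move: (expmx X) (expmx (- X)) hX hNX => E E' hX hNX.
apply: (@realify_inj R n n); rewrite hX hNX realifyN.
by apply: mexp_opp_eq; rewrite -!realifyM X3 realifyZ.
Qed.

Definition cis (t : R) : C := cos t +i* sin t.

(** Euler's formula, obtained from Rodrigues' formula for a 2 by 2 real matrix; t = 0 is apart
    because that formula divides by t. *)
Lemma mexp_realify_i (t : R) :
  mexp (realify ((0 +i* t)%:M : 'M_1)) = realify ((cis t)%:M : 'M_1).
Proof.
have [->|t0] := eqVneq t 0.
  rewrite /cis sin0 cos0; have -> : realify ((0 +i* 0)%:M : 'M[C]_1) = 0.
    by rewrite /realify rmx_scalar imx_scalar /= raddf0 oppr0 block_mx0.
  by rewrite mexp0 realify1.
set I := realify _.
have I2 : I *m I = - (t ^+ 2) *: 1%:M.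
  rewrite -realifyM -realify1 -realifyZ -scalar_mxM scale_scalar_mx; congr (realify _%:M).
  by apply/eqP; rewrite eq_complex /=; apply/andP; split; apply/eqP; ring.
rewrite (mexp_rodrigues t0); last by rewrite I2 -scalemxAl mul1mx.
rewrite I2 -realify1 -!realifyZ.
have realifyD m n (X Y : 'M[C]_(m, n)) : realify (X + Y) = realify X + realify Y.
  rewrite /realify add_block_mx; congr block_mx; apply/matrixP => i j;
  by rewrite !mxE; case: (X i j); case: (Y i j) => * /=; rewrite ?opprD.
rewrite -!realifyD; congr realify; rewrite !scale_scalar_mx -!raddfD; congr (_%:M).
by apply/eqP; rewrite eq_complex /=; apply/andP; split; apply/eqP; field.
Qed.

(** An eigenrow intertwines [X] with a 1 by 1 matrix. *)
Lemma expmx_eigenrow n (X : 'M[C]_n) (w : 'M[C]_(1, n)) (t : R) :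
  w *m X = (0 +i* t) *: w -> w *m expmx X = cis t *: w.
Proof.
rewrite -mul_scalar_mx => /esym wX; rewrite -[RHS]mul_scalar_mx.
move: (expmx X) (realify_expmx X) => E hE.
apply: (@realify_inj R 1 n); rewrite !realifyM hE -mexp_realify_i.
by symmetry; apply: mexp_intertwine; rewrite -!realifyM wX.
Qed.

Lemma adjmxM m n p (A : 'M[C]_(m, n)) (B : 'M[C]_(n, p)) :
  (A *m B)^t* = B^t* *m A^t*.
Proof. by rewrite trmx_mul map_mxM. Qed.

Lemma skew_hermitian_spectral n (X : 'M[C]_n) : X^t* = - X ->
  exists (P : 'M[C]_n) (t : 'I_n -> R),
    P \is unitarymx /\ X = P^t* *m diag_mx (\row_j (0 +i* t j)) *m P.
Proof.
move=> Xs; have nX : X \is normalmx.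
  by apply/normalmxP; rewrite Xs mulmxN mulNmx.
have := orthomx_spectralP nX; set P := spectralmx X; set d := spectral_diag X => XE.
have uP : P \is unitarymx by exact: spectral_unitarymx.
have PPt : P *m P^t* = 1%:M by exact/unitarymxP.
exists P, (fun j => Im (d 0 j)); split=> //.
have dE : diag_mx d = P *m X *m P^t*.
  by rewrite XE (invmx_unitary uP) !mulmxA PPt mul1mx -mulmxA PPt mulmx1.
have ds : (diag_mx d)^t* = - diag_mx d.
  by rewrite dE !adjmxM trmxCK Xs mulNmx mulmxN mulmxA.
have <- : d = \row_j (0 +i* Im (d 0 j)).
  apply/rowP => j; rewrite mxE; move/matrixP/(_ j j): ds.
  rewrite !mxE eqxx !mulr1n conjC_conjc; case: (d 0 j) => x y /=.
  by move=> /eqP; rewrite eq_complex /= => /andP[/eqP x0 _]; congr (_ +i* _); lra.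
by rewrite -(invmx_unitary uP).
Qed.

Lemma row_diag_mulmx n p (d : 'rV[C]_n) (A : 'M[C]_(n, p)) j :
  row j (diag_mx d *m A) = d 0 j *: row j A.
Proof. by rewrite row_mul row_diag_mx -scalemxAl -rowE. Qed.

Lemma expmx_spectral n (P : 'M[C]_n) (t : 'I_n -> R) : P \is unitarymx ->
  expmx (P^t* *m diag_mx (\row_j (0 +i* t j)) *m P) =
  P^t* *m diag_mx (\row_j cis (t j)) *m P.
Proof.
move=> uP; have PPt : P *m P^t* = 1%:M by exact/unitarymxP.
have PtP : P^t* *m P = 1%:M by exact: mulmx1C.
set X := _ *m _ *m P.
have PX : P *m X = diag_mx (\row_j (0 +i* t j)) *m P.
  by rewrite /X !mulmxA PPt mul1mx.
rewrite -[LHS]mul1mx -PtP -!mulmxA; congr (_ *m _).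
apply/row_matrixP => j; rewrite row_mul row_diag_mulmx mxE.
by apply: expmx_eigenrow; rewrite -row_mul PX row_diag_mulmx mxE.
Qed.

Lemma cis_eq_dist (s t : R) : cis s = cis t -> cos (s - t) = 1.
Proof. by case=> cE sE; rewrite cosB cE sE -!expr2 cos2Dsin2. Qed.

(** By the half-angle formula sin (t / 2) = 0, whereas for t > 0 the bound puts t / 2 strictly
    between 0 and pi. *)
Lemma cos_eq1_small (t : R) : cos t = 1 -> t ^+ 2 < 4 * pi ^+ 2 -> t = 0.
Proof.
move=> ct t2; wlog t0 : t ct t2 / 0 <= t.
  move=> h; have [/h -> //|t0] := leP 0 t.
  by apply/eqP; rewrite -oppr_eq0; apply/eqP/h; rewrite ?cosN ?sqrrN// oppr_ge0 ltW.
apply/eqP; rewrite eq_le t0 andbT leNgt; apply/negP => t_gt0.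
have t2pi : t / 2 < pi.
  rewrite ltr_pdivrMr// -(ltr_pXn2r (ltn0Sn 1)) ?nnegrE//; last first.
    by rewrite mulr_ge0// pi_ge0.
  by rewrite exprMn; lra.
have : 0 < sin (t / 2) by apply: sin_gt0_pi; rewrite divr_gt0 // t2pi.
have := cosD (t / 2) (t / 2); rewrite -splitr ct -!expr2.
have := cos2Dsin2 (t / 2); set x := cos _; set y := sin _ => e1 e2 y0.
have : y ^+ 2 = 0 by lra.
by move=> /eqP; rewrite sqrf_eq0 => /eqP y00; rewrite y00 ltxx in y0.
Qed.

End UnitaryExponential.

(** * The groups SU (m + 1) and Sp (m) *)

Lemma injectivity_radius_eq (R : realType) (L : lie_group R) (r : R) :
  (exists p, @lie_points R L p) ->
  (forall p, @lie_points R L p -> injectivity_radius_at p = r%:E) ->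
  injectivity_radius L = r%:E.
Proof.
move=> [p0 p0L] hL; apply/eqP; rewrite eq_le; apply/andP; split.
  by apply: ereal_inf_lbound; exists p0 => //; exact: hL.
by apply: le_ereal_inf_tmp => _ [p pL <-]; rewrite hL.
Qed.

Lemma conj_comm_iff (K : comPzRingType) n (P V D Y : 'M[K]_n) :
  P *m V = 1%:M -> V *m P = 1%:M ->
  (V *m D *m P) *m Y = Y *m (V *m D *m P) <->
  D *m (P *m Y *m V) = (P *m Y *m V) *m D.
Proof.
move=> PV VP; split=> [/(congr1 (fun M => P *m M *m V))|/(congr1 (fun M => V *m M *m P))].
  by rewrite !mulmxA PV mul1mx -[RHS]mulmxA PV mulmx1.
by rewrite !mulmxA VP mul1mx -[LHS]mulmxA VP mulmx1.
Qed.

Section UnitaryGroups.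
Variable R : realType.
Local Notation C := (R[i]).
Local Notation Re := (@complex.Re R).
Local Notation Im := (@complex.Im R).

Lemma trace_form_skew n (X : 'M[C]_n) : X^t* = - X ->
  trace_form X X = frob2 (mxReIm X).
Proof.
move=> Xs; rewrite /trace_form /frob2 /mxtrace raddfN /= Re_sum -sumrN.
apply: eq_bigr => i _; rewrite mxE Re_sum -sumrN big_split_ord /= -big_split /=.
apply: eq_bigr => k _; rewrite /mxReIm row_mxEl row_mxEr !mxE.
move/matrixP/(_ k i): Xs; rewrite !mxE conjC_conjc => /(congr1 -%R).
by rewrite opprK => <-; case: (X i k) => x y /=; ring.
Qed.

Lemma trace_form_spectral n (P : 'M[C]_n) (t : 'I_n -> R) : P \is unitarymx ->
  let X := P^t* *m diag_mx (\row_j (0 +i* t j)) *m P in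
  trace_form X X = \sum_j t j ^+ 2 /\ \tr X = \sum_j (0 +i* t j).
Proof.
move=> uP; have PPt : P *m P^t* = 1%:M by exact/unitarymxP.
set d := \row_j _ => X; split; last first.
  rewrite /X -mulmxA mxtrace_mulC -mulmxA PPt mulmx1 mxtrace_diag.
  by apply: eq_bigr => j _; rewrite mxE.
rewrite /trace_form; have -> : X *m X = P^t* *m (diag_mx d *m diag_mx d) *m P.
  by rewrite /X !mulmxA -(mulmxA _ P) PPt mulmx1.
rewrite -mulmxA mxtrace_mulC -mulmxA PPt mulmx1 mulmx_diag mxtrace_diag.
rewrite raddfN /= Re_sum -sumrN; apply: eq_bigr => j _.
by rewrite !mxE /=; ring.
Qed.

(** In an eigenbasis the entry Z_jk of Y vanishes unless e^(i t_j) = e^(i t_k). Then t_j - t_k is a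
    multiple of 2 pi whose square is at most 2 (t_j^2 + t_k^2) < 4 pi^2, so that t_j = t_k. *)
Lemma skew_hermitian_comm n (X Y : 'M[C]_n) : X^t* = - X ->
  trace_form X X < 2 * pi ^+ 2 -> expmx X *m Y = Y *m expmx X -> X *m Y = Y *m X.
Proof.
move=> /skew_hermitian_spectral[P [t [uP XE]]].
have PPt : P *m P^t* = 1%:M by exact/unitarymxP.
have PtP : P^t* *m P = 1%:M by exact: mulmx1C.
have [tE _] := trace_form_spectral t uP.
have := expmx_spectral t uP; rewrite -XE in tE *.
set D := diag_mx _ in XE; set E := diag_mx _ => expE; rewrite tE => t2.
rewrite expE => /(conj_comm_iff _ _ PPt PtP) EZ.
rewrite XE; apply/(conj_comm_iff _ _ PPt PtP).
move: (P *m Y *m P^t*) EZ => Z EZ; apply/matrixP => j k.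
move/matrixP/(_ j k): EZ; rewrite /E /D !mul_diag_mx !mul_mx_diag !mxE.
have [-> _|njk eZ] := eqVneq j k; first by rewrite mulrC.
have [->|Z0] := eqVneq (Z j k) 0; first by rewrite mulr0 mul0r.
have : cis (t j) = cis (t k) by apply: (mulIf Z0); rewrite eZ mulrC.
move=> /cis_eq_dist /cos_eq1_small tjk; rewrite [LHS]mulrC.
congr (_ * (_ +i* _)); apply/eqP; rewrite -subr_eq0; apply/eqP/tjk.
move: t2; rewrite (bigD1 j) //= (bigD1 k) 1?eq_sym //=.
set s := \sum_(_ | _) _ => t2.
have s0 : 0 <= s by apply: sumr_ge0 => i _; exact: sqr_ge0.
have := sqr_ge0 (t j + t k); nra.
Qed.

(** All t_j are multiples of 2 pi. Trace zero forbids exactly one of them to be nonzero, and two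
    nonzero ones already cost 8 pi^2. *)
Lemma skew_hermitian_exp1 n (X : 'M[C]_n) : X^t* = - X -> \tr X = 0 ->
  trace_form X X < 8 * pi ^+ 2 -> expmx X = 1%:M -> X = 0.
Proof.
move=> /skew_hermitian_spectral[P [t [uP XE]]].
have PPt : P *m P^t* = 1%:M by exact/unitarymxP.
have PtP : P^t* *m P = 1%:M by exact: mulmx1C.
have [tE trE] := trace_form_spectral t uP.
have := expmx_spectral t uP; rewrite -XE in tE trE *; rewrite tE trE.
set E := diag_mx _ => expE tr0 t2 exp1.
have E1 : E = 1%:M.
  have := congr1 (fun M => P *m M *m P^t*) (etrans (esym exp1) expE).
  by rewrite mulmx1 PPt !mulmxA PPt mul1mx -mulmxA PPt mulmx1 => <-.
have ct j : cos (t j) = 1.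
  move/matrixP/(_ j j): E1; rewrite !mxE eqxx !mulr1n.
  by move=> /(congr1 Re).
have tr0' : \sum_j t j = 0 by move/(congr1 Im): tr0; rewrite Im_sum.
suff t0 j : t j = 0.
  rewrite XE (_ : \row_j _ = 0) ?raddf0 ?mulmx0 ?mul0mx//.
  by apply/rowP => j; rewrite !mxE t0.
apply/eqP/negPn/negP => tj0.
have [k /andP[nkj tk0]] : exists k, (k != j) && (t k != 0).
  case: (pickP (fun k => (k != j) && (t k != 0))) => [k hk|h]; first by exists k.
  move: tr0' tj0; rewrite (bigD1 j) //= big1 ?addr0; first by move=> ->; rewrite eqxx.
  by move=> k nkj; have := h k; rewrite /= nkj => /negbFE/eqP.
have big i : t i != 0 -> 4 * pi ^+ 2 <= t i ^+ 2.
  by move=> ti; rewrite leNgt; apply/negP => /(cos_eq1_small (ct i)) /eqP; apply/negP.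
move: t2; rewrite (bigD1 j) //= (bigD1 k) //=.
set s := \sum_(_ | _) _ => t2.
have s0 : 0 <= s by apply: sumr_ge0 => i _; exact: sqr_ge0.
by have := big _ tj0; have := big _ tk0; lra.
Qed.

Lemma sqr_sqrt2pi : (Num.sqrt 2 * pi : R) ^+ 2 = 2 * pi ^+ 2.
Proof. by rewrite exprMn sqr_sqrtr. Qed.

(** SU and Sp are treated at once: beyond a traceless skew-Hermitian algebra, only the witness [X]
    of the upper bound depends on the group. *)
Lemma unitary_injectivity_radius n (pts alg : set 'M[C]_n) (X : 'M[C]_n) :
  (forall Y, alg Y -> Y^t* = - Y /\ \tr Y = 0) -> alg 0 ->
  (forall (t : R) Y Z, alg Y -> alg Z -> alg (t%:C *: Y + Z)) ->
  pts 1%:M -> (forall p, pts p -> p \is unitarymx) ->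
  alg X -> X *m X *m X = (- (pi ^+ 2))%:C *: X -> trace_form X X = 2 * pi ^+ 2 ->
  injectivity_radius (@LieGroup R 'M[C]_n 'M[R]_(n, n + n) (@mxReIm R n)
    (@expmx R n) pts alg (@trace_form R n)) = (Num.sqrt 2 * pi)%:E.
Proof.
move=> alg_su alg0 alg_lin pts1 ptsU aX X3 X2.
have r0 : 0 < Num.sqrt 2 * pi :> R by rewrite mulr_gt0 ?sqrtr_gt0 ?pi_gt0.
set L := @LieGroup _ _ _ _ _ _ _ _.
apply: injectivity_radius_eq; first by exists 1%:M.
move=> p pL; apply/eqP; rewrite eq_le; apply/andP; split.
  have aNX : alg (- X).
    by have := alg_lin (-1) X 0 aX alg0; rewrite rmorphN1 scaleN1r addr0.
  have hX : @lie_norm R L X <= Num.sqrt 2 * pi.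
    by rewrite /lie_norm /= X2 -sqr_sqrt2pi sqrtr_sqr ger0_norm// ltW.
  have hNX : @lie_norm R L (- X) <= Num.sqrt 2 * pi.
    by move: hX; rewrite /lie_norm /= /trace_form mulNmx mulmxN opprK.
  have XN : X <> - X.
    move=> XN; have X0 : X = 0.
      apply/eqP; have : X *+ 2 == 0 by rewrite mulr2n {1}XN addNr.
      by rewrite -scaler_nat scaler_eq0 pnatr_eq0.
    move: X2; rewrite X0 /trace_form mulmx0 mxtrace0 oppr0 /= => /esym/eqP.
    by rewrite mulf_eq0 pnatr_eq0 /= sqrf_eq0 gt_eqF// pi_gt0.
  exact: (@injectivity_radius_at_le R L p X (- X) _ aX aNX hX hNX (expmx_opp_eq X3) XN).
apply: (@injectivity_radius_at_ge R 'M[C]_n n (n + n) (n + n) (@mxReIm R n)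
  (@unrealify R n n) (@expmx R n) pts alg (@trace_form R n) (@realify R n n)
  (@realify_mxReIm R n) (@left_blocks R n) _ 1 _ _ _ _ _ _ _ _ _ _ _ _ _ _ p (p^t* )).
- exact: mxReImK.
- exact: unrealifyK.
- exact: mxReImB.
- exact: realifyE.
- exact: realify_mxReImK.
- exact: realify1.
- exact: realifyM.
- exact: realify_expmx.
- exact: alg0.
- by move=> t Y Z aY aZ; rewrite mxReIm_lin; exact: alg_lin.
- exact: ltr01.
- by move=> Y /alg_su[Ys _]; rewrite mul1r trace_form_skew.
- by move=> Y Z /alg_su[Ys _] _; rewrite sqr_sqrt2pi; exact: skew_hermitian_comm.
- move=> Z /alg_su[Zs Z0]; rewrite sqr_sqrt2pi => hZ; apply: skew_hermitian_exp1 => //.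
  by move: hZ; rewrite mulrA -natrM.
- exact: r0.
- by apply: mulmx1C; exact/unitarymxP/ptsU.
Qed.

Definition imag_diag n (t : 'I_n -> R) : 'M[C]_n := diag_mx (\row_j (0 +i* t j)).

Lemma imag_diag_skew n (t : 'I_n -> R) : (imag_diag t)^t* = - imag_diag t.
Proof.
apply/matrixP => i j; rewrite !mxE conjC_conjc.
by case: eqVneq => [->|_]; rewrite ?mulr1n ?mulr0n; apply/eqP;
  rewrite eq_complex /= ?oppr0 !eqxx.
Qed.

Lemma imag_diag_cube n (t : 'I_n -> R) a : (forall j, t j ^+ 3 = a * t j) ->
  imag_diag t *m imag_diag t *m imag_diag t = (- a)%:C *: imag_diag t.
Proof.
move=> t3; rewrite /imag_diag !mulmx_diag -linearZ /=; congr diag_mx.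
apply/rowP => j; rewrite !mxE; apply/eqP; rewrite eq_complex /=.
apply/andP; split; apply/eqP; first ring.
by transitivity (- (t j ^+ 3)); [ring|rewrite t3; ring].
Qed.

Lemma imag_diag_trace n (t : 'I_n -> R) :
  trace_form (imag_diag t) (imag_diag t) = \sum_j t j ^+ 2 /\
  \tr (imag_diag t) = \sum_j (0 +i* t j).
Proof.
have h : (1%:M : 'M[C]_n)^t* = 1%:M by rewrite trmx1 map_mx1.
have := @trace_form_spectral n 1%:M t; rewrite h mul1mx mulmx1; apply.
by apply/unitarymxP; rewrite h mulmx1.
Qed.

Lemma skew_hermitian_lin n (a : R) (Y Z : 'M[C]_n) :
  Y^t* = - Y -> Z^t* = - Z -> (a%:C *: Y + Z)^t* = - (a%:C *: Y + Z).
Proof.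
move=> /matrixP Ys /matrixP Zs; apply/matrixP => i j.
have := Ys i j; have := Zs i j; rewrite !mxE !conjC_conjc.
case: (Y j i) (Y i j) => y1 y2 [y3 y4]; case: (Z j i) (Z i j) => z1 z2 [z3 z4] /=.
move=> [z1E z2E] [y1E y2E]; rewrite z1E y1E.
apply/eqP; rewrite eq_complex /=; apply/andP; split; apply/eqP; first ring.
by rewrite -[z2]opprK -[y2]opprK z2E y2E; ring.
Qed.

Lemma SU_injectivity_radius m : (1 <= m)%N ->
  injectivity_radius (SU R (m + 1)) = (Num.sqrt 2 * pi)%:E.
Proof.
case: m => // m _; rewrite addn1.
pose t (j : 'I_m.+2) : R := if j == ord0 then pi else if j == ord_max then - pi else 0.
have sum_t (f : R -> C) : f 0 = 0 -> \sum_j f (t j) = f pi + f (- pi).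
  move=> f0; rewrite (bigD1 ord0) //= (bigD1 ord_max) //= big1 /t ?eqxx ?addr0//.
  by move=> j /andP[/negPf -> /negPf ->].
have [t2 tr0] := imag_diag_trace t.
apply: (@unitary_injectivity_radius _ _ _ (imag_diag t)).
- by [].
- by rewrite /= trmx0 map_mx0 oppr0 mxtrace0.
- move=> a Y Z [Ys Y0] [Zs Z0]; split; first exact: skew_hermitian_lin.
  by rewrite linearD linearZ /= Y0 Z0 mulr0 addr0.
- by split; [apply/unitarymxP; rewrite trmx1 map_mx1 mulmx1|exact: det1].
- by move=> p [].
- split; first exact: imag_diag_skew.
  rewrite tr0 (sum_t (fun x => 0 +i* x)) //.
  by apply/eqP; rewrite eq_complex /= addr0 subrr !eqxx.
- by apply: imag_diag_cube => j; rewrite /t; do 2?case: ifP => _; ring.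
- rewrite t2 (bigD1 ord0) //= (bigD1 ord_max) //= big1 /t ?eqxx ?addr0 /=.
    by rewrite sqrrN; ring.
  by move=> j /andP[/negPf -> /negPf ->]; rewrite expr0n.
Qed.

(** The symplectic form conjugates X^T to - X, so that tr X = - tr X. *)
Lemma sp_trace0 m (X : 'M[C]_(m + m)) :
  X^T *m symplectic_form R m + symplectic_form R m *m X = 0 -> \tr X = 0.
Proof.
set S := symplectic_form R m => XS.
have SS : S *m S = - 1%:M.
  rewrite /S /symplectic_form mulmx_block !(mul0mx, mulmx0, mul1mx, mulmx1, add0r, addr0).
  by rewrite (@scalar_mx_block _ m m) opp_block_mx oppr0.
have trE : \tr X = - \tr X.
  rewrite -[LHS]mxtrace_tr; have -> : X^T = X^T *m S *m (- S).
    by rewrite -mulmxA mulmxN SS opprK mulmx1.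
  have -> : X^T *m S = - (S *m X) by apply/eqP; rewrite -addr_eq0 XS.
  by rewrite mulNmx mulmxN opprK mxtrace_mulC mulmxA SS mulNmx mul1mx raddfN.
by apply/eqP; rewrite -eqNr -trE.
Qed.

Lemma Sp_injectivity_radius m : (0 < m)%N ->
  injectivity_radius (Sp R m) = (Num.sqrt 2 * pi)%:E.
Proof.
case: m => // m _.
(* In sp a diagonal element has opposite entries in its two halves: pi at the first index of one
   half, - pi at the first index of the other. *)
pose u (j : 'I_m.+1) : R := if j == ord0 then pi else 0.
pose t (j : 'I_(m.+1 + m.+1)) : R :=
  match fintype.split j with inl i => u i | inr i => - u i end.
have tl i : t (lshift _ i) = u i by rewrite /t -[lshift _ i]/(unsplit (inl i)) unsplitK.
have tr i : t (rshift _ i) = - u i by rewrite /t -[rshift _ i]/(unsplit (inr i)) unsplitK.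
have [t2 _] := imag_diag_trace t.
apply: (@unitary_injectivity_radius _ _ _ (imag_diag t)).
- by move=> Y [Ys /sp_trace0].
- by rewrite /= !trmx0 map_mx0 oppr0 mul0mx mulmx0 addr0.
- move=> a Y Z [Ys Y0] [Zs Z0]; split; first exact: skew_hermitian_lin.
  rewrite linearD linearZ /= mulmxDl mulmxDr -scalemxAl -scalemxAr addrACA.
  by rewrite -scalerDr Y0 Z0 scaler0 addr0.
- by split; [apply/unitarymxP; rewrite trmx1 map_mx1 mulmx1|rewrite trmx1 mul1mx mulmx1].
- by move=> p [].
- split; first exact: imag_diag_skew.
  pose d : 'rV[C]_m.+1 := \row_j (0 +i* u j).
  have -> : imag_diag t = block_mx (diag_mx d) 0 0 (- diag_mx d).
    rewrite -(raddfN (@diag_mx C m.+1)) -diag_mx_row; congr diag_mx.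
    apply/rowP => j; rewrite mxE; case: (split_ordP j) => i ->.
      by rewrite row_mxEl mxE tl.
    by rewrite row_mxEr !mxE tr -[0 in LHS]oppr0.
  rewrite tr_block_mx /symplectic_form !mulmx_block tr_diag_mx !trmx0.
  rewrite !(mul0mx, mulmx0, mul1mx, mulmx1, add0r, addr0, mulNmx, mulmxN, opprK).
  rewrite add_block_mx (raddfN (@trmx _ _ _)) /= tr_diag_mx opprK !subrr.
  by rewrite ?oppr0 ?addr0 block_mx0.
- apply: imag_diag_cube => j; case: (split_ordP j) => i ->; rewrite ?tl ?tr /u;
  by case: ifP => _; ring.
- rewrite t2 big_split_ord /=.
  have hu : \sum_i u i ^+ 2 = pi ^+ 2.
    rewrite (bigD1 ord0) //= big1 /u ?eqxx ?addr0 // => j /negPf ->.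
    by rewrite expr0n.
  under eq_bigr do rewrite tl; under [X in _ + X]eq_bigr do rewrite tr sqrrN.
  by rewrite hu; ring.
Qed.

End UnitaryGroups.

(** * Real skew matrices: commutation and kernel of the exponential *)

Section RealSkewMatrices.
Variables (R : realType) (N : nat).
Local Notation C := (R[i]).
Local Notation Re := (@complex.Re R).
Local Notation Im := (@complex.Im R).
Implicit Types (W : 'M[R]_N) (a b c d u v : 'rV[R]_N).

Lemma dotC u v : dot u v = dot v u.
Proof. by apply: eq_bigr => i _; rewrite mulrC. Qed.

Lemma dotE u v : u *m v^T = (dot u v)%:M.
Proof.
apply/matrixP => i j; rewrite !ord1 !mxE eqxx mulr1n.
by apply: eq_bigr => k _; rewrite mxE.
Qed.

Lemma dotZl (t : R) u v : dot (t *: u) v = t * dot u v.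
Proof. by rewrite /dot mulr_sumr; apply: eq_bigr => i _; rewrite mxE mulrA. Qed.

Lemma dot_skew W u v : W^T = - W -> dot (u *m W) v = - dot u (v *m W).
Proof.
move=> Ws; have : (u *m W) *m v^T = - (u *m (v *m W)^T).
  by rewrite trmx_mul Ws mulNmx mulmxN opprK mulmxA.
rewrite !dotE -raddfN => /matrixP/(_ 0 0); rewrite !mxE eqxx !mulr1n.
by [].
Qed.

Definition fdot (A B : 'M[R]_N) : R := \tr (A *m B^T).

Lemma frob2E A : frob2 A = fdot A A.
Proof.
rewrite /frob2 /fdot /mxtrace; apply: eq_bigr => i _; rewrite mxE.
by apply: eq_bigr => j _; rewrite mxE expr2.
Qed.

Lemma fdotBl A B D : fdot (A - B) D = fdot A D - fdot B D.
Proof. by rewrite /fdot mulmxBl raddfB. Qed.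

Lemma fdotBr A B D : fdot D (A - B) = fdot D A - fdot D B.
Proof. by rewrite /fdot linearB /= mulmxBr raddfB. Qed.

Lemma fdotDl A B D : fdot (A + B) D = fdot A D + fdot B D.
Proof. by rewrite /fdot mulmxDl raddfD. Qed.

Lemma fdotDr A B D : fdot D (A + B) = fdot D A + fdot D B.
Proof. by rewrite /fdot linearD /= mulmxDr raddfD. Qed.

Lemma fdotZl (t : R) A D : fdot (t *: A) D = t * fdot A D.
Proof. by rewrite /fdot -scalemxAl linearZ. Qed.

Lemma fdotZr (t : R) A D : fdot D (t *: A) = t * fdot D A.
Proof. by rewrite /fdot linearZ /= -scalemxAr linearZ. Qed.

Lemma fdot_outer W u v : fdot W (u^T *m v) = dot (u *m W) v.
Proof.
rewrite /fdot trmx_mul trmxK mulmxA mxtrace_mulC mulmxA dotE.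
by rewrite mxtrace_scalar mulr1n.
Qed.

Lemma outer_fdot a b u v : fdot (a^T *m b) (u^T *m v) = dot a u * dot b v.
Proof.
by rewrite fdot_outer mulmxA dotE mul_scalar_mx dotZl dotC.
Qed.

Lemma fdotC A B : fdot A B = fdot B A.
Proof. by rewrite /fdot -mxtrace_tr trmx_mul trmxK. Qed.

Definition wedge u v : 'M[R]_N := u^T *m v - v^T *m u.

Lemma fdot_wedge W u v : fdot W (wedge u v) = dot (u *m W) v - dot (v *m W) u.
Proof. by rewrite fdotBr !fdot_outer. Qed.

Lemma wedge_fdot a b u v : fdot (wedge a b) (wedge u v) =
  2 * (dot a u * dot b v - dot a v * dot b u).
Proof. by rewrite fdotBl !fdotBr !outer_fdot; ring. Qed.

Lemma wedge_skew u v : (wedge u v)^T = - wedge u v.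
Proof. by rewrite /wedge linearB /= !trmx_mul !trmxK opprB. Qed.

(* a + i b is an eigenvector of W for the eigenvalue i t. *)
Definition rotates W (t : R) a b := a *m W = - t *: b /\ b *m W = t *: a.

(* Cauchy-Schwarz for W and K, where K, of norm at most 1, is the real 2-form
   attached to the two orthonormal eigenvectors. *)
Lemma skew_eigenpair_bound W t s a b c d :
  rotates W t a b -> rotates W s c d ->
  dot a a + dot b b = 1 -> dot c c + dot d d = 1 ->
  dot a c + dot b d = 0 -> dot b c = dot a d ->
  (t + s) ^+ 2 <= frob2 W.
Proof.
move=> [aW bW] [cW dW] ab1 cd1 acbd bcad.
pose K := wedge b a + wedge d c.
have WK : fdot W K = t + s.
  rewrite fdotDr !fdot_wedge aW bW cW dW !dotZl.
  transitivity (t * (dot a a + dot b b) + s * (dot c c + dot d d)); first ring.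
  by rewrite ab1 cd1; ring.
(* The mixed terms amount to -4 ((dot a c)^2 + (dot a d)^2) by orthogonality, and each wedge
   contributes at most 1/2 because dot a a + dot b b = 1, likewise for c and d. *)
have K1 : fdot K K <= 1.
  rewrite /K fdotDl 2!fdotDr !wedge_fdot.
  rewrite (dotC b a) (dotC d c) (dotC c a) (dotC c b) (dotC d a) (dotC d b) bcad.
  have -> : dot b d = - dot a c by apply/eqP; rewrite -addr_eq0 addrC acbd.
  have := sqr_ge0 (dot a c); have := sqr_ge0 (dot a d).
  have := sqr_ge0 (dot a b); have := sqr_ge0 (dot c d).
  have := sqr_ge0 (dot a a - dot b b); have := sqr_ge0 (dot c c - dot d d).
  have -> : dot b b = 1 - dot a a by rewrite -ab1; ring.
  have -> : dot d d = 1 - dot c c by rewrite -cd1; ring.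
  nra.
have := frob2_ge0 (W - (t + s) *: K); rewrite !frob2E fdotBl !fdotBr.
rewrite !fdotZl !fdotZr (fdotC K) WK.
have := sqr_ge0 (t + s); nra.
Qed.

Definition cplx (W : 'M[R]_N) : 'M[C]_N := map_mx (real_complex R) W.

Lemma rmx_cplx W : rmx (cplx W) = W.
Proof. by apply/matrixP => i j; rewrite !mxE. Qed.

Lemma imx_cplx W : imx (cplx W) = 0.
Proof. by apply/matrixP => i j; rewrite !mxE. Qed.

Lemma cplx_inj : injective cplx.
Proof. by move=> A B AB; rewrite -(rmx_cplx A) AB rmx_cplx. Qed.

Lemma expmx_cplx W : expmx (cplx W) = cplx (mexp W).
Proof.
have E := realify_expmx (cplx W); move: (expmx (cplx W)) E => X E.
apply: (@realify_inj R N N); rewrite E /realify !rmx_cplx !imx_cplx oppr0.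
by rewrite mexp_block (linear0 (mexp_ur W W)).
Qed.

Lemma cplx_skew W : W^T = - W -> (cplx W)^t* = - cplx W.
Proof.
move=> Ws; apply/matrixP => i j; rewrite !mxE conjC_conjc conjc_real.
by move/matrixP/(_ i j): Ws; rewrite !mxE => ->; rewrite rmorphN.
Qed.

Section Eigenrows.
Variables (W : 'M[R]_N) (P : 'M[C]_N) (t : 'I_N -> R).
Hypothesis uP : P \is unitarymx.
Hypothesis WE : cplx W = P^t* *m diag_mx (\row_j (0 +i* t j)) *m P.

Let PPt : P *m P^t* = 1%:M. Proof. exact/unitarymxP. Qed.

Lemma eigenrow_rotates j : rotates W (t j) (row j (rmx P)) (row j (imx P)).
Proof.
have PW : P *m cplx W = diag_mx (\row_j (0 +i* t j)) *m P.
  by move: (P^t*) WE PPt => V -> PV; rewrite !mulmxA PV mul1mx.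
have rw (f : C -> R) : row j (map_mx f P) = map_mx f (row j P).
  by apply/rowP => k; rewrite !mxE.
have h : row j P *m cplx W = (0 +i* t j) *: row j P.
  by rewrite -row_mul PW row_diag_mulmx mxE.
split.
  have := congr1 (@rmx R 1 N) h; rewrite rmxM rmx_cplx imx_cplx mulmx0 subr0.
  rewrite /rmx /imx !rw => ->; apply/rowP => k; rewrite !mxE.
  by case: (P j k) => x y /=; ring.
have := congr1 (@imx R 1 N) h; rewrite imxM rmx_cplx imx_cplx mulmx0 add0r.
rewrite /rmx /imx !rw => ->; apply/rowP => k; rewrite !mxE.
by case: (P j k) => x y /=; ring.
Qed.

Lemma eigenrow_dot j k :
  dot (row j (rmx P)) (row k (rmx P)) + dot (row j (imx P)) (row k (imx P)) = (j == k)%:R /\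
  dot (row j (imx P)) (row k (rmx P)) = dot (row j (rmx P)) (row k (imx P)).
Proof.
move/matrixP/(_ j k): PPt; rewrite !mxE => h.
split.
  rewrite /dot -big_split /=; transitivity (Re (\sum_i P j i * (P^t*) i k)).
    rewrite Re_sum; apply: eq_bigr => i _; rewrite !mxE conjC_conjc.
    by case: (P j i) => x y; case: (P k i) => z w /=; ring.
  by rewrite h; case: (j == k).
apply/eqP; rewrite -subr_eq0 /dot -sumrB; apply/eqP.
transitivity (Im (\sum_i P j i * (P^t*) i k)).
  rewrite Im_sum; apply: eq_bigr => i _; rewrite !mxE conjC_conjc.
  by case: (P j i) => x y; case: (P k i) => z w /=; ring.
by rewrite h; case: (j == k).
Qed.

End Eigenrows.

Lemma trmx_mexp (W : 'M[R]_N) : (mexp W)^T = mexp W^T.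
Proof.
apply: (@mxcvg_unique _ _ _ (mexp_sum W^T)); last exact: mexp_cvg.
have -> : mexp_sum W^T = (fun k => (mexp_sum W k)^T).
  apply/funext => k; rewrite /mexp_sum linear_sum; apply: eq_bigr => i _.
  rewrite linearZ /=; congr (_ *: _).
  elim: (i : nat) => [|n IH]; first by rewrite !expr0 trmx1.
  by rewrite exprSr exprS -!mulmxE trmx_mul IH.
exact: (@cvg_mxlin _ _ _ _ _ (@trmx R N N) _ _ (@mexp_cvg _ _ W)).
Qed.

Lemma cplxM A B : cplx (A *m B) = cplx A *m cplx B.
Proof. exact: map_mxM. Qed.

Lemma cplx_tr A : (cplx A)^T = cplx A^T.
Proof. by rewrite /cplx map_trmx. Qed.

(* In a unitary eigenbasis P of W, with eigenvalues i t_j, the real skew matrix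
   W' is turned into the skew-symmetric Z = P W' P^T, and the hypothesis says
   that Z_jk = 0 unless exp (i (t_j + t_k)) = 1. *)
Lemma skew_comm_of_comm_mexp W W' : W^T = - W -> W'^T = - W' ->
  frob2 W < 4 * pi ^+ 2 -> mexp W *m W' = W' *m mexp W -> W *m W' = W' *m W.
Proof.
move=> Ws W's W2 EW'.
have [P [t [uP XE]]] := skew_hermitian_spectral (cplx_skew Ws).
have rot j := eigenrow_rotates uP XE j.
have odot j k := eigenrow_dot uP j k.
have PV : P *m P^t* = 1%:M by exact/unitarymxP.
have VP : P^t* *m P = 1%:M by exact: mulmx1C.
have EE := expmx_spectral t uP; rewrite -XE expmx_cplx in EE.
move: (P^t*) PV VP XE EE => V PV VP XE EE.
set D := diag_mx _ in XE; set Delta := diag_mx _ in EE.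
have PVM M : P *m (V *m M *m P) = M *m P by rewrite !mulmxA PV mul1mx.
have PE : P *m cplx (mexp W) = Delta *m P := (etrans (congr1 (mulmx P) EE) (PVM _)).
have PX : P *m cplx W = D *m P := (etrans (congr1 (mulmx P) XE) (PVM _)).
have EEt : cplx (mexp W) *m (cplx (mexp W))^T = 1%:M.
  by rewrite cplx_tr -cplxM trmx_mexp Ws mexpKN /cplx map_mx1.
have trdiag (d : 'rV[C]_N) (M : 'M[C]_N) :
    P *m M = diag_mx d *m P -> P^T *m diag_mx d = M^T *m P^T.
  by move=> h; rewrite -[diag_mx d]tr_diag_mx -trmx_mul -h trmx_mul.
have EY : cplx (mexp W) *m cplx W' = cplx W' *m cplx (mexp W).
  by rewrite -!cplxM EW'.
have Ys : (cplx W')^T = - cplx W' by rewrite cplx_tr W's /cplx map_mxN.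
have DZ (Z : 'M[C]_N) : Z^T = - Z -> Delta *m Z *m Delta = Z -> D *m Z + Z *m D = 0.
  have dl (d : 'rV[C]_N) M j k : (diag_mx d *m M) j k = d 0 j * M j k :> C.
    by rewrite mul_diag_mx mxE.
  have dr (d : 'rV[C]_N) M j k : (M *m diag_mx d) j k = M j k * d 0 k :> C.
    by rewrite mul_mx_diag mxE.
  move=> /matrixP Zs /matrixP DZD; apply/matrixP => j k.
  rewrite [LHS]mxE dl dr [RHS]mxE; have := DZD j k; rewrite dr dl.
  have := Zs j k; rewrite !mxE.
  (* On the diagonal the condition would be on 2 t_j, and t_j = pi is allowed by the norm bound;
     there it is skewness that gives Z_jj = 0. *)
  have [<- /eqP|njk _] := eqVneq j k.
    by rewrite eq_sym eqNr => /eqP -> _; rewrite mulr0 mul0r addr0.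
  have [->|Z0] := eqVneq (Z j k) 0; first by move=> _; rewrite mulr0 mul0r addr0.
  rewrite mulrAC -[RHS]mul1r => /(mulIf Z0) /(congr1 Re).
  rewrite /cis /= -cosD => ctk; rewrite mulrC -mulrDr.
  suff tjk : t j + t k = 0.
    by apply/eqP; rewrite mulf_eq0 (negPf Z0) eq_complex /= addr0 tjk !eqxx.
  apply: cos_eq1_small ctk (le_lt_trans _ W2).
  have [e1 e2] := odot j k.
  apply: (skew_eigenpair_bound (rot j) (rot k)).
  - by rewrite (odot j j).1 eqxx.
  - by rewrite (odot k k).1 eqxx.
  - by rewrite e1 (negPf njk).
  - exact: e2.
move: (cplx (mexp W)) PE EEt EY {EE XE} => E PE EEt EY.
have Zs : (P *m cplx W' *m P^T)^T = - (P *m cplx W' *m P^T).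
  by rewrite !trmx_mul trmxK Ys mulNmx mulmxN mulmxA.
have {}DZ := DZ _ Zs.
(* Multiplied by P on the left and P^T on the right, this is D Z + Z D = 0; skewness of W then turns
   it into a commutator. *)
have : cplx W *m cplx W' + cplx W' *m (cplx W)^T = 0.
  have h : P *m (cplx W *m cplx W' + cplx W' *m (cplx W)^T) *m P^T = 0.
    rewrite -[RHS]DZ; last first.
      by rewrite -!mulmxA (trdiag _ _ PE) !mulmxA -PE -(mulmxA P) EY !mulmxA
        -(mulmxA _ E) EEt mulmx1.
    by rewrite mulmxDr mulmxDl !mulmxA PX -!mulmxA (trdiag _ _ PX).
  move/(congr1 (fun M => V *m M *m V^T)): h.
  rewrite !mulmxA VP mul1mx -mulmxA -trmx_mul VP trmx1 mulmx1.
  by rewrite mulmx0 mul0mx.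
rewrite cplx_tr Ws /cplx map_mxN mulmxN => /eqP; rewrite subr_eq0 => /eqP.
by rewrite -!map_mxM => /cplx_inj.
Qed.

(** For a nonzero eigenvalue, skewness makes the real and imaginary parts of an eigenvector
    orthogonal and of equal length, so that they span a plane turned by W. *)
Lemma skew_rotates W : W^T = - W -> mexp W = 1%:M -> W <> 0 ->
  exists t a b, [/\ rotates W t a b, dot a a = 1, dot b b = 1, dot a b = 0 &
    cos t = 1 /\ t != 0].
Proof.
move=> Ws W1 W0.
have [P [t [uP XE]]] := skew_hermitian_spectral (cplx_skew Ws).
have rot j := eigenrow_rotates uP XE j.
have odot j k := eigenrow_dot uP j k.
have PV : P *m P^t* = 1%:M by exact/unitarymxP.
have VP : P^t* *m P = 1%:M by exact: mulmx1C.
have EE := expmx_spectral t uP; rewrite -XE expmx_cplx W1 /cplx map_mx1 in EE.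
have [j tj0] : exists j, t j != 0.
  case: (pickP (fun j => t j != 0)) => [j tj0|h]; first by exists j.
  case: W0; apply: cplx_inj; rewrite XE (_ : \row_j _ = 0); last first.
    by apply/rowP => j; rewrite !mxE; have /negbFE/eqP -> := h j.
  by rewrite raddf0 mulmx0 mul0mx /cplx map_mx0.
have ctj : cos (t j) = 1.
  move/(congr1 (fun M => P *m M *m P^t*)): EE.
  rewrite mulmx1 PV !mulmxA PV mul1mx -mulmxA PV mulmx1 => /matrixP/(_ j j).
  by rewrite !mxE eqxx !mulr1n => /(congr1 Re) /esym.
have := rot j; have := (odot j j).1; rewrite eqxx mulr1n.
set u := row j (rmx P); set v := row j (imx P) => uv1 [uW vW].
have uv0 : dot u v = 0.
  have := dot_skew v v Ws; rewrite vW (dotC v) !dotZl => h.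
  have : t j * dot u v = 0 by lra.
  by move/eqP; rewrite mulf_eq0 (negPf tj0) => /eqP.
have uuvv : dot u u = dot v v.
  have := dot_skew u v Ws; rewrite uW vW (dotC u (t j *: u)) !dotZl => /eqP.
  by rewrite mulNr eqr_opp => /eqP /(mulfI tj0).
(* The two parts share a total squared length of 1 equally. *)
pose s := Num.sqrt 2 : R.
have s2 : s * s = 2 by rewrite -expr2 sqr_sqrtr.
exists (t j), (s *: u), (s *: v); split=> //.
- split; rewrite -scalemxAl ?uW ?vW !scalerA; congr (_ *: _); ring.
- by rewrite dotZl dotC dotZl mulrA s2; lra.
- by rewrite dotZl dotC dotZl mulrA s2; lra.
- by rewrite dotZl dotC dotZl dotC uv0 !mulr0.
Qed.

Lemma cube_oppmx (M : 'M[R]_N) (r : R) :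
  M *m M *m M = r *: M -> - M *m - M *m - M = r *: - M.
Proof. by move=> M3; rewrite !(mulNmx, mulmxN) !opprK M3 scalerN. Qed.

(** A plane turned by a nonzero t costs 2 t^2 >= 8 pi^2 in |W|^2, so below 16 pi^2 there is at most
    one, with |t| = 2 pi. Subtracting its part T leaves a matrix of exponential 1 and squared norm
    below 8 pi^2, hence 0. *)
Lemma skew_exp1 W : W^T = - W -> frob2 W < 16 * pi ^+ 2 -> mexp W = 1%:M ->
  W = 0 \/ exists t a b, [/\ dot a a = 1, dot b b = 1, dot a b = 0,
    t ^+ 2 = (2 * pi) ^+ 2 & W = t *: wedge b a].
Proof.
move=> Ws W2 W1; have [->|/eqP W0] := eqVneq W 0; first by left.
right; have [t [a [b [rot a1 b1 ab [ct t0]]]]] := skew_rotates Ws W1 W0.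
have split_off (V : 'M[R]_N) s u v : V^T = - V -> rotates V s u v ->
    dot u u = 1 -> dot v v = 1 -> dot u v = 0 ->
    frob2 (V - s *: wedge v u) = frob2 V - 2 * s ^+ 2.
  move=> Vs [uV vV] u1 v1 uv.
  rewrite !frob2E fdotBl !fdotBr !fdotZl !fdotZr (fdotC (wedge v u)) fdot_wedge.
  rewrite wedge_fdot uV vV !dotZl (dotC v u) uv u1 v1; ring.
have big (V : 'M[R]_N) s u v : V^T = - V -> rotates V s u v ->
    dot u u = 1 -> dot v v = 1 -> dot u v = 0 -> 2 * s ^+ 2 <= frob2 V.
  move=> Vs rV u1 v1 uv; have := frob2_ge0 (V - s *: wedge v u).
  by rewrite (split_off _ _ _ _ Vs rV u1 v1 uv) subr_ge0.
have ct_big (s : R) : cos s = 1 -> s != 0 -> 4 * pi ^+ 2 <= s ^+ 2.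
  by move=> cs s0; rewrite leNgt; apply/negP => /(cos_eq1_small cs) /eqP; apply/negP.
have t2 : t ^+ 2 = (2 * pi) ^+ 2.
  have t8 := big _ _ _ _ Ws rot a1 b1 ab; have t4 := ct_big _ ct t0.
  have pi0 := pi_gt0 R.
  (* Here 2 pi <= |t| < sqrt 8 pi, which puts |t| - 2 pi within reach of [cos_eq1_small]. *)
  have h : `|t| - 2 * pi = 0.
    apply: cos_eq1_small.
      have c2pi : cos (2 * pi) = 1 :> R.
        by rewrite mulr_natl mulr2n cosD cospi sinpi; ring.
      have ca : cos `|t| = 1 by case: ger0P => _; rewrite ?cosN.
      have s2pi : sin (2 * pi) = 0 :> R.
        by rewrite mulr_natl mulr2n sinD cospi sinpi; ring.
      by rewrite cosB ca c2pi s2pi mulr0 addr0 mulr1.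
    have e : `|t| ^+ 2 = t ^+ 2 by rewrite real_normK ?num_real.
    have := normr_ge0 t; set z := `|t| in e *; move=> z0; nra.
  rewrite -(real_normK (num_real t)); congr (_ ^+ 2); lra.
pose T := t *: wedge b a.
have Ts : T^T = - T by rewrite /T linearZ /= wedge_skew scalerN.
have [aW bW] := rot.
have Wa : W *m a^T = t *: b^T.
  have := congr1 trmx aW; rewrite trmx_mul Ws linearZ /= mulNmx scaleNr.
  exact: oppr_inj.
have Wb : W *m b^T = - t *: a^T.
  have := congr1 trmx bW; rewrite trmx_mul Ws linearZ /= mulNmx => h.
  by rewrite scaleNr -h opprK.
have WT : W *m T = T *m W.
  rewrite /T -scalemxAr -scalemxAl /wedge mulmxBr mulmxBl !mulmxA Wa Wb.
  by rewrite -!mulmxA aW bW -!scalemxAl -!scalemxAr !scaleNr addrC.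
have aT : a *m T = - t *: b.
  rewrite /T -scalemxAr /wedge mulmxBr !mulmxA !dotE ab a1 !mul_scalar_mx.
  by rewrite scale0r scale1r sub0r scalerN scaleNr.
have bT : b *m T = t *: a.
  rewrite /T -scalemxAr /wedge mulmxBr !mulmxA !dotE (dotC b a) ab b1 !mul_scalar_mx.
  by rewrite scale0r scale1r subr0.
have T3 : T *m T *m T = - (t ^+ 2) *: T.
  have T2 : T *m T = - t ^+ 2 *: (a^T *m a + b^T *m b).
    rewrite {1}/T -scalemxAl /wedge mulmxBl -!mulmxA aT bT -!scalemxAr.
    by rewrite scaleNr -opprD -scalerDr scalerN scalerA -scaleNr -expr2 [b^T *m b + _]addrC.
  have wa : wedge b a *m a^T = b^T.
    by rewrite /wedge mulmxBl -!mulmxA !dotE a1 (dotC b) ab !mul_mx_scalar scale0r subr0 scale1r.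
  have wb : wedge b a *m b^T = - a^T.
    by rewrite /wedge mulmxBl -!mulmxA !dotE b1 ab !mul_mx_scalar scale0r sub0r scale1r.
  rewrite -mulmxA T2 {1}/T -scalemxAl -scalemxAr mulmxDr !mulmxA wa wb mulNmx.
  by rewrite /T /wedge !scalerA; congr (_ *: _); ring.
have NT3 : - T *m - T *m - T = - (t ^+ 2) *: - T.
  by exact: cube_oppmx.
have ENT : mexp (- T) = 1%:M.
  rewrite (mexp_rodrigues t0 NT3) ct subrr mul0r scale0r addr0.
  suff -> : sin t = 0 by rewrite mul0r scale0r addr0.
  by have := cos2Dsin2 t; rewrite ct expr1n => /eqP; rewrite -subr_eq0 addrC addKr sqrf_eq0 => /eqP.
have W'1 : mexp (W - T) = 1%:M.
  by rewrite mexpD ?W1 ?ENT ?mulmx1// mulmxN mulNmx WT.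
have W's : (W - T)^T = - (W - T) by rewrite linearB /= Ws Ts opprD.
have W'0 : W - T = 0.
  have [//|/eqP nz] := eqVneq (W - T) 0.
  have [t' [a' [b' [rot' a'1 b'1 ab' [ct' t'0]]]]] := skew_rotates W's W'1 nz.
  exfalso; have := big _ _ _ _ W's rot' a'1 b'1 ab'; have := ct_big _ ct' t'0.
  rewrite (split_off _ _ _ _ Ws rot a1 b1 ab) t2; lra.
exists t, a, b; split=> //; apply/eqP; rewrite -subr_eq0; exact/eqP.
Qed.

End RealSkewMatrices.

(** * The Spin groups *)

Section SpinGroup.
Variables (R : realType) (N : nat).
Local Notation cl := (clifford R N).
Local Notation vec := (@clvec R N).
Local Notation K := #|{: {set 'I_N}}|.
Implicit Types (S W : 'M[R]_N) (u v : 'rV[R]_N) (x y z : cl).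

Lemma mul_rV_lin1_linear m n (f : 'rV[R]_m -> 'rV[R]_n) (u : 'rV[R]_m) :
  linear f -> u *m lin1_mx f = f u.
Proof.
move=> lf.
pose F : {linear 'rV[R]_m -> 'rV[R]_n} := HB.pack f (GRing.isLinear.Build _ _ _ _ _ lf).
exact: (mul_rV_lin1 F u).
Qed.

(** With row vectors, right multiplications compose in the order of the product and left ones in the
    reverse order. The former give the faithful representation for the lower bound; both together
    give conjugation. *)
Definition rmulmx x : 'M[R]_K := lin1_mx (fun y : 'rV[R]_K => (y : cl) * x : 'rV[R]_K).
Definition lmulmx x : 'M[R]_K := lin1_mx (fun y : 'rV[R]_K => x * (y : cl) : 'rV[R]_K).

Lemma rmulmxE (y : 'rV[R]_K) x : y *m rmulmx x = (y : cl) * x.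
Proof.
apply: (@mul_rV_lin1_linear K K (fun y => (y : cl) * x)) => a y1 y2.
by rewrite -[LHS]/(((a *: (y1 : cl) + (y2 : cl)) * x : cl)) mulrDl -scalerAl.
Qed.

Lemma lmulmxE (y : 'rV[R]_K) x : y *m lmulmx x = x * (y : cl).
Proof.
apply: (@mul_rV_lin1_linear K K (fun y => x * (y : cl))) => a y1 y2.
by rewrite -[LHS]/((x * (a *: (y1 : cl) + (y2 : cl)) : cl)) mulrDr -scalerAr.
Qed.

Lemma eq_mx_rV m n (A B : 'M[R]_(m, n)) : (forall u : 'rV[R]_m, u *m A = u *m B) -> A = B.
Proof. by move=> AB; apply/row_matrixP => i; rewrite !rowE. Qed.

Lemma rmulmx1 : rmulmx 1 = 1%:M.
Proof. by apply: eq_mx_rV => u; rewrite rmulmxE mulr1 mulmx1. Qed.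

Lemma lmulmx1 : lmulmx 1 = 1%:M.
Proof. by apply: eq_mx_rV => u; rewrite lmulmxE mul1r mulmx1. Qed.

Lemma rmulmxM x y : rmulmx (x * y) = rmulmx x *m rmulmx y.
Proof. by apply: eq_mx_rV => u; rewrite mulmxA !rmulmxE mulrA. Qed.

Lemma lmulmxM x y : lmulmx (x * y) = lmulmx y *m lmulmx x.
Proof. by apply: eq_mx_rV => u; rewrite mulmxA !lmulmxE mulrA. Qed.

Lemma rmulmx_linear : linear (rmulmx : 'rV[R]_K -> 'M[R]_K).
Proof.
move=> a x y; apply: eq_mx_rV => u; rewrite mulmxDr -scalemxAr !rmulmxE.
by rewrite -[LHS]/((u : cl) * (a *: (x : cl) + (y : cl)) : cl) mulrDr -scalerAr.
Qed.

Lemma rmulmxZ (t : R) x : rmulmx (t *: x) = t *: rmulmx x.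
Proof.
apply: eq_mx_rV => u; rewrite -scalemxAr !rmulmxE.
by rewrite -[LHS]/((u : cl) * (t *: (x : cl)) : cl) -scalerAr.
Qed.

Lemma rmulmxN x : rmulmx (- x) = - rmulmx x.
Proof. by rewrite -scaleN1r rmulmxZ scaleN1r. Qed.

Lemma rmulmx_inj x y : rmulmx x = rmulmx y -> x = y.
Proof. by move=> /(congr1 (mulmx ((1 : cl) : 'rV[R]_K))); rewrite !rmulmxE !mul1r. Qed.

Lemma lmulmx_linear : linear (lmulmx : 'rV[R]_K -> 'M[R]_K).
Proof.
move=> a x y; apply: eq_mx_rV => u; rewrite mulmxDr -scalemxAr !lmulmxE.
by rewrite -[LHS]/((a *: (x : cl) + (y : cl)) * (u : cl) : cl) mulrDl -scalerAl.
Qed.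

Definition rmul_lin : {linear 'rV[R]_K -> 'M[R]_K} :=
  HB.pack (rmulmx : 'rV[R]_K -> 'M[R]_K) (GRing.isLinear.Build _ _ _ _ _ rmulmx_linear).
Definition lmul_lin : {linear 'rV[R]_K -> 'M[R]_K} :=
  HB.pack (lmulmx : 'rV[R]_K -> 'M[R]_K) (GRing.isLinear.Build _ _ _ _ _ lmulmx_linear).

Definition clexp_sum x (n : nat) : 'rV[R]_K := \sum_(k < n) (k`!%:R)^-1 *: (x ^+ k : cl).

Lemma rmulmx_expr x k : rmulmx (x ^+ k) = (rmulmx x ^+ k : 'M[R]_K).
Proof.
elim: k => [|k IH]; first by rewrite !expr0 rmulmx1.
by rewrite !exprS rmulmxM IH.
Qed.

Lemma lmulmx_expr x k : lmulmx (x ^+ k) = (lmulmx x ^+ k : 'M[R]_K).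
Proof.
elim: k => [|k IH]; first by rewrite !expr0 lmulmx1.
by rewrite exprSr exprS lmulmxM IH.
Qed.

Lemma linear_clexp_sum (f : {linear 'rV[R]_K -> 'M[R]_K}) x n :
  (forall k, f (x ^+ k : cl) = (f (x : cl) ^+ k : 'M[R]_K)) ->
  f (clexp_sum x n) = mexp_sum (f (x : cl)) n.
Proof.
move=> fX; rewrite /clexp_sum /mexp_sum linear_sum; apply: eq_bigr => k _.
by rewrite linearZ fX.
Qed.

Lemma clexp_cvg x : clexp_sum x @ \oo --> (clexp x : 'rV[R]_K).
Proof.
have h : clexp_sum x @ \oo --> ((1 : cl) : 'rV[R]_K) *m mexp (rmulmx x).
  have -> : clexp_sum x = fun n => ((1 : cl) : 'rV[R]_K) *m mexp_sum (rmulmx x) n.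
    apply/funext => n; rewrite -(@linear_clexp_sum rmul_lin) /=; last exact: rmulmx_expr.
    by rewrite rmulmxE mul1r.
  exact: (@cvg_mxlin _ _ _ _ _ (mulmx ((1 : cl) : 'rV[R]_K)) _ _ (@mexp_cvg _ _ _)).
suff -> : (clexp x : 'rV[R]_K) = ((1 : cl) : 'rV[R]_K) *m mexp (rmulmx x) by [].
by apply: (cvg_lim _ h); exact: norm_hausdorff.
Qed.

Lemma linear_clexp (f : {linear 'rV[R]_K -> 'M[R]_K}) x :
  (forall k, f (x ^+ k : cl) = (f (x : cl) ^+ k : 'M[R]_K)) ->
  f (clexp x) = mexp (f (x : cl)).
Proof.
move=> fX; apply: (@mxcvg_unique _ _ _ (fun n => f (clexp_sum x n))).
  exact: (@cvg_mxlin _ _ _ _ _ f _ _ (@clexp_cvg x)).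
have -> : (fun n => f (clexp_sum x n)) = mexp_sum (f (x : cl)).
  by apply/funext => n; exact: linear_clexp_sum.
exact: mexp_cvg.
Qed.

Lemma rmulmx_clexp x : rmulmx (clexp x) = mexp (rmulmx x).
Proof. exact: (@linear_clexp rmul_lin x (rmulmx_expr x)). Qed.

Lemma lmulmx_clexp x : lmulmx (clexp x) = mexp (lmulmx x).
Proof. exact: (@linear_clexp lmul_lin x (lmulmx_expr x)). Qed.

(* Left and right multiplications by x commute, so that exponentiating
   xW on the vectors gives conjugation by clexp x. *)
Lemma clexp_conj_vec x W v : (forall u, x * vec u - vec u * x = vec (u *m W)) ->
  clexp x * vec v = vec (v *m mexp W) * clexp x.
Proof.
move=> xW; pose c : 'M[R]_(N, K) := lin1_mx (vec : 'rV[R]_N -> 'rV[R]_K).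
have cE u : u *m c = vec u.
  by apply: mul_rV_lin1_linear => a u1 u2; exact: clvec_linear.
have Wc : W *m c = c *m (lmulmx x - rmulmx x).
  apply: eq_mx_rV => u; rewrite !mulmxA !cE mulmxBr lmulmxE rmulmxE.
  by rewrite -xW.
have lr : lmulmx x *m - rmulmx x = - rmulmx x *m lmulmx x.
  rewrite mulmxN mulNmx; congr (- _); apply: eq_mx_rV => u.
  by rewrite !mulmxA !lmulmxE !rmulmxE mulrA.
have := mexp_intertwine Wc; rewrite mexpD // mulmxA.
move=> /(congr1 (mulmx^~ (mexp (rmulmx x)))); rewrite -[RHS]mulmxA mexpNK mulmx1.
move=> /(congr1 (mulmx v)); rewrite !mulmxA !cE.
by rewrite -rmulmx_clexp -lmulmx_clexp lmulmxE rmulmxE.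
Qed.

Lemma clexp_mulIr x y z : y * clexp x = z * clexp x -> y = z.
Proof.
move=> yz; have : (y : 'rV[R]_K) *m mexp (rmulmx x) = (z : 'rV[R]_K) *m mexp (rmulmx x).
  by rewrite -rmulmx_clexp !rmulmxE yz.
move=> /(congr1 (mulmx^~ (mexp (- rmulmx x)))).
by rewrite -!mulmxA mexpKN !mulmx1.
Qed.

Let spin_inner x y : R := - \tr (spin_to_so x *m spin_to_so y).

Lemma spin_inner_biv S : S^T = - S -> spin_inner (biv S) (biv S) = frob2 (4 *: S).
Proof.
move=> Ss; rewrite /spin_inner spin_to_so_biv // frob2E /fdot mulmxN mulNmx opprK.
by rewrite [(4 *: S)^T]linearZ /= Ss scalerN mulmxN raddfN.
Qed.

Lemma skew4 S : S^T = - S -> (4 *: S)^T = - (4 *: S).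
Proof. by move=> Ss; rewrite linearZ /= Ss scalerN. Qed.

(** Conjugation by clexp z acts on vectors as [mexp (4 *: S)], up to the row convention. The
    question is thus pushed down to skew matrices, settled there, and lifted back by
    [biv_comm_biv]. *)
Lemma spin_comm_of_comm_exp z z' : bivector z -> bivector z' ->
  spin_inner z z < (2 * pi) ^+ 2 -> clexp z * z' = z' * clexp z -> z * z' = z' * z.
Proof.
move=> /bivectorP[S [Ss ->]] /bivectorP[S' [S's ->]].
rewrite spin_inner_biv // => S2 h.
set x := biv S in h *; set y := biv S' in h *.
have xv u := clexp_conj_vec u (fun u => biv_comm_vec u Ss).
have EW : mexp (4 *: S) *m (4 *: S') = (4 *: S') *m mexp (4 *: S).
  apply: eq_mx_rV => u; apply: clvec_inj; rewrite !mulmxA.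
  rewrite -[LHS]biv_comm_vec // -/y; apply: (@clexp_mulIr x).
  rewrite -/x in xv; rewrite -xv -(biv_comm_vec u S's) -/y.
  rewrite mulrBl mulrBr -!mulrA -xv; congr (_ - _).
    by rewrite !mulrA h.
  by rewrite [clexp x * _]mulrA xv -mulrA h.
have S2' : frob2 (4 *: S) < 4 * pi ^+ 2 by move: S2; rewrite exprMn expr2; lra.
have WW := skew_comm_of_comm_mexp (skew4 Ss) (skew4 S's) S2' EW.
apply/eqP; rewrite -subr_eq0 biv_comm_biv // (_ : S' *m S - S *m S' = 0).
  by rewrite scaler0 linear0.
move: WW; rewrite -!scalemxAl -!scalemxAr => /scalerI h4.
apply/eqP; rewrite subr_eq0; apply/eqP.
by apply: (@scalerI _ _ (4 : R)); rewrite ?pnatr_eq0 ?h4 ?pnatr_eq0.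
Qed.

(* In SO(N), 2 pi (b^T a - a^T b) also has exponential 1, but its lift
   pi (vec b * vec a) to the Clifford algebra has exponential -1. *)
Lemma spin_exp1 x : bivector x -> spin_inner x x < 4 * (2 * pi) ^+ 2 ->
  clexp x = 1 -> x = 0.
Proof.
move=> /bivectorP[S [Ss ->]]; rewrite spin_inner_biv // => S2 h.
have W1 : mexp (4 *: S) = 1%:M.
  apply: eq_mx_rV => u; apply: clvec_inj; rewrite mulmx1.
  by have := clexp_conj_vec u (fun u => biv_comm_vec u Ss); rewrite h mul1r mulr1.
have S2' : frob2 (4 *: S) < 16 * pi ^+ 2 by move: S2; rewrite exprMn expr2; lra.
case: (skew_exp1 (skew4 Ss) S2' W1) => [/eqP|[t [a [b [a1 b1 ab t2 SE]]]]].
  by rewrite scaler_eq0 pnatr_eq0 => /eqP ->; exact: linear0.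
have t0 : t / 2 != 0.
  apply/eqP => t0; have : t = 0 by move: t0; lra.
  move=> t00; move: t2; rewrite t00 expr0n => /esym/eqP.
  by rewrite sqrf_eq0 mulf_eq0 pnatr_eq0 (gt_eqF (pi_gt0 R)).
(* [q] squares to -1 and the angle is halved by the lift: Rodrigues' formula at t / 2 = pi or - pi
   turns the hypothesis into 1 = -1. *)
pose q : cl := vec b * vec a.
have qN : vec a * vec b = - q.
  have := clvec_relation a b; rewrite ab mulr0 scale0r => /eqP.
  by rewrite addr_eq0 => /eqP.
have xE : biv S = (t / 2) *: q.
  have -> : S = (t / 4) *: wedge b a.
    apply: (@scalerI _ _ (4 : R)); first by rewrite pnatr_eq0.
    by rewrite SE scalerA; congr (_ *: _); field.
  rewrite linearZ /= /wedge linearB /= !biv_outer qN opprK -/q -mulr2n -[X in _ *: X](scaler_nat 2 q) scalerA.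
  by congr (_ *: _); field.
have q2 : q * q = - 1.
  rewrite /q -mulrA [vec a * _]mulrA qN /q mulNr mulrN !mulrA clvec_sqr b1.
  by rewrite -scalerAl mul1r -scalerAl clvec_sqr a1 !scaleN1r opprK.
have X2 : rmulmx (biv S) *m rmulmx (biv S) = - ((t / 2) ^+ 2) *: 1%:M.
  rewrite xE rmulmxZ -scalemxAl -scalemxAr scalerA -rmulmxM q2 rmulmxN rmulmx1.
  by rewrite scalerN -scaleNr expr2.
have := mexp_rodrigues t0 (X := rmulmx (biv S)).
rewrite X2 -scalemxAl mul1mx => /(_ erefl).
have tE : t / 2 = pi \/ t / 2 = - pi.
  have /eqP : (t / 2) ^+ 2 = pi ^+ 2 by rewrite exprMn t2; field.
  by rewrite eqf_sqr => /orP[]/eqP ->; [left|right].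
have -> : sin (t / 2) = 0 by case: tE => ->; rewrite ?sinN sinpi ?oppr0.
have -> : cos (t / 2) = -1 by case: tE => ->; rewrite ?cosN cospi.
rewrite -rmulmx_clexp h rmulmx1 mul0r scale0r addr0 scalerA.
rewrite (_ : (1 - -1) / (t / 2) ^+ 2 * - (t / 2) ^+ 2 = - 2); last by move: (t / 2) t0 => s s0; field.
move=> /(congr1 (mulmx ((1 : cl) : 'rV[R]_K))); rewrite mulmxDr -scalemxAr mulmx1.
move=> /eqP; rewrite -subr_eq0 opprD addrA subrr sub0r oppr_eq0 scaler_eq0 oppr_eq0 pnatr_eq0 /=.
by have := oner_neq0 cl => /negP one0 one0'; case: (one0 one0').
Qed.

(** A unit vector squares to -1, so its inverse is its opposite. *)
Lemma clvec_prod_unit (s : seq 'rV[R]_N) : (forall v, v \in s -> v *m v^T = 1%:M) ->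
  exists y, y * \prod_(v <- s) vec v = 1.
Proof.
elim: s => [_|v s IH vs]; first by exists 1; rewrite big_nil mul1r.
have [y yE] : exists y, y * \prod_(v <- s) vec v = 1.
  by apply: IH => u us; apply: vs; rewrite inE us orbT.
exists (- (y * vec v)); rewrite big_cons mulNr -mulrA [vec v * (_ * _)]mulrA clvec_sqr.
have -> : dot v v = 1.
  have /matrixP/(_ 0 0) := vs v (mem_head _ _).
  by rewrite dotE !mxE eqxx !mulr1n.
by rewrite scaleN1r mulNr mul1r mulrN opprK.
Qed.

Lemma clexp_opp_eq x : x * x * x = - pi ^+ 2 *: x -> clexp x = clexp (- x).
Proof.
move=> x3; have X3 : rmulmx x *m rmulmx x *m rmulmx x = - pi ^+ 2 *: rmulmx x.
  by rewrite -!rmulmxM x3 rmulmxZ.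
by apply: rmulmx_inj; rewrite !rmulmx_clexp rmulmxN; exact: mexp_opp_eq.
Qed.

Lemma bivector_biv S : S^T = - S -> bivector (biv S).
Proof. by move=> Ss; apply/bivectorP; exists S. Qed.

Lemma bivector_lin (t : R) x y : bivector x -> bivector y -> bivector (t *: x + y).
Proof.
move=> /bivectorP[S [Ss ->]] /bivectorP[S' [S's ->]].
have -> : t *: biv S + biv S' = biv (t *: S + S') by rewrite biv_linear.
by apply: bivector_biv; rewrite linearD linearZ /= Ss S's scalerN opprD.
Qed.

Lemma Spin_injectivity_radius_ge (p q : cl) : q * p = 1 ->
  ((2 * pi)%:E <= @injectivity_radius_at R (Spin R N) p)%E.
Proof.
move=> qp.
have piR : 0 < 2 * pi :> R by rewrite mulr_gt0// pi_gt0.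
(* The constant 8 is the quotient of the metric |4 S|^2 = 16 |S|^2 by the squared norm 2 |S|^2 of
   the coordinates; evaluation at 1 recovers x from [rmulmx x]. *)
apply: (@injectivity_radius_at_ge R cl 1 K K id id (@clexp R N) (@lie_points R (Spin R N))
  (@bivector R N) spin_inner rmulmx rmul_lin (mulmx ((1 : cl) : 'rV[R]_K)) _ 8
  _ _ _ _ _ _ _ _ _ _ _ _ _ _ p q piR qp).
- by move=> x.
- by move=> x.
- by move=> x y.
- by move=> x.
- by move=> x; rewrite /= rmulmxE mul1r.
- exact: rmulmx1.
- exact: rmulmxM.
- exact: rmulmx_clexp.
- by rewrite -(linear0 (@biv R N)); apply: bivector_biv; rewrite trmx0 oppr0.
- by move=> t x y; exact: bivector_lin.
- by rewrite ltr0n.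
- move=> x /bivectorP[S [Ss ->]]; rewrite spin_inner_biv // frob2_biv //.
  by rewrite !frob2E /fdot linearZ /= -scalemxAl -scalemxAr !linearZ /=; ring.
- move=> x y; exact: spin_comm_of_comm_exp.
- move=> x; exact: spin_exp1.
Qed.

(** Used with p and q the unit bivectors of two orthogonal planes; after scaling by pi / 2 the
    factor 4 becomes pi^2. *)
Lemma sum_roots_cube (A : pzRingType) (p q : A) :
  p * p = -1 -> q * q = -1 -> p * q = q * p ->
  (p + q) * (p + q) * (p + q) = - ((p + q) *+ 4).
Proof.
move=> p2 q2 pq.
have s2 : (p + q) * (p + q) = (p * q - 1) *+ 2.
  by rewrite mulrDl !mulrDr p2 q2 -pq [X in X + _]addrC mulr2n.
have pqs : p * q * (p + q) = - (p + q).
  rewrite mulrDr -[p * q * q]mulrA q2 mulrN1 pq -mulrA p2 mulrN1.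
  by rewrite opprD addrC.
by rewrite s2 mulrnAl mulrBl pqs mul1r -opprD -mulr2n mulNrn -mulrnA.
Qed.

(** Half turns in two orthogonal planes, of norm 2 pi, are shorter than a full turn in one plane, of
    norm 2 sqrt 2 pi, and reversing both gives the same element of Spin. This takes four orthonormal
    vectors. *)
Lemma Spin_injectivity_radius_le (p : cl) (u : nat -> 'rV[R]_N) :
  (forall i j, (i < 4)%N -> (j < 4)%N -> dot (u i) (u j) = (i == j)%:R) ->
  (@injectivity_radius_at R (Spin R N) p <= (2 * pi)%:E)%E.
Proof.
move=> uu.
have pi0 : 0 < pi :> R by exact: pi_gt0.
have vv i : (i < 4)%N -> vec (u i) * vec (u i) = -1.
  by move=> i4; rewrite clvec_sqr uu // eqxx scaleN1r.
have vC i j : (i < 4)%N -> (j < 4)%N -> i != j ->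
    vec (u i) * vec (u j) = - (vec (u j) * vec (u i)).
  move=> i4 j4 /negPf ij; have := clvec_relation (u i) (u j).
  by rewrite uu // ij mulr0 scale0r => /eqP; rewrite addr_eq0 => /eqP.
(* [biv] doubles each wedge, so the coefficient pi / 4 on [w] gives pi / 2 in the Clifford algebra
   and, through the factor 4, the angle pi on vectors. *)
pose w := wedge (u 0%N) (u 1%N) + wedge (u 2%N) (u 3%N).
have ww : fdot w w = 4.
  by rewrite /w fdotDl 2!fdotDr !wedge_fdot !uu //=; ring.
have ws (t : R) : (t *: w)^T = - (t *: w).
  by rewrite linearZ /= linearD /= !wedge_skew -opprD scalerN.
have inner_w (t : R) : t ^+ 2 = (pi / 4) ^+ 2 ->
    Num.sqrt (spin_inner (biv (t *: w)) (biv (t *: w))) <= 2 * pi.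
  move=> t2; rewrite spin_inner_biv // frob2E !fdotZl !fdotZr ww.
  rewrite (_ : _ * _ = (2 * pi) ^+ 2); first by rewrite sqrtr_sqr ger0_norm // mulr_ge0 // ltW.
  by transitivity (64 * t ^+ 2); [ring|rewrite t2; field].
pose a := vec (u 0%N); pose b := vec (u 1%N); pose c := vec (u 2%N); pose d := vec (u 3%N).
have xE : biv ((pi / 4) *: w) = (pi / 2) *: (a * b + c * d).
  rewrite linearZ /= linearD /= /wedge !linearB /= !biv_outer -/a -/b -/c -/d.
  rewrite (vC 1%N 0%N) // (vC 3%N 2%N) // !opprK -/a -/b -/c -/d.
  rewrite -!mulr2n -mulrnDl -(scaler_nat 2 (a * b + c * d)) scalerA.
  by congr (_ *: _); field.
have p2 : (a * b) * (a * b) = -1.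
  by rewrite mulrA -[a * b * a]mulrA (vC 1%N 0%N) // mulrN mulrA vv // mulN1r opprK vv.
have q2 : (c * d) * (c * d) = -1.
  by rewrite mulrA -[c * d * c]mulrA (vC 3%N 2%N) // mulrN mulrA vv // mulN1r opprK vv.
have cdC i : (i < 2)%N -> vec (u i) * (c * d) = c * d * vec (u i).
  move=> i2; rewrite mulrA (vC i 2%N); [|by case: i i2 => [|[]]..].
  by rewrite mulNr -[in LHS]mulrA (vC i 3%N) ?mulrN ?opprK ?mulrA //; case: i i2 => [|[]].
have pq : (a * b) * (c * d) = (c * d) * (a * b).
  by rewrite -mulrA (cdC 1%N) // mulrA (cdC 0%N) // mulrA.
set x := biv ((pi / 4) *: w) in xE.
have x3 : x * x * x = - pi ^+ 2 *: x.
  rewrite xE -!(scalerAl, scalerAr) (sum_roots_cube p2 q2 pq) -(scaler_nat 4 (a * b + c * d)).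
  rewrite -scaleNr !scalerA.
  by congr (_ *: _); field.
have xN : - x = biv ((- (pi / 4)) *: w) by rewrite scaleNr linearN.
have nx : x <> - x.
  move=> xx; have x0 : x = 0.
    apply/eqP; have : x *+ 2 == 0 by rewrite mulr2n {1}xx addNr.
    by rewrite -scaler_nat scaler_eq0 pnatr_eq0.
  have := frob2_biv (ws (pi / 4)); rewrite -/x x0 frob2E !fdotZl !fdotZr ww.
  have -> : frob2 ((0 : cl) : 'rV[R]_K) = 0 by rewrite frob2_clcoef big1 // => A _; rewrite /clcoef mxE expr0n.
  by apply/eqP; rewrite eq_sym !mulf_neq0 // ?invr_neq0 ?pnatr_eq0 ?(gt_eqF pi0).
apply: (@injectivity_radius_at_le R (Spin R N) p x (- x)).
- exact: bivector_biv.
- by rewrite xN; exact: bivector_biv.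
- exact: inner_w.
- by rewrite xN; apply: inner_w; rewrite sqrrN.
- exact: clexp_opp_eq.
- exact: nx.
Qed.

End SpinGroup.

Lemma Spin_injectivity_radius (R : realType) N : (4 <= N)%N ->
  injectivity_radius (Spin R N) = (2 * pi)%:E.
Proof.
case: N => [|[|[|[|n]]]] // _; apply: injectivity_radius_eq.
  by exists 1, [::]; rewrite big_nil.
move=> p [s [_ s1 ->]]; apply/eqP; rewrite eq_le; apply/andP; split.
  apply: (@Spin_injectivity_radius_le _ _ _ (fun i => delta_mx 0 (inord i))) => i j i4 j4.
  rewrite /dot (bigD1 (inord i)) //= big1 => [|k /negPf ki]; rewrite !mxE ?eqxx ?ki ?mul0r //=.
  rewrite mul1r addr0 -val_eqE /= !inordK //.
    exact: leq_trans j4 _.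
  exact: leq_trans i4 _.
have [q qE] := clvec_prod_unit s1; exact: Spin_injectivity_radius_ge qE.
Qed.

Theorem theorem4p1 (R : realType) :
  [/\ (forall m : nat, (1 <= m)%N ->
         injectivity_radius (SU R (m + 1)) = (Num.sqrt 2 * pi)%:E),
      (forall m : nat, (3 <= m)%N ->
         injectivity_radius (Sp R m) = (Num.sqrt 2 * pi)%:E),
      (forall m : nat, (4 <= m)%N ->
         injectivity_radius (Spin R (2 * m)) = (2 * pi)%:E) &
      (forall m : nat, (2 <= m)%N ->
         injectivity_radius (Spin R (2 * m + 1)) = (2 * pi)%:E)] /\
  [/\ (forall m m' : nat, (1 <= m)%N -> (1 <= m')%N ->
         injectivity_radius (SU R (m + 1)) =
         injectivity_radius (SU R (m' + 1))),
      (forall m m' : nat, (3 <= m)%N -> (3 <= m')%N ->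
         injectivity_radius (Sp R m) = injectivity_radius (Sp R m')),
      (forall m m' : nat, (4 <= m)%N -> (4 <= m')%N ->
         injectivity_radius (Spin R (2 * m)) =
         injectivity_radius (Spin R (2 * m'))) &
      (forall m m' : nat, (2 <= m)%N -> (2 <= m')%N ->
         injectivity_radius (Spin R (2 * m + 1)) =
         injectivity_radius (Spin R (2 * m' + 1)))].
Proof.
have Spin_even m : (4 <= m)%N -> injectivity_radius (Spin R (2 * m)) = (2 * pi)%:E.
  by move=> m4; apply: Spin_injectivity_radius; rewrite (leq_trans m4)// leq_pmull.
have Spin_odd m : (2 <= m)%N -> injectivity_radius (Spin R (2 * m + 1)) = (2 * pi)%:E.
  move=> m2; apply: Spin_injectivity_radius.
  by rewrite addn1 leqW // (leq_mul (leqnn 2) m2).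
have Sp_3 m : (3 <= m)%N -> injectivity_radius (Sp R m) = (Num.sqrt 2 * pi)%:E.
  by move=> m3; apply: Sp_injectivity_radius; exact: leq_trans m3.
split; split.
- exact: SU_injectivity_radius.
- exact: Sp_3.
- exact: Spin_even.
- exact: Spin_odd.
- by move=> m m' h h'; rewrite !SU_injectivity_radius.
- by move=> m m' h h'; rewrite !Sp_3.
- by move=> m m' h h'; rewrite !Spin_even.
- by move=> m m' h h'; rewrite !Spin_odd.
Qed.
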